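(* Let $K$ be a real valued field (of any characteristic), let $x=(x_1,\dots,x_n)$, $s=(s_1,\dots,s_l)$, $Y=(Y_1,\dots,Y_p)$, $Z=(Z_1,\dots,Z_q)$ be variables, let $I\subset K\{s\}$ be an ideal, $\mathfrak m=\langle s_1,\dots,s_l\rangle\subset K\{s\}$, and let $F=(F_1,\dots,F_N)\in K\{x,s,Y,Z\}^N$. Let $e_0\in\mathbb N$. Suppose that the system of equations $F\equiv0 \bmod I$ has a solution $(y^{(e_0)},z^{(e_0)})$ of order $e_0$. Suppose moreover that for all $e\ge e_0$ every solution $(y^{(e)},z^{(e)})$ of order $e$ with $y^{(e)}\equiv y^{(e_0)}\bmod \mathfrak m^{e_0+1}$ and $z^{(e)}\equiv z^{(e_0)}\bmod \mathfrak m^{e_0+1}$ extends to a solution $(y^{(e)}+u^{(e)},\,z^{(e)}+v^{(e)})$ of order $e+1$, with $u^{(e)}\in K[s]^p$ and $v^{(e)}\in K\{x\}[s]^q$ homogeneous of degree $e+1$ in $s$. Then the system of equations $F\equiv0\bmod I$ has an analytic solution $(y,z)$ with $y\equiv y^{(e_0)}\bmod \mathfrak m^{e_0+1}$ and $z\equiv z^{(e_0)}\bmod\mathfrak m^{e_0+1}$.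
   Context: A real valued field is a field $K$ with a map $|\ |:K\to\mathbb R_{\ge 0}$ such that $|a|=0\Leftrightarrow a=0$, $|ab|=|a||b|$, $|a+b|\le|a|+|b|$ (the trivial valuation is allowed; $K$ need not be complete). A power series $\sum c_\alpha x^\alpha\in K[[x]]$ is convergent if $\sum|c_\alpha|\varepsilon^\alpha<\infty$ for some $\varepsilon\in(\mathbb R_{>0})^n$; $K\{x\}$ is the ring of convergent power series (similarly in other sets of variables). $\mathbb N$ includes $0$. A solution of order $e$ of $F\equiv0\bmod I$ is a pair $(y,z)\in K[s]^p\times K\{x\}[s]^q$ such that $F(x,s,y(s),z(x,s))\equiv0\bmod (I+\mathfrak m^{e+1})\cdot K\{x,s\}^N$. An analytic solution of $F\equiv 0\bmod I$ is a pair $(y,z)\in K\{s\}^p\times K\{x,s\}^q$ such that $F(x,s,y(s),z(x,s))\equiv0\bmod I\cdot K\{x,s\}^N$. Congruences modulo $\mathfrak m^{e_0+1}$ are componentwise, modulo $\mathfrak m^{e_0+1}$ in $K\{s\}$ for $y$ and modulo $\mathfrak m^{e_0+1}K\{x,s\}$ for $z$. *)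

(* Defs.v *)
From HB Require Import structures.
From mathcomp Require Import all_boot all_order all_algebra.
From mathcomp Require Import all_classical all_reals ereal esum.

Set Implicit Arguments.
Unset Strict Implicit.
Unset Printing Implicit Defensive.

Import Order.TTheory GRing.Theory Num.Theory.

Local Open Scope classical_set_scope.
Local Open Scope ring_scope.

(* The variables are indexed by a finite type: blocks of variables are put   *)
(* together by taking sums of finite types.                                  *)

Notation mon V := {ffun V -> nat}.

Definition mdeg (V : finType) (a : mon V) : nat := (\sum_(i : V) a i)%N.

Definition mjoin (V W : finType) (a : mon V) (b : mon W) : mon (V + W)%type :=
  [ffun i => match i with inl j => a j | inr k => b k end].

Definition lmon (V W : finType) (a : mon (V + W)%type) : mon V :=
  [ffun i => a (inl i)].

Definition rmon (V W : finType) (a : mon (V + W)%type) : mon W :=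
  [ffun i => a (inr i)].

Record powser (V : finType) (A : Type) := Powser { ps_coef : mon V -> A }.

HB.instance Definition _ (V : finType) (A : Type) :=
  gen_eqMixin (powser V A).
HB.instance Definition _ (V : finType) (A : Type) :=
  gen_choiceMixin (powser V A).

Lemma powserP (V : finType) (A : Type) (f g : powser V A) :
  ps_coef f =1 ps_coef g <-> f = g.
Proof.
split=> [|->//]; case: f g => [f] [g] /= fg; congr Powser; exact/funext.
Qed.

Section PowserZmodule.
Variables (V : finType) (A : zmodType).
Implicit Types f g h : powser V A.

Definition ps_zero : powser V A := Powser (fun _ => 0).
Definition ps_opp f : powser V A := Powser (fun a => - ps_coef f a).
Definition ps_add f g : powser V A := Powser (fun a => ps_coef f a + ps_coef g a).

Lemma ps_addA : associative ps_add.
Proof. by move=> f g h; apply/powserP => a /=; rewrite addrA. Qed.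

Lemma ps_addC : commutative ps_add.
Proof. by move=> f g; apply/powserP => a /=; rewrite addrC. Qed.

Lemma ps_add0 : left_id ps_zero ps_add.
Proof. by move=> f; apply/powserP => a /=; rewrite add0r. Qed.

Lemma ps_addN : left_inverse ps_zero ps_opp ps_add.
Proof. by move=> f; apply/powserP => a /=; rewrite addNr. Qed.

HB.instance Definition _ :=
  GRing.isZmodule.Build (powser V A) ps_addA ps_addC ps_add0 ps_addN.

Lemma ps_coef0 a : ps_coef (0 : powser V A) a = 0. Proof. by []. Qed.
Lemma ps_coefN f a : ps_coef (- f) a = - ps_coef f a. Proof. by []. Qed.
Lemma ps_coefD f g a : ps_coef (f + g) a = ps_coef f a + ps_coef g a. Proof. by []. Qed.
Lemma ps_coefB f g a : ps_coef (f - g) a = ps_coef f a - ps_coef g a. Proof. by []. Qed.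

End PowserZmodule.

Section PowserRing.
Variables (V : finType) (A : comNzRingType).
Implicit Types f g h : powser V A.

Definition ps_const (c : A) : powser V A :=
  Powser (fun a => if a == 0 then c else 0).

(* The sum is finite: an exponent has finitely many decompositions. *)
Definition ps_mul f g : powser V A :=
  Powser (fun a => \sum_(bc \in [set bc : mon V * mon V | bc.1 + bc.2 = a])
                     ps_coef f bc.1 * ps_coef g bc.2).

Let bmon N := {ffun V -> 'I_N.+1}.
Let up N (b : bmon N) : mon V := [ffun i => b i : nat].

Let up_inj N : injective (@up N).
Proof.
move=> b c /ffunP bc; apply/ffunP => i; apply/val_inj.
by have := bc i; rewrite !ffunE.
Qed.

Let upK N (a : mon V) : (forall i, a i <= N)%N -> exists b : bmon N, up b = a.
Proof.
move=> aN; exists [ffun i => inord (a i)]; apply/ffunP => i.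
by rewrite !ffunE inordK // ltnS.
Qed.

Let leq_mdeg (a : mon V) i : (a i <= mdeg a)%N.
Proof. by rewrite /mdeg (bigD1 i) //= leq_addr. Qed.

Let monDE (b c : mon V) i : (b + c) i = (b i + c i)%N.
Proof. by rewrite ffunE. Qed.

Let leq_monDr (b c : mon V) i : (c i <= (b + c)%R i)%N.
Proof. by rewrite monDE leq_addl. Qed.

Let ps_mulE N f g (a : mon V) : (forall i, a i <= N)%N ->
  ps_coef (ps_mul f g) a =
  \sum_(b : bmon N) \sum_(c : bmon N | up b + up c == a)
     ps_coef f (up b) * ps_coef g (up c).
Proof.
move=> aN; rewrite pair_big_dep /=.
pose r := [seq (up p.1, up p.2) | p <- index_enum (bmon N * bmon N)%type
                                 & up p.1 + up p.2 == a].
have r_uniq : uniq r.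
  rewrite map_inj_uniq ?filter_uniq ?index_enum_uniq //.
  by move=> [b c] [b' c'] /= [/up_inj -> /up_inj ->].
have -> : [set bc : mon V * mon V | bc.1 + bc.2 = a] = [set` r].
  apply/seteqP; split=> [[b c] /= bca|[b c] /=].
    have [b' b'E] : exists b' : bmon N, up b' = b.
      by apply: upK => i; rewrite (leq_trans _ (aN i)) // -bca monDE leq_addr.
    have [c' c'E] : exists c' : bmon N, up c' = c.
      by apply: upK => i; rewrite (leq_trans _ (aN i)) // -bca monDE leq_addl.
    apply/mapP; exists (b', c'); last by rewrite /= b'E c'E.
    by rewrite mem_filter mem_index_enum /= b'E c'E bca eqxx.
  by case/mapP=> -[b' c']; rewrite mem_filter => /andP[/eqP <- _] [-> ->].
by rewrite -fsbig_seq // big_map big_filter.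
Qed.

Lemma ps_mulC : commutative ps_mul.
Proof.
move=> f g; apply/powserP => a; rewrite !(ps_mulE _ _ (leq_mdeg a)).
under eq_bigr do rewrite big_mkcond.
rewrite exchange_big; apply: eq_bigr => c _; rewrite [RHS]big_mkcond /=.
by apply: eq_bigr => b _; rewrite mulrC addrC.
Qed.

Let ps_mulrE3 f g h a :
  ps_coef (ps_mul f (ps_mul g h)) a =
  \sum_(b : bmon (mdeg a)) \sum_(c : bmon (mdeg a))
    \sum_(d : bmon (mdeg a) | up b + (up c + up d) == a)
     ps_coef f (up b) * (ps_coef g (up c) * ps_coef h (up d)).
Proof.
rewrite (ps_mulE _ _ (leq_mdeg a)); apply: eq_bigr => b _.
transitivity (\sum_(e : bmon (mdeg a) | up b + up e == a)
  \sum_(c : bmon (mdeg a)) \sum_(d : bmon (mdeg a) | up c + up d == up e)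
     ps_coef f (up b) * (ps_coef g (up c) * ps_coef h (up d))).
  apply: eq_bigr => e /eqP bea; rewrite (@ps_mulE (mdeg a)) ?mulr_sumr.
    by apply: eq_bigr => c _; rewrite mulr_sumr.
  move=> i; apply: leq_trans (leq_mdeg a i).
  by rewrite -[X in (_ <= fun_of_fin X i)%N]bea leq_monDr.
rewrite exchange_big /=; apply: eq_bigr => c _.
under eq_bigr do rewrite big_mkcond /=.
rewrite exchange_big /= [RHS]big_mkcond; apply: eq_bigr => d _.
case: eqP => [bcda|nbcda].
  have [e eE] : exists e : bmon (mdeg a), up e = up c + up d.
    apply: upK => i; apply: leq_trans (leq_mdeg a i).
    by rewrite -[X in (_ <= fun_of_fin X i)%N]bcda leq_monDr.
  rewrite (bigD1 e) /= ?eE ?bcda ?eqxx // big1 ?addr0 // => e' /andP[_ e'e].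
  by case: eqP => // cde'; case/eqP: e'e; apply: up_inj; rewrite eE.
rewrite big1 // => e /eqP bea; case: eqP => // cde.
by case: nbcda; rewrite cde.
Qed.

Lemma ps_mulA : associative ps_mul.
Proof.
move=> f g h; rewrite (ps_mulC (ps_mul f g)); apply/powserP => a.
rewrite !ps_mulrE3 [RHS]exchange_big.
apply: eq_bigr => b _.
under [RHS]eq_bigr do rewrite big_mkcond.
rewrite [RHS]exchange_big; apply: eq_bigr => c _.
rewrite big_mkcond; apply: eq_bigr => d _ /=.
by rewrite addrA (addrC (up d)) (mulrC (ps_coef h _)) mulrA.
Qed.

Lemma ps_mul1 : left_id (ps_const 1) ps_mul.
Proof.
move=> f; apply/powserP => a; rewrite (ps_mulE _ _ (leq_mdeg a)).
have [z zE] : exists z : bmon (mdeg a), up z = 0.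
  by apply: upK => i; rewrite ffunE.
have [a' a'E] : exists a' : bmon (mdeg a), up a' = a.
  exact: upK (leq_mdeg a).
rewrite (bigD1 z) //= [X in _ + X]big1 => [|b bz].
  rewrite addr0 (bigD1 a') /= ?zE ?a'E ?add0r ?eqxx // big1 ?addr0 ?mul1r //.
  move=> c; rewrite add0r => /andP[/eqP ca /eqP[]]; apply: up_inj.
  by rewrite a'E ca.
rewrite big1 // => c _; case: eqP => [b0|]; last by rewrite mul0r.
by case/eqP: bz; apply: up_inj; rewrite zE.
Qed.

Lemma ps_mulDl : left_distributive ps_mul +%R.
Proof.
move=> f g h; apply/powserP => a.
rewrite ps_coefD !(ps_mulE _ _ (leq_mdeg a)) -big_split; apply: eq_bigr => b _.
by rewrite -big_split; apply: eq_bigr => c _; rewrite ps_coefD mulrDl.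
Qed.

Lemma ps_onez : ps_const 1 != 0.
Proof.
apply/eqP => /powserP /(_ 0) /=; rewrite eqxx => /eqP.
by rewrite oner_eq0.
Qed.

HB.instance Definition _ := GRing.Zmodule_isComNzRing.Build (powser V A)
  ps_mulA ps_mulC ps_mul1 ps_mulDl ps_onez.

Lemma ps_coef1 a : ps_coef (1 : powser V A) a = if a == 0 then 1 else 0.
Proof. by []. Qed.

Lemma ps_coefM f g a : ps_coef (f * g) a =
  \sum_(bc \in [set bc : mon V * mon V | bc.1 + bc.2 = a])
     ps_coef f bc.1 * ps_coef g bc.2.
Proof. by []. Qed.

Definition ps_var (i : V) : powser V A :=
  Powser (fun a => if a == [ffun j => (j == i : nat)] then 1 else 0).

Definition ps_const_coef f : A := ps_coef f 0.

End PowserRing.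

(* A series in the second block of variables, seen as a series in all of them. *)
Definition ps_lift (V W : finType) (A : comNzRingType) (f : powser W A) :
  powser (V + W)%type A :=
  Powser (fun a => if lmon a == 0 then ps_coef f (rmon a) else 0).

(* F(g), meaningful only if every g w has zero constant term: then           *)
(* g ^ b has no term of degree < mdeg b, so the sum below is finite          *)
(* (a sum with infinite support would be 0 by convention).                   *)
Definition ps_subst (V W : finType) (A : comNzRingType)
    (F : powser W A) (g : W -> powser V A) : powser V A :=
  Powser (fun a =>
    \sum_(b \in [set: mon W]) ps_coef F b * ps_coef (\prod_(w : W) g w ^+ b w) a).

(* Ideals of a subring C of A are subsets of A.                              *)

Section Ideals.
Variables (A : comNzRingType) (C : set A).

Definition is_ideal (I : set A) : Prop :=
  [/\ I `<=` C, I 0, (forall f g, I f -> I g -> I (f + g))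
    & forall c f, C c -> I f -> I (c * f)].

Definition gen_ideal (S : set A) : set A :=
  [set f | exists k (c g : 'I_k -> A),
     [/\ forall i, C (c i), forall i, S (g i) & f = \sum_(i < k) c i * g i]].

Definition ideal_add (I J : set A) : set A :=
  [set f | exists g h, [/\ I g, J h & f = g + h]].

Definition ideal_exp (I : set A) (k : nat) : set A :=
  gen_ideal [set f | exists g : 'I_k -> A,
                       (forall i, I (g i)) /\ f = \prod_(i < k) g i].

End Ideals.

Definition real_valued_field (R : realType) (K : fieldType) (v : K -> R) : Prop :=
  [/\ forall a, 0 <= v a, forall a, v a = 0 <-> a = 0,
      forall a b, v (a * b) = v a * v b & forall a b, v (a + b) <= v a + v b].

Section NestedSystem.
Variables (R : realType) (K : fieldType) (v : K -> R).

(* K{V} *)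
Definition convergent (V : finType) : set (powser V K) :=
  [set f | exists eps : V -> R, (forall i, 0 < eps i) /\
     (\esum_(a in [set: mon V])
        (v (ps_coef f a) * \prod_(i : V) eps i ^+ a i)%:E < +oo)%E].

(* K[V] *)
Definition polynomial_series (V : finType) : set (powser V K) :=
  [set f | finite_set [set a : mon V | ps_coef f a != 0]].

(* the coefficient in K[[V]] of s ^ b, where s are the variables in W *)
Definition ps_coef_right (V W : finType) (f : powser (V + W)%type K) (b : mon W) :
  powser V K := Powser (fun a => ps_coef f (mjoin a b)).

(* K{V}[W] *)
Definition conv_polynomial_series (V W : finType) : set (powser (V + W)%type K) :=
  [set f | finite_set [set b : mon W | ps_coef_right f b != 0] /\
           forall b, convergent (ps_coef_right f b)].

Definition homogeneous (V : finType) (d : nat) : set (powser V K) :=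
  [set f | forall a, ps_coef f a != 0 -> mdeg a = d].

Definition homogeneous_right (V W : finType) (d : nat) :
    set (powser (V + W)%type K) :=
  [set f | forall b, ps_coef_right f b != 0 -> mdeg b = d].

Variables n l p q N : nat.

(* The blocks x, s, Y, Z are indexed by 'I_n, 'I_l, 'I_p, 'I_q. *)
Notation xs := ('I_n + 'I_l)%type.
Notation xsYZ := (('I_n + 'I_l) + ('I_p + 'I_q))%type.

Definition max_ideal : set (powser 'I_l K) :=
  gen_ideal (@convergent 'I_l) [set f | exists j, f = ps_var K j].

(* J * K{x,s}, for J contained in K{s} *)
Definition extended (J : set (powser 'I_l K)) : set (powser xs K) :=
  gen_ideal (@convergent xs) [set ps_lift 'I_n f | f in J].

Definition max_pow (k : nat) : set (powser 'I_l K) :=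
  ideal_exp (@convergent 'I_l) max_ideal k.

Definition nested_args (y : 'I_p -> powser 'I_l K) (z : 'I_q -> powser xs K)
    (w : xsYZ) : powser xs K :=
  match w with
  | inl i => ps_var K i
  | inr (inl j) => ps_lift 'I_n (y j)
  | inr (inr k) => z k
  end.

(* F_i(x, s, y(s), z(x, s)) *)
Definition eval_system (F : 'I_N -> powser xsYZ K)
    (y : 'I_p -> powser 'I_l K) (z : 'I_q -> powser xs K) (i : 'I_N) :
  powser xs K := ps_subst (F i) (nested_args y z).

(* Substitution into an arbitrary convergent F requires y(0) = 0 and          *)
(* z(0, 0) = 0.                                                              *)
Definition substitutable (y : 'I_p -> powser 'I_l K)
    (z : 'I_q -> powser xs K) : Prop :=
  (forall j, ps_const_coef (y j) = 0) /\ (forall k, ps_const_coef (z k) = 0).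

Definition solution_of_order (F : 'I_N -> powser xsYZ K)
    (I : set (powser 'I_l K)) (e : nat)
    (y : 'I_p -> powser 'I_l K) (z : 'I_q -> powser xs K) : Prop :=
  [/\ forall j, polynomial_series (y j), forall k, conv_polynomial_series (z k),
      substitutable y z
    & forall i, extended (ideal_add I (max_pow e.+1)) (eval_system F y z i)].

Definition analytic_solution (F : 'I_N -> powser xsYZ K)
    (I : set (powser 'I_l K))
    (y : 'I_p -> powser 'I_l K) (z : 'I_q -> powser xs K) : Prop :=
  [/\ forall j, convergent (y j), forall k, convergent (z k),
      substitutable y z
    & forall i, extended I (eval_system F y z i)].

Definition congruent (k : nat)
    (y y' : 'I_p -> powser 'I_l K) (z z' : 'I_q -> powser xs K) : Prop :=
  (forall j, max_pow k (y j - y' j)) /\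
  (forall j, extended (max_pow k) (z j - z' j)).

End NestedSystem.

(* Main.v *)
(* Let M be the image of the derivative (u, v) |-> A(x) u + B(x) v of F in Y and Z at
   s = 0, a map K^p x K{x}^q -> K{x}^N.  Division by a standard basis of M, for a
   monomial order that is made compatible with weighted l^1 norms, yields a section of
   this map that is bounded on all small polydiscs; K need not be complete, since the
   coefficients of the quotients are given by finite recursions.  Division in K{s} by a
   standard basis of I, for an order refining the degree in s, likewise yields a bounded
   K{x}-linear normal form NF on K{x,s} whose kernel is I K{x,s} and which does not
   decrease the order in s.
   Increments may be restricted to standard monomials of I, and then the extension of a
   solution from order e to order e + 1 is a linear problem that decouples over these
   monomials: the hypothesis says that the coefficients of NF(F) in degree e + 1 lie in M,
   so the section provides the next increment.  Writing
   F = (constant part) + (derivative) + (quadratic remainder), the partial sums solve the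
   truncated equation w = - section(NF(constant part + remainder(w))), in which the
   remainder at w only involves w in smaller degree.  Hence for small radii in s all the
   partial sums stay in a small ball, and their formal limit converges. *)

Require Import Defs.
From mathcomp Require Import all_boot all_order all_algebra.
From mathcomp Require Import all_classical all_reals ereal esum.
From mathcomp Require Import zify ring lra.

Set Implicit Arguments.
Unset Strict Implicit.
Unset Printing Implicit Defensive.

Import Order.TTheory GRing.Theory Num.Theory.

Local Open Scope classical_set_scope.
Local Open Scope ring_scope.

(** * Exponents and coefficients *)

(** The nested condition shapes the proof. As y may not involve x, its increment in one degree of s
    contributes constants only, so M is not a K{x}-module but the sum of a finitely generated module
    and the span of p columns. Besides the leads of the module, which may be shifted by monomials, a
    standard basis has at most p further leads, which may only be used unshifted; quotients by the
    latter are constants, and so y stays free of x. The derivative is frozen at s = 0. Moving to the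
    current approximation changes it by terms of positive order in s, which gain one degree when
    multiplied by an increment, so one linear map and one section serve in all degrees. Constants
    are chosen in this order: the radii in x, which fix the norm of the section; the ball for the
    increments, so small that the quadratic remainder uses at most half of it; the radii in s, so
    small that the constant part uses at most the other half. Hence the bound for the normal form
    must hold with one constant for all smaller radii in s, and that for the section must not depend
    on these radii. *)

Lemma big_uniq_supp (T : eqType) (A : nmodType) (s t : seq T) (F : T -> A) :
  uniq s -> uniq t ->
  (forall x, x \in s -> x \notin t -> F x = 0) ->
  (forall x, x \in t -> x \notin s -> F x = 0) ->
  \sum_(x <- s) F x = \sum_(x <- t) F x.
Proof.
move=> us ut hs ht.
rewrite (bigID (mem t)) /= [X in _ + X]big_seq_cond [X in _ + X]big1 ?addr0; last first.
  by move=> x /andP[xs xt]; exact: hs.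
rewrite [RHS](bigID (mem s)) /= [X in _ + X]big_seq_cond [X in _ + X]big1 ?addr0; last first.
  by move=> x /andP[xs xt]; exact: ht.
rewrite -big_filter -[RHS]big_filter.
have st : perm_eq [seq x <- s | mem t x] [seq x <- t | mem s x].
  by apply: uniq_perm; rewrite ?filter_uniq // => x; rewrite !mem_filter /= andbC.
by rewrite (perm_big _ st).
Qed.

Lemma ler_sum_uniq (T : eqType) (A : numDomainType) (s t : seq T) (F : T -> A) :
  uniq s -> uniq t -> {subset s <= t} -> (forall x, 0 <= F x) ->
  \sum_(x <- s) F x <= \sum_(x <- t) F x.
Proof.
move=> us ut st F0.
rewrite [leRHS](bigID (mem s)) /= -[X in X <= _]addr0 lerD ?sumr_ge0 //.
rewrite -[leRHS]big_filter.
have ts : perm_eq s [seq x <- t | mem s x].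
  apply: uniq_perm; rewrite ?filter_uniq // => x; rewrite mem_filter /=.
  by case xs: (x \in s) => //=; rewrite st.
by rewrite -(perm_big _ ts).
Qed.

Section Monomials.
Variable V : finType.
Implicit Types a b c : mon V.

Definition mle b a := [forall i, (b i <= a i)%N].
Definition msub a b : mon V := [ffun i => (a i - b i)%N].

Lemma mleP b a : reflect (forall i, (b i <= a i)%N) (mle b a).
Proof. exact: forallP. Qed.

Lemma monDE b c i : (b + c) i = (b i + c i)%N.
Proof. by rewrite ffunE. Qed.

Lemma mon0E i : (0 : mon V) i = 0%N.
Proof. by rewrite ffunE. Qed.

Lemma mle_addr b c : mle b (b + c).
Proof. by apply/mleP => i; rewrite monDE leq_addr. Qed.

Lemma msubK a b : mle b a -> b + msub a b = a.
Proof. by move=> /mleP ba; apply/ffunP => i; rewrite monDE ffunE subnKC. Qed.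

Lemma maddK b c : msub (b + c) b = c.
Proof. by apply/ffunP => i; rewrite ffunE monDE addKn. Qed.

Lemma monDI b : injective (fun c => b + c).
Proof. by move=> c d bcd; rewrite -(maddK b c) bcd maddK. Qed.

Lemma mdegD b c : mdeg (b + c) = (mdeg b + mdeg c)%N.
Proof. by rewrite /mdeg -big_split; apply: eq_bigr => i _; rewrite monDE. Qed.

Lemma mdeg0 : mdeg (0 : mon V) = 0%N.
Proof. by rewrite /mdeg big1 // => i _; rewrite mon0E. Qed.

Lemma leq_mdeg a i : (a i <= mdeg a)%N.
Proof. by rewrite /mdeg (bigD1 i) //= leq_addr. Qed.

Lemma mdeg_eq0 a : mdeg a = 0%N -> a = 0.
Proof.
by move=> a0; apply/ffunP => i; rewrite mon0E; have := leq_mdeg a i; rewrite a0 leqn0 => /eqP.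
Qed.

Definition mdelta (i : V) : mon V := [ffun j => (j == i : nat)].

Lemma mdeg_delta i : mdeg (mdelta i) = 1%N.
Proof.
rewrite /mdeg (bigD1 i) //= ffunE eqxx big1 ?addn0 // => j ji.
by rewrite ffunE (negbTE ji).
Qed.

Definition mons (d : nat) : seq (mon V) :=
  [seq a <- [seq [ffun i => (f i : nat)] | f : {ffun V -> 'I_d.+1}] | mdeg a <= d]%N.

Lemma mons_uniq d : uniq (mons d).
Proof.
rewrite filter_uniq // map_inj_uniq ?enum_uniq // => f g /ffunP fg.
by apply/ffunP => i; apply/val_inj; have := fg i; rewrite !ffunE.
Qed.

Lemma mem_mons d a : (a \in mons d) = (mdeg a <= d)%N.
Proof.
rewrite mem_filter; case: leqP => //= ad; apply/mapP.
exists [ffun i => inord (a i)]; rewrite ?mem_enum //.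
by apply/ffunP => i; rewrite !ffunE inordK // ltnS (leq_trans (leq_mdeg a i)).
Qed.

Definition below a := [seq b <- mons (mdeg a) | mle b a].

Lemma below_uniq a : uniq (below a).
Proof. by rewrite filter_uniq // mons_uniq. Qed.

Lemma mem_below a b : (b \in below a) = mle b a.
Proof.
rewrite mem_filter mem_mons; case: (boolP (mle b a)) => //= ba.
by rewrite -(msubK ba) mdegD leq_addr.
Qed.

Lemma mdeg_below a b : b \in below a -> (mdeg b <= mdeg a)%N.
Proof. by rewrite mem_filter mem_mons => /andP[]. Qed.

Lemma mons_split (d : nat) a : (d <= mdeg a)%N -> exists2 b, mle b a & mdeg b = d.
Proof.
elim: d => [_|d IH da]; first by exists 0; [apply/mleP => i; rewrite mon0E|exact: mdeg0].
have [b ba bd] := IH (ltnW da).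
have /existsP[i bi] : [exists i, (b i < a i)%N].
  apply: contraLR da; rewrite negb_exists => /forallP ab.
  rewrite -leqNgt -bd /mdeg leq_sum // => i _; rewrite leqNgt; exact: ab.
exists (b + mdelta i); last by rewrite mdegD bd mdeg_delta addn1.
apply/mleP => j; rewrite monDE ffunE; case: eqP => [->|_]; first by rewrite addn1.
by rewrite addn0; exact: (mleP _ _ ba).
Qed.

(** Induction on the list of coordinates on which divisibility is tested. When a coordinate [i] is
    added, the finite set found without it still serves the exponents whose [i]-th entry is at least
    all of its own; each of the finitely many smaller values of that entry is treated by itself. *)
Lemma dickson (S : set (mon V)) : exists L : seq (mon V),
  (forall a, a \in L -> S a) /\ (forall a, S a -> exists2 b, b \in L & mle b a).
Proof.
suff [L [LS SL]] : exists L : seq (mon V), (forall a, a \in L -> S a) /\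
    (forall a, S a -> exists2 b, b \in L & forall i, i \in enum V -> (b i <= a i)%N).
  exists L; split=> // a /SL[b bL ba]; exists b => //; apply/mleP => i.
  by apply: ba; rewrite mem_enum.
elim: (enum V) S => [|i cs IH] S.
  have [[a Sa]|S0] := pselect (exists a, S a).
    by exists [:: a]; split=> [b|b _]; [rewrite inE => /eqP ->|exists a; rewrite ?inE].
  by exists [::]; split=> // a Sa; case: S0; exists a.
have [L [LS SL]] := IH S.
pose m := \max_(b <- L) b i.
have /choice[Lk Lkp] : forall k, exists L' : seq (mon V),
    (forall a, a \in L' -> S a /\ a i = k) /\
    (forall a, S a /\ a i = k -> exists2 b, b \in L' & forall j, j \in cs -> (b j <= a j)%N).
  by move=> k; exact: IH [set a | S a /\ a i = k].
exists (L ++ flatten [seq Lk k | k <- iota 0 m]); split=> [a|a Sa].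
  rewrite mem_cat => /orP[/LS//|/flatten_mapP[k _ aLk]].
  by case: (Lkp k) => /(_ _ aLk)[].
have [am|ma] := ltnP (a i) m.
  case: (Lkp (a i)) => L1 /(_ a (conj Sa erefl)) [b bL ba].
  exists b.
    rewrite mem_cat; apply/orP; right; apply/flatten_mapP; exists (a i) => //.
    by rewrite mem_iota.
  by move=> j; rewrite inE => /orP[/eqP ->|/ba//]; case: (L1 _ bL) => _ ->.
have [b bL ba] := SL _ Sa; exists b; first by rewrite mem_cat bL.
move=> j; rewrite inE => /orP[/eqP ->|/ba//].
by apply: leq_trans ma; rewrite /m; apply: leq_bigmax_seq.
Qed.

End Monomials.

Section JoinedMonomials.
Variables V W : finType.

Lemma lmonE (a : mon V) (b : mon W) : lmon (mjoin a b) = a.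
Proof. by apply/ffunP => i; rewrite !ffunE. Qed.

Lemma rmonE (a : mon V) (b : mon W) : rmon (mjoin a b) = b.
Proof. by apply/ffunP => i; rewrite !ffunE. Qed.

Lemma mjoinK (c : mon (V + W)%type) : mjoin (lmon c) (rmon c) = c.
Proof. by apply/ffunP => -[i|i]; rewrite !ffunE. Qed.

Lemma rmonD (c d : mon (V + W)%type) : rmon (c + d) = rmon c + rmon d.
Proof. by apply/ffunP => i; rewrite !ffunE. Qed.

Lemma mdeg_join (c : mon (V + W)%type) : mdeg c = (mdeg (lmon c) + mdeg (rmon c))%N.
Proof.
rewrite /mdeg big_sumType /=; congr (_ + _)%N; apply: eq_bigr => i _; by rewrite ffunE.
Qed.

Lemma mjoin_eq0 (c : mon (V + W)%type) : (c == 0) = (lmon c == 0) && (rmon c == 0).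
Proof.
apply/eqP/andP => [->|[/eqP lc /eqP rc]].
  by split; apply/eqP/ffunP => i; rewrite !ffunE.
by rewrite -(mjoinK c) lc rc; apply/ffunP => -[i|i]; rewrite !ffunE.
Qed.

Lemma mle_join (c d : mon (V + W)%type) : mle c d = mle (lmon c) (lmon d) && mle (rmon c) (rmon d).
Proof.
apply/mleP/andP => [cd|[/mleP l /mleP r] [i|i]].
- by split; apply/mleP => i; rewrite !ffunE.
- by have := l i; rewrite !ffunE.
- by have := r i; rewrite !ffunE.
Qed.

Lemma lmon_sub (c d : mon (V + W)%type) : lmon (msub c d) = msub (lmon c) (lmon d).
Proof. by apply/ffunP => i; rewrite !ffunE. Qed.

Lemma rmon_sub (c d : mon (V + W)%type) : rmon (msub c d) = msub (rmon c) (rmon d).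
Proof. by apply/ffunP => i; rewrite !ffunE. Qed.

End JoinedMonomials.

Section Coefficients.
Variable A : comNzRingType.

Lemma ps_coefM_below (V : finType) (f g : powser V A) a :
  ps_coef (f * g) a = \sum_(b <- below a) ps_coef f b * ps_coef g (msub a b).
Proof.
rewrite ps_coefM.
have -> : [set bc : mon V * mon V | bc.1 + bc.2 = a] = [set` [seq (b, msub a b) | b <- below a]].
  apply/seteqP; split=> [[b c] /= <-|[b c] /= /mapP[d]].
    by apply/mapP; exists b; rewrite ?mem_below ?mle_addr ?maddK.
  by rewrite mem_below => da [-> ->]; exact: msubK.
rewrite -fsbig_seq ?big_map // map_inj_uniq ?below_uniq // => b c [] //.
Qed.

Lemma ps_coef_sum (V : finType) (T : Type) (r : seq T) (P : pred T) (f : T -> powser V A) a :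
  ps_coef (\sum_(i <- r | P i) f i) a = \sum_(i <- r | P i) ps_coef (f i) a.
Proof. by elim/big_rec2: _ => // i x y _ <-. Qed.

Lemma ps_coef_constM (V : finType) c (f : powser V A) a :
  ps_coef (ps_const V c * f) a = c * ps_coef f a.
Proof.
have z : 0 \in below a by rewrite mem_below; apply/mleP => i; rewrite mon0E.
rewrite ps_coefM_below (bigD1_seq 0) ?below_uniq //= eqxx big1 ?addr0 => [|b b0]; last by rewrite (negbTE b0) mul0r.
by congr (_ * ps_coef f _); apply/ffunP => i; rewrite !ffunE subn0.
Qed.

Definition ps_mono (V : finType) (b : mon V) : powser V A :=
  Powser (fun a => if a == b then 1 else 0).

Lemma ps_coef_monoM (V : finType) b (f : powser V A) a :
  ps_coef (ps_mono b * f) a = if mle b a then ps_coef f (msub a b) else 0.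
Proof.
rewrite ps_coefM_below; case: ifP => ba.
  rewrite (bigD1_seq b) ?below_uniq ?mem_below //= eqxx mul1r big1 ?addr0 // => c cb.
  by rewrite (negbTE cb) mul0r.
rewrite big_seq big1 // => c; rewrite mem_below /= => ca.
by case: eqP ca => [->|_]; rewrite ?ba ?mul0r.
Qed.

Lemma ps_monoD (V : finType) (b c : mon V) : ps_mono (b + c) = ps_mono b * ps_mono c.
Proof.
apply/powserP => a; rewrite ps_coef_monoM /=.
case: (boolP (mle b a)) => [ba|]; first by rewrite -{1}(msubK ba) (inj_eq (@monDI _ b)).
by case: eqP => // ->; rewrite mle_addr.
Qed.

Lemma ps_constM (V : finType) (c d : A) : ps_const V (c * d) = ps_const V c * ps_const V d.
Proof.
by apply/powserP => a; rewrite ps_coef_constM /=; case: eqP; rewrite ?mulr0.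
Qed.

End Coefficients.

Section Orders.
Variables (A : comNzRingType) (V : finType) (D : mon V -> nat).
Hypothesis DD : forall a b, D (a + b) = (D a + D b)%N.
Implicit Types f g : powser V A.

(** The degree [D] is left abstract because two are used: the total degree, which makes substitution
    well defined, and the degree in s, which measures approximation. *)
Definition ord_ge k f := forall a, (D a < k)%N -> ps_coef f a = 0.

Lemma ord_ge_zero f : ord_ge 0 f. Proof. by []. Qed.

Lemma ord_geD k f g : ord_ge k f -> ord_ge k g -> ord_ge k (f + g).
Proof. by move=> kf kg a ak; rewrite ps_coefD kf ?kg ?addr0. Qed.

Lemma ord_ge_sum (T : Type) (r : seq T) (P : pred T) (F : T -> powser V A) k :
  (forall i, P i -> ord_ge k (F i)) -> ord_ge k (\sum_(i <- r | P i) F i).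
Proof. by move=> kF; elim/big_rec: _ => // i x Pi; apply: ord_geD; exact: kF. Qed.

Lemma ord_ge_le k m f : (m <= k)%N -> ord_ge k f -> ord_ge m f.
Proof. by move=> mk kf a am; apply: kf; apply: leq_trans mk. Qed.

Lemma ord_geM k m f g : ord_ge k f -> ord_ge m g -> ord_ge (k + m) (f * g).
Proof.
move=> kf mg a akm; rewrite ps_coefM_below big_seq big1 // => b; rewrite mem_below => ba.
have [bk|kb] := ltnP (D b) k; first by rewrite kf ?mul0r.
rewrite mg ?mulr0 //; rewrite -(msubK ba) DD in akm; lia.
Qed.

Lemma ord_ge_mull k f g : ord_ge k g -> ord_ge k (f * g).
Proof. by move=> kg; rewrite -[k]add0n; apply: ord_geM. Qed.

Lemma ord_ge_mulr k f g : ord_ge k f -> ord_ge k (f * g).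
Proof. by rewrite mulrC; exact: ord_ge_mull. Qed.

End Orders.

(** * Weighted norms *)

Section Norms.
Variables (R : realType) (K : fieldType) (v : K -> R).
Hypothesis hv : real_valued_field v.

Lemma abs_ge0 a : 0 <= v a. Proof. by case: hv. Qed.
Lemma abs0 : v 0 = 0. Proof. by case: hv => _ + _ _; move=> /(_ 0)[_ ->]. Qed.
Lemma abs_eq0 a : v a = 0 -> a = 0. Proof. by case: hv => _ + _ _; move=> /(_ a)[]. Qed.
Lemma absM a b : v (a * b) = v a * v b. Proof. by case: hv. Qed.
Lemma absD a b : v (a + b) <= v a + v b. Proof. by case: hv. Qed.

Lemma abs1 : v 1 = 1.
Proof.
have v1 : v 1 != 0 by apply/eqP => /abs_eq0 /eqP; rewrite oner_eq0.
by apply: (mulfI v1); rewrite -absM !mulr1.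
Qed.

Lemma absN a : v (- a) = v a.
Proof.
rewrite -mulN1r absM; suff -> : v (-1) = 1 by rewrite mul1r.
have : v (-1) ^+ 2 = 1 by rewrite expr2 -absM mulrNN mulr1 abs1.
by move/eqP; rewrite sqrf_eq1 => /orP[/eqP//|/eqP v1]; have := abs_ge0 (-1); rewrite v1; lra.
Qed.

Lemma abs_sum (T : Type) (r : seq T) (P : pred T) (F : T -> K) :
  v (\sum_(i <- r | P i) F i) <= \sum_(i <- r | P i) v (F i).
Proof.
elim/big_rec2: _ => [|i x y _ xy]; first by rewrite abs0.
by apply: le_trans (absD _ _) _; rewrite lerD2l.
Qed.

Section Bounded.
Variables (E : eqType) (wt : E -> R).
Hypothesis wt_ge0 : forall e, 0 <= wt e.
Implicit Types f g : E -> K.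

(* The weighted l^1 norm of f is at most C; only finite sums are ever needed, so *)
(* that K need not be complete.                                              *)
Definition bounded f (C : R) :=
  forall S : seq E, uniq S -> \sum_(e <- S) v (f e) * wt e <= C.

Lemma term_ge0 f e : 0 <= v (f e) * wt e.
Proof. by rewrite mulr_ge0 ?abs_ge0. Qed.

Lemma bounded_ge0 f C : bounded f C -> 0 <= C.
Proof. by move=> /(_ [::] isT); rewrite big_nil. Qed.

Lemma bounded_le f C D : C <= D -> bounded f C -> bounded f D.
Proof. by move=> CD fC S uS; exact: le_trans (fC S uS) CD. Qed.

Lemma bounded0 : bounded (fun => 0) 0.
Proof. by move=> S _; rewrite big1 // => e _; rewrite abs0 mul0r. Qed.

Lemma bounded_dom f g C : (forall e, v (g e) <= v (f e)) -> bounded f C -> bounded g C.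
Proof.
move=> gf fC S uS; apply: le_trans (fC S uS); apply: ler_sum => e _.
by rewrite ler_wpM2r.
Qed.

Lemma boundedD f g C D : bounded f C -> bounded g D -> bounded (fun e => f e + g e) (C + D).
Proof.
move=> fC gD S uS; apply: le_trans (lerD (fC S uS) (gD S uS)).
rewrite -big_split; apply: ler_sum => e _ /=.
by rewrite -mulrDl ler_wpM2r // absD.
Qed.

Lemma boundedN f C : bounded f C -> bounded (fun e => - f e) C.
Proof. by apply: bounded_dom => e; rewrite absN. Qed.

Lemma bounded_single f e0 : (forall e, e != e0 -> f e = 0) -> bounded f (v (f e0) * wt e0).
Proof.
move=> f0 S uS; have [e0S|e0S] := boolP (e0 \in S).
  by rewrite (bigD1_seq e0) //= big1 ?addr0 // => e /f0 ->; rewrite abs0 mul0r.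
rewrite big_seq big1 ?term_ge0 // => e eS; rewrite f0 ?abs0 ?mul0r //.
by apply: contraNneq e0S => <-.
Qed.

End Bounded.

Lemma bounded_le_wt (E : eqType) (wt wt' : E -> R) f C : (forall e, wt' e <= wt e) ->
  bounded wt f C -> bounded wt' f C.
Proof.
move=> ww fC S uS; apply: le_trans (fC S uS); apply: ler_sum => e _.
by rewrite ler_wpM2l ?abs_ge0.
Qed.

Lemma bounded_reindex (E E' : eqType) (wt : E -> R) (h : E' -> E) f C : injective h ->
  bounded wt f C -> bounded (wt \o h) (f \o h) C.
Proof.
move=> hi fC S uS; have := fC (map h S); rewrite map_inj_uniq // => /(_ uS).
by rewrite big_map.
Qed.

Lemma bounded_scale (E : eqType) (wt : E -> R) c f C : bounded wt f C ->
  bounded wt (fun e => c * f e) (v c * C).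
Proof.
move=> fC S uS; apply: le_trans (ler_wpM2l (abs_ge0 c) (fC S uS)).
by rewrite mulr_sumr; apply: ler_sum => e _; rewrite absM mulrA.
Qed.

Section Weights.
Variable V : finType.
Implicit Types (w : V -> R) (f g : powser V K).

Definition mwt w (a : mon V) : R := \prod_i w i ^+ a i.

Lemma mwtD w a b : mwt w (a + b) = mwt w a * mwt w b.
Proof. by rewrite /mwt -big_split; apply: eq_bigr => i _; rewrite monDE exprD. Qed.

Lemma mwt0 w : mwt w 0 = 1.
Proof. by rewrite /mwt big1 // => i _; rewrite mon0E. Qed.

Lemma mwt_gt0 w a : (forall i, 0 < w i) -> 0 < mwt w a.
Proof. by move=> w0; rewrite prodr_gt0 // => i _; rewrite exprn_gt0. Qed.

Lemma mwt_ge0 w a : (forall i, 0 <= w i) -> 0 <= mwt w a.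
Proof. by move=> w0; rewrite prodr_ge0 // => i _; rewrite exprn_ge0. Qed.

Lemma mwt_le w w' a : (forall i, 0 <= w i <= w' i) -> mwt w a <= mwt w' a.
Proof.
move=> ww; apply: ler_prod => i _; have /andP[w0 wi] := ww i.
by rewrite exprn_ge0 //= lerXn2r // nnegrE // (le_trans w0).
Qed.

Lemma mwt_scale c w a : mwt (fun i => c * w i) a = c ^+ mdeg a * mwt w a.
Proof.
rewrite /mwt /mdeg -prodrXr -big_split; apply: eq_bigr => i _; exact: exprMn.
Qed.

Lemma mwt_cst c a : mwt (fun=> c) a = c ^+ mdeg a.
Proof. by rewrite /mwt /mdeg prodrXr. Qed.

Notation nrm w f C := (bounded (mwt w) (ps_coef f) C).

Lemma nrmD w f g C D : (forall i, 0 <= w i) -> nrm w f C -> nrm w g D -> nrm w (f + g) (C + D).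
Proof. by move=> w0; apply: boundedD => a; exact: mwt_ge0. Qed.

Lemma nrmN w f C : (forall i, 0 <= w i) -> nrm w f C -> nrm w (- f) C.
Proof. by move=> w0; apply: boundedN => a; exact: mwt_ge0. Qed.

Lemma nrmB w f g C D : (forall i, 0 <= w i) -> nrm w f C -> nrm w g D -> nrm w (f - g) (C + D).
Proof. by move=> w0 fC gD; apply: nrmD => //; exact: nrmN. Qed.

Lemma nrm_sum w (T : Type) (r : seq T) (P : pred T) (f : T -> powser V K) C :
  (forall i, 0 <= w i) -> (forall i, P i -> nrm w (f i) (C i)) ->
  nrm w (\sum_(i <- r | P i) f i) (\sum_(i <- r | P i) C i).
Proof.
move=> w0 fC; elim/big_rec2: _ => [|i x y Pi xy]; first exact: bounded0.
by apply: nrmD => //; exact: fC.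
Qed.

(** Exponents whose sum lies in [S] have degree at most [N], and for a fixed first exponent distinct
    sums have distinct second exponents. So the finite sum for the product is part of a product of
    two finite sums. *)
Lemma nrmM w f g C D : (forall i, 0 <= w i) -> nrm w f C -> nrm w g D -> nrm w (f * g) (C * D).
Proof.
move=> w0 fC gD S uS.
have C0 := bounded_ge0 fC; have D0 := bounded_ge0 gD.
pose N := \max_(a <- S) mdeg a.
have SN a : a \in S -> (mdeg a <= N)%N.
  by move=> aS; rewrite /N; apply: leq_bigmax_seq.
have W0 a := mwt_ge0 a w0.
apply: (@le_trans _ _ (\sum_(b <- mons V N) \sum_(c <- mons V N)
    (v (ps_coef f b) * mwt w b) * (v (ps_coef g c) * mwt w c))); last first.
  under eq_bigr do rewrite -mulr_sumr.
  rewrite -mulr_suml; apply: ler_pM; rewrite ?sumr_ge0 ?fC ?gD ?mons_uniq //.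
  - by move=> a _; rewrite term_ge0.
  - by move=> a _; rewrite term_ge0.
pose G (a b : mon V) := if mle b a then (v (ps_coef f b) * mwt w b) *
   (v (ps_coef g (msub a b)) * mwt w (msub a b)) else 0.
have G0 a b : 0 <= G a b.
  by rewrite /G; case: ifP => // _; rewrite mulr_ge0 ?term_ge0.
apply: (@le_trans _ _ (\sum_(a <- S) \sum_(b <- mons V N) G a b)).
  rewrite big_seq [leRHS]big_seq; apply: ler_sum => a aS.
  rewrite ps_coefM_below.
  apply: (@le_trans _ _ (\sum_(b <- below a) G a b)).
    apply: le_trans (ler_wpM2r (W0 _) (abs_sum _ _ _)) _.
    rewrite mulr_suml big_seq [leRHS]big_seq; apply: ler_sum => b; rewrite mem_below => ba.
    by rewrite /G ba absM mulrACA -mwtD msubK.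
  apply: ler_sum_uniq; rewrite ?below_uniq ?mons_uniq // => b /mdeg_below ba.
  by rewrite mem_mons (leq_trans ba) ?SN.
rewrite exchange_big; apply: ler_sum => b _ /=.
rewrite (bigID (mle b)) /= [X in _ + X]big1 ?addr0 => [|a nba]; last first.
  by rewrite /G (negbTE nba).
rewrite -big_filter.
apply: (@le_trans _ _ (\sum_(c <- map (fun a => msub a b) [seq a <- S | mle b a])
   v (ps_coef f b) * mwt w b * (v (ps_coef g c) * mwt w c))).
  rewrite big_map [leLHS]big_seq [leRHS]big_seq; apply: ler_sum => a.
  by rewrite mem_filter /G => /andP[->].
apply: ler_sum_uniq; rewrite ?mons_uniq //.
- rewrite map_inj_in_uniq ?filter_uniq // => a a'; rewrite !mem_filter => /andP[ba _] /andP[ba' _] aa'.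
  by rewrite -(msubK ba) aa' msubK.
- move=> c /mapP[a]; rewrite mem_filter => /andP[ba aS] ->; rewrite mem_mons.
  by apply: leq_trans (SN a aS); rewrite -{2}(msubK ba) mdegD leq_addl.
- by move=> c; rewrite mulr_ge0 ?term_ge0.
Qed.

Lemma nrm_mono w b : (forall i, 0 <= w i) -> nrm w (ps_mono K b) (mwt w b).
Proof.
move=> w0; have := @bounded_single _ (mwt w) (fun a => mwt_ge0 a w0) (ps_coef (ps_mono K b)) b.
by rewrite /= eqxx abs1 mul1r; apply=> e /negbTE ->.
Qed.

Lemma nrm_const w c : (forall i, 0 <= w i) -> nrm w (ps_const V c) (v c).
Proof.
move=> w0; have := @bounded_single _ (mwt w) (fun a => mwt_ge0 a w0) (ps_coef (ps_const V c)) 0.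
by rewrite /= eqxx mwt0 mulr1; apply=> e /negbTE ->.
Qed.

Lemma nrm_constM w c f C : nrm w f C -> nrm w (ps_const V c * f) (v c * C).
Proof.
move=> fC S uS; have := bounded_scale c fC uS.
by under eq_bigr do rewrite -ps_coef_constM.
Qed.

Lemma nrm1 w : (forall i, 0 <= w i) -> nrm w 1 1.
Proof. by move=> w0; rewrite -[X in bounded _ _ X]abs1; exact: nrm_const. Qed.

Lemma nrm_le_wt w w' f C : (forall i, 0 <= w' i <= w i) -> nrm w f C -> nrm w' f C.
Proof. by move=> ww; apply: bounded_le_wt => a; exact: mwt_le. Qed.

Lemma convergentP f :
  convergent v f <-> exists w, (forall i, 0 < w i) /\ exists C, nrm w f C.
Proof.
have T0 w a : (forall i, 0 < w i) -> (0 <= (v (ps_coef f a) * \prod_(i : V) w i ^+ a i)%:E)%E.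
  by move=> w0; rewrite lee_fin mulr_ge0 ?abs_ge0 // (mwt_ge0 (w := w)) // => i; rewrite ltW.
split=> [[w [w0 lty]]|[w [w0 [C fC]]]]; exists w; split=> //.
  have e0 : (0 <= \esum_(a in [set: mon V]) (v (ps_coef f a) * \prod_(i : V) w i ^+ a i)%:E)%E.
    by apply: esum_ge0 => a _; exact: T0.
  exists (fine (\esum_(a in [set: mon V]) (v (ps_coef f a) * \prod_(i : V) w i ^+ a i)%:E)%E).
  move=> S uS; rewrite -lee_fin fineK; last by rewrite ge0_fin_numE.
  rewrite -sumEFin; apply: ereal_sup_ubound; exists [set` S].
    by split => //; exact: finite_seq.
  by rewrite -fsbig_seq.
apply: (@le_lt_trans _ _ C%:E); last exact: ltry.
apply: ub_ereal_sup => _ [S [fS _] <-].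
rewrite fsbig_finite //= sumEFin lee_fin; apply: fC; exact: finmap.fset_uniq.
Qed.

End Weights.

End Norms.

Notation nrm v w f C := (bounded v (mwt w) (ps_coef f) C).

(** * Triangular families *)

Section Segments.
Variables (E : eqType) (rk : E -> nat).
Hypothesis rk_inj : injective rk.

Lemma segment_exists m : exists S : seq E, uniq S /\ forall e, (e \in S) = (rk e < m)%N.
Proof.
elim: m => [|m [S [uS memS]]]; first by exists [::].
have [[e em]|nm] := pselect (exists e, rk e = m).
  exists (e :: S); split=> [|e']; first by rewrite /= memS em ltnn.
  by rewrite inE memS ltnS [RHS]leq_eqVlt -em (inj_eq rk_inj).
exists S; split=> // e; rewrite memS ltnS [RHS]leq_eqVlt.
by case: eqP => // em; case: nm; exists e.
Qed.

Definition seg m : seq E := sval (cid (segment_exists m)).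

Lemma seg_uniq m : uniq (seg m).
Proof. by rewrite /seg; case: cid => S []. Qed.

Lemma mem_seg m e : (e \in seg m) = (rk e < m)%N.
Proof. by rewrite /seg; case: cid => S []. Qed.

Section Triangular.
Variables (K : fieldType) (g : E -> E -> K).
Hypothesis g_diag : forall e, g e e = 1.
Hypothesis g_low : forall e e', (rk e' < rk e)%N -> g e e' = 0.
Implicit Types f : E -> K.

(** The argument [k] is fuel: the recursive calls are at entries of smaller rank, so any fuel larger
    than the rank of [e] gives the same value. *)
Fixpoint tri_rec (k : nat) f e : K :=
  if k is k'.+1 then f e - \sum_(e' <- seg (rk e)) tri_rec k' f e' * g e' e else 0.

(* The coefficients c such that f is the (locally finite) sum of the c e * g e. *)
Definition tri f e : K := tri_rec (rk e).+1 f e.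

Lemma tri_rec_stable k m f e : (rk e < k)%N -> (rk e < m)%N -> tri_rec k f e = tri_rec m f e.
Proof.
elim: k m e => [//|k IH] [//|m] e ek em /=; congr (_ - _); apply: eq_big_seq => e'.
by rewrite mem_seg => e'e; congr (_ * _); apply: IH; apply: leq_trans e'e _; rewrite -ltnS.
Qed.

Lemma triE f e : tri f e = f e - \sum_(e' <- seg (rk e)) tri f e' * g e' e.
Proof.
rewrite {1}/tri /=; congr (_ - _); apply: eq_big_seq => e'; rewrite mem_seg => e'e.
by congr (_ * _); exact: tri_rec_stable.
Qed.

(** The recursion determines its solution; linearity and the fixed points of [tri] are read off from
    this. *)
Lemma tri_uniq f c : (forall e, c e = f e - \sum_(e' <- seg (rk e)) c e' * g e' e) ->
  c =1 tri f.
Proof.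
move=> fc e; elim: {e}(rk e).+1 {-2}e (ltnSn (rk e)) => [//|k IH] e ek.
rewrite fc triE; congr (_ - _); apply: eq_big_seq => e'; rewrite mem_seg => e'e.
by rewrite IH // (leq_trans e'e).
Qed.


Lemma tri_sum f e m : (rk e < m)%N -> f e = \sum_(e' <- seg m) tri f e' * g e' e.
Proof.
move=> em; rewrite (bigD1_seq e) ?seg_uniq ?mem_seg //= g_diag mulr1 [X in _ = X + _]triE.
suff -> : \sum_(i <- seg m | i != e) tri f i * g i e = \sum_(e' <- seg (rk e)) tri f e' * g e' e.
  by rewrite subrK.
rewrite -big_filter; apply: big_uniq_supp; rewrite ?filter_uniq ?seg_uniq // => e'.
  rewrite mem_filter !mem_seg => /andP[e'e _]; rewrite -leqNgt leq_eqVlt (inj_eq rk_inj) eq_sym.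
  by rewrite (negbTE e'e) => /g_low ->; rewrite mulr0.
rewrite mem_filter !mem_seg => e'e; rewrite (ltn_trans e'e em) andbT negbK => /eqP e'E.
by rewrite e'E ltnn in e'e.
Qed.

Lemma triD f h e : tri (fun x => f x + h x) e = tri f e + tri h e.
Proof.
symmetry; move: e; apply: tri_uniq => e; rewrite triE [tri h e]triE.
under [in RHS]eq_bigr do rewrite mulrDl.
by rewrite big_split /= opprD addrACA.
Qed.

Lemma triZ c f e : tri (fun x => c * f x) e = c * tri f e.
Proof.
symmetry; move: e; apply: tri_uniq => e; rewrite triE mulrBr mulr_sumr.
by under eq_bigr do rewrite mulrA.
Qed.

Lemma tri_ext f h : f =1 h -> tri f =1 tri h.
Proof. by move=> /funext ->. Qed.

Lemma tri0 e : tri (fun=> 0) e = 0.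
Proof.
by transitivity (tri (fun=> 0 * 0) e); [apply: tri_ext => x|rewrite triZ]; rewrite mul0r.
Qed.

Lemma tri_lt k f : (forall e, (rk e < k)%N -> f e = 0) -> forall e, (rk e < k)%N -> tri f e = 0.
Proof.
move=> f0 e; elim: {e}(rk e).+1 {-2}e (ltnSn (rk e)) => [//|m IH] e em ek.
rewrite triE f0 // big_seq big1 ?subr0 // => e'; rewrite mem_seg => e'e.
by rewrite IH ?mul0r //; lia.
Qed.

(** By triangularity [f] may be cut off beyond the rank of [e], where it is a finite combination of
    unit vectors. A matrix with entries in K, applied to finitely many entries, is what later makes
    the normal form linear over the series in x. *)
Lemma tri_matrix f e : tri f e = \sum_(e' <- seg (rk e).+1) f e' * tri (fun x => (x == e')%:R) e.
Proof.
pose h x := \sum_(e' <- seg (rk e).+1) f e' * (x == e')%:R.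
have hf x : (rk x < (rk e).+1)%N -> f x - h x = 0.
  move=> xe; rewrite /h (bigD1_seq x) ?seg_uniq ?mem_seg //= eqxx mulr1 big1 ?addr0 ?subrr //.
  by move=> y yx; rewrite eq_sym (negbTE yx) mulr0.
have -> : tri f e = tri h e.
  rewrite -[RHS]add0r -(tri_lt hf (ltnSn _)) -triD; apply: tri_ext => x; by rewrite subrK.
rewrite /h; elim: (seg _) => [|y s IH].
  by rewrite big_nil -[RHS](tri0 e); apply: tri_ext => x; rewrite big_nil.
rewrite big_cons -IH -triZ -triD; apply: tri_ext => x; by rewrite big_cons.
Qed.

Lemma tri_fixed f : (forall e e', f e != 0 -> e' != e -> g e e' = 0) -> tri f =1 f.
Proof.
move=> fg e; symmetry; move: e; apply: tri_uniq => e.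
rewrite big_seq big1 ?subr0 // => e'; rewrite mem_seg => e'e.
have [->|fe'] := eqVneq (f e') 0; first by rewrite mul0r.
rewrite (fg e' e fe') ?mulr0 //; apply: contraTneq e'e => ->; by rewrite ltnn.
Qed.

Variables (R : realType) (v : K -> R).
Hypothesis hv : real_valued_field v.
Variable wt : E -> R.
Hypothesis wt_ge0 : forall e, 0 <= wt e.
Hypothesis g_tail : forall e, bounded v wt (fun e' => if e' == e then 0 else g e e') (2^-1 * wt e).

(* Each truncation to an initial segment satisfies S <= |f| + S / 2. *)
Lemma tri_bound f m :
  \sum_(e <- seg m) v (tri f e) * wt e <= 2 * \sum_(e <- seg m) v (f e) * wt e.
Proof.
set S := \sum_(e <- _) _; set T := \sum_(e <- _) _.
suff : S <= T + 2^-1 * S by lra.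
have t0 h e : 0 <= v h * wt e by rewrite mulr_ge0 // (abs_ge0 hv).
apply: (@le_trans _ _ (\sum_(e <- seg m) (v (f e) * wt e +
    \sum_(e' <- seg m) v (tri f e') * (v (if e == e' then 0 else g e' e) * wt e)))).
  rewrite /S big_seq [leRHS]big_seq; apply: ler_sum => e; rewrite mem_seg => em.
  rewrite triE.
  apply: le_trans (ler_wpM2r (wt_ge0 e) (absD hv _ _)) _.
  rewrite mulrDl lerD2l (absN hv).
  apply: le_trans (ler_wpM2r (wt_ge0 e) (abs_sum hv _ _ _)) _.
  rewrite mulr_suml.
  apply: (@le_trans _ _ (\sum_(e' <- seg (rk e)) v (tri f e') * (v (if e == e' then 0 else g e' e) * wt e))).
    rewrite big_seq [leRHS]big_seq; apply: ler_sum => e'; rewrite mem_seg => e'e.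
    case: eqP e'e => [->|_ _]; first by rewrite ltnn.
    by rewrite (absM hv) mulrA.
  apply: ler_sum_uniq; rewrite ?seg_uniq //.
  - by move=> x; rewrite !mem_seg => xe; exact: ltn_trans em.
  - by move=> x; rewrite mulr_ge0 ?(abs_ge0 hv).
rewrite big_split /= lerD2l exchange_big mulr_sumr; apply: ler_sum => e' _.
rewrite -mulr_sumr mulrCA; apply: ler_wpM2l; first exact: (abs_ge0 hv).
exact: g_tail (seg_uniq m).
Qed.

(** The order of the quantifiers matters: [S'] is chosen before [f], because the bound will be
    summed over all slices of a series, which need a common finite set. *)
Lemma tri_bound_seq (S : seq E) : uniq S -> exists S', uniq S' /\
  forall f, \sum_(e <- S) v (tri f e) * wt e <= 2 * \sum_(e <- S') v (f e) * wt e.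
Proof.
move=> uS; pose m := (\max_(e <- S) rk e).+1.
exists (seg m); split=> [|h]; first exact: seg_uniq.
apply: le_trans (tri_bound h m); apply: ler_sum_uniq; rewrite ?seg_uniq //.
- by move=> e eS; rewrite mem_seg ltnS; apply: leq_bigmax_seq.
- by move=> e; rewrite mulr_ge0 // (abs_ge0 hv).
Qed.

End Triangular.
End Segments.

(** * The order on the exponents *)

Fixpoint nth_prime (k : nat) : nat :=
  if k is k'.+1 then s2val (prime_above (nth_prime k')) else 2.

Lemma nth_prime_prime k : prime (nth_prime k).
Proof. by case: k => //= k; case: prime_above. Qed.

Lemma nth_prime_inj : injective nth_prime.
Proof.
have lt j k : (j < k)%N -> (nth_prime j < nth_prime k)%N.
  elim: k => // k IH; rewrite ltnS leq_eqVlt /= => /orP[/eqP ->|/IH jk].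
    by case: prime_above.
  by apply: ltn_trans jk _; case: prime_above.
move=> j k jk; case: (ltngtP j k) => // /lt; by rewrite jk ltnn.
Qed.

(* Exponents are compared by degree first, ties being broken by the value of  *)
(* the monomial at distinct primes: this value is injective by unique          *)
(* factorization, and the norms below give x ^ a the weight                    *)
(* delta ^ deg a / value ^ tau.                                                *)
Section PrimeOrder.
Variables V J : finType.
Implicit Types (e : mon V * J) (b : mon V).

Definition pr (x : (V + J)%type) : nat := nth_prime (enum_rank x).

Lemma pr_prime x : prime (pr x). Proof. exact: nth_prime_prime. Qed.

Lemma pr_gt0 x : (0 < pr x)%N. Proof. exact: prime_gt0 (pr_prime x). Qed.

Lemma pr_inj : injective pr.
Proof. by move=> x y /nth_prime_inj /ord_inj /enum_rank_inj. Qed.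

Definition mval b : nat := (\prod_i pr (inl i) ^ b i)%N.
(** A component acts as one more variable of exponent one, with a prime of its own, but it does not
    count in the degree. *)
Definition pval e : nat := (mval e.1 * pr (inr e.2))%N.
Definition edeg e : nat := mdeg e.1.
Definition eadd b e : mon V * J := (b + e.1, e.2).

Lemma mval_gt0 b : (0 < mval b)%N.
Proof. by rewrite prodn_gt0 // => i; rewrite expn_gt0 pr_gt0. Qed.

Lemma pval_gt0 e : (0 < pval e)%N.
Proof. by rewrite muln_gt0 mval_gt0 pr_gt0. Qed.

Lemma mvalD b c : mval (b + c) = (mval b * mval c)%N.
Proof. by rewrite /mval -big_split; apply: eq_bigr => i _; rewrite monDE expnD. Qed.

Lemma pvalD b e : pval (eadd b e) = (mval b * pval e)%N.
Proof. by rewrite /pval /= mvalD mulnA. Qed.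

Lemma edegD b e : edeg (eadd b e) = (mdeg b + edeg e)%N.
Proof. exact: mdegD. Qed.

Lemma logn_pr x y k : logn (pr x) (pr y ^ k) = if x == y then k else 0%N.
Proof.
rewrite lognX logn_prime ?pr_prime // (inj_eq pr_inj) eq_sym.
by case: eqP => _; rewrite ?muln1 ?muln0.
Qed.

Lemma logn_mval x b : logn (pr x) (mval b) = if x is inl i then b i else 0%N.
Proof.
suff -> : logn (pr x) (mval b) = (\sum_i logn (pr x) (pr (inl i) ^ b i))%N.
  under eq_bigr do rewrite logn_pr.
  case: x => [i|j]; last by rewrite big1.
  rewrite (bigD1 i) //= eqxx big1 ?addn0 // => k /negbTE ki.
  by rewrite (inj_eq inl_inj) eq_sym ki.
suff [] : logn (pr x) (mval b) = (\sum_i logn (pr x) (pr (inl i) ^ b i))%N /\ (0 < mval b)%N by [].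
rewrite /mval; elim/big_rec2: _ => [|i m n _ [mE n0]]; first by rewrite logn1.
by rewrite lognM ?mE ?muln_gt0 ?expn_gt0 ?pr_gt0.
Qed.

Lemma pval_inj : injective pval.
Proof.
have le e x : logn (pr x) (pval e) = (if x is inl i then e.1 i else (x == inr e.2 : nat))%N.
  rewrite lognM ?mval_gt0 ?pr_gt0 // logn_mval -[pr (inr _)]expn1 logn_pr.
  by case: x => [i|j]; rewrite ?addn0 ?add0n //; case: eqP.
move=> [a j] [a' j'] ee; congr pair.
  by apply/ffunP => i; have := le (a, j) (inl i); rewrite ee le.
have := le (a, j) (inr j); rewrite ee le eqxx /=.
by case: eqP => // -[].
Qed.

Let P := (\sum_x pr x)%N.

Let pr_le x : (pr x <= P)%N.
Proof. by rewrite /P (bigD1 x) //= leq_addr. Qed.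

(** The pair of degree and value is coded by one number, so that the triangular recursion can run
    over it: a value is at most [P ^ (edeg e).+1], which fits into the gap between consecutive
    powers of [P.+1]. *)
Definition erk e : nat := (pval e + P.+1 ^ (edeg e).+2)%N.

Let pval_le e : (pval e <= P ^ (edeg e).+1)%N.
Proof.
rewrite expnSr leq_mul ?pr_le // /mval /edeg /mdeg expn_sum.
by apply: leq_prod => i _; case: (e.1 i) => // k; rewrite leq_exp2r ?pr_le.
Qed.

Let erk_deg e e' : (edeg e < edeg e')%N -> (erk e < erk e')%N.
Proof.
move=> ee; rewrite /erk.
have P0 : (0 < P)%N by rewrite (leq_trans (pr_gt0 (inr e.2))) ?pr_le.
have : (P.+1 ^ (edeg e).+3 <= P.+1 ^ (edeg e').+2)%N by rewrite leq_exp2l // ltnS.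
have := pval_le e; have := pval_gt0 e'.
have : (P ^ (edeg e).+1 <= P.+1 ^ (edeg e).+2)%N.
  by apply: (@leq_trans (P.+1 ^ (edeg e).+1)); [rewrite leq_exp2r|rewrite leq_exp2l].
rewrite (expnS _ (edeg e).+2) mulSn.
have : (P.+1 ^ (edeg e).+2 <= P * P.+1 ^ (edeg e).+2)%N by rewrite leq_pmull.
lia.
Qed.

Lemma erk_lt e e' : (erk e < erk e')%N =
  ((edeg e < edeg e')%N || ((edeg e == edeg e') && (pval e < pval e')%N)).
Proof.
case: (ltngtP (edeg e) (edeg e')) => [/erk_deg ->//|/erk_deg /ltnW|ee] /=.
  by rewrite leqNgt => /negbTE.
by rewrite /erk ee ltn_add2r.
Qed.

Lemma erk_inj : injective erk.
Proof.
move=> e e' ee; have := erk_lt e e'; have := erk_lt e' e; rewrite ee ltnn.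
case: (ltngtP (edeg e) (edeg e')) => //= _; case: ltngtP => // /pval_inj //.
Qed.

Lemma erk_add b e e' : (erk (eadd b e) < erk (eadd b e'))%N = (erk e < erk e')%N.
Proof. by rewrite !erk_lt !edegD !pvalD ltn_add2l eqn_add2l ltn_pmul2l ?mval_gt0. Qed.

Lemma edeg_le e e' : (erk e <= erk e')%N -> (edeg e <= edeg e')%N.
Proof.
rewrite leq_eqVlt => /orP[/eqP/erk_inj->//|].
by rewrite erk_lt => /orP[/ltnW//|/andP[/eqP ->]].
Qed.

Lemma eadd_inj b : injective (eadd b).
Proof. by move=> [a j] [a' j'] [/monDI -> ->]. Qed.

Lemma eadd0 e : eadd 0 e = e.
Proof. by case: e => a j; rewrite /eadd /= add0r. Qed.

End PrimeOrder.

(** * Polyradii for which leads dominate *)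

Lemma small_common (R : realFieldType) (T : finType) (P : T -> R -> Prop) :
  (forall i, exists2 d, 0 < d & forall x, 0 < x <= d -> P i x) ->
  exists2 d, 0 < d & forall x, 0 < x <= d -> forall i, P i x.
Proof.
move=> h; suff [d d0 dP] : exists2 d, 0 < d & forall x, 0 < x <= d -> forall i, i \in enum T -> P i x.
  by exists d => // x xd i; apply: dP; rewrite ?mem_enum.
elim: (enum T) => [|i s [d d0 dP]]; first by exists 1.
have [d' d'0 d'P] := h i; exists (Num.min d d'); first by rewrite lt_min d0.
move=> x /andP[x0]; rewrite le_min => /andP[xd xd'] j.
by rewrite inE => /orP[/eqP ->|]; [apply: d'P|apply: dP]; rewrite x0.
Qed.

Lemma large_common (T : finType) (P : T -> nat -> Prop) :
  (forall i, exists m, forall x, (m <= x)%N -> P i x) ->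
  exists m, forall x, (m <= x)%N -> forall i, P i x.
Proof.
move=> /choice[m mP]; exists (\max_i m i) => x mx i; apply: mP.
by apply: leq_trans mx; exact: leq_bigmax.
Qed.

Lemma pos_lower (R : realFieldType) (T : finType) (w : T -> R) :
  (forall i, 0 < w i) -> exists2 d, 0 < d & forall x, 0 < x <= d -> forall i, x <= w i.
Proof. by move=> w0; apply: small_common => i; exists (w i) => // x /andP[]. Qed.

Lemma bernoulli_ge (R : realFieldType) (x : R) m : 0 <= x -> 1 + m%:R * x <= (1 + x) ^+ m.
Proof.
move=> x0; elim: m => [|m IH]; first by rewrite mul0r addr0.
rewrite exprS; apply: (@le_trans _ _ ((1 + x) * (1 + m%:R * x))).
  rewrite -natr1; have : 0 <= m%:R * (x * x) by rewrite mulr_ge0 // mulr_ge0.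
  nra.
by rewrite ler_wpM2l // addr_ge0.
Qed.

Section Weights.
Variables (R : realType) (K : fieldType) (v : K -> R).
Hypothesis hv : real_valued_field v.
Variables V J : finType.
Implicit Types (e : mon V * J).

Definition ewt (w : V -> R) (k : J -> R) e := mwt w e.1 * k e.2.

Lemma ewt_add w k b e : ewt w k (eadd b e) = mwt w b * ewt w k e.
Proof. by rewrite /ewt /= mwtD mulrA. Qed.

Lemma ewt_gt0 w k e : (forall i, 0 < w i) -> (forall j, 0 < k j) -> 0 < ewt w k e.
Proof. by move=> w0 k0; rewrite mulr_gt0 // mwt_gt0. Qed.

Definition prime_wt (tau : nat) : V -> R := fun i => ((pr (inl i : V + J))%:R)^-1 ^+ tau.
Definition prime_kt (tau : nat) : J -> R := fun j => ((pr (inr j : V + J))%:R)^-1 ^+ tau.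

Lemma prime_ewt tau d e :
  ewt (fun i => d * prime_wt tau i) (prime_kt tau) e = d ^+ edeg e * (pval e)%:R^-1 ^+ tau.
Proof.
rewrite /ewt mwt_scale -mulrA; congr (_ * _).
rewrite /pval natrM invfM exprMn; congr (_ * _).
rewrite /mval natr_prod -prodfV -prodrXl; apply: eq_bigr => i _.
by rewrite /prime_wt natrX exprVn exprVn exprVn -!exprM mulnC.
Qed.

(** Values are integers, so one that exceeds [m] is at least [m.+1], and by Bernoulli the power (1 +
    1/m) ^ tau exceeds any given bound. *)
Lemma ratio_small (A : R) (m : nat) : 0 <= A -> (0 < m)%N ->
  exists tau0, forall tau, (tau0 <= tau)%N ->
    A * (m.+1%:R^-1) ^+ tau <= 4^-1 * m%:R^-1 ^+ tau.
Proof.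
move=> A0 m0; have mR : (0 : R) < m%:R by rewrite ltr0n.
pose t0 := Num.Def.archi_bound (4 * A * m%:R : R).
exists t0 => tau tt.
have lt : 4 * A * m%:R <= tau%:R.
  apply: le_trans (_ : t0%:R <= _); last by rewrite ler_nat.
  by apply/ltW/archi_boundP; rewrite !mulr_ge0 // ltW.
rewrite [in leLHS]exprVn ler_pdivrMr ?exprn_gt0 ?ltr0n // -mulrA -exprMn [m%:R^-1 * _]mulrC.
have -> : (m.+1%:R / m%:R : R) = 1 + m%:R^-1.
  by rewrite -natr1 mulrDl divff ?gt_eqF // mul1r.
have := bernoulli_ge tau (ltW (_ : (0 : R) < m%:R^-1)); rewrite invr_gt0 => /(_ mR) B.
suff : 4 * A <= (1 + m%:R^-1) ^+ tau by lra.
apply: le_trans B; suff : 4 * A <= tau%:R * m%:R^-1 by lra.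
by rewrite ler_pdivlMr.
Qed.

(* First tau is taken so large that each lead dominates the other terms of its    *)
(* degree, which are finitely many, then delta so small that it dominates the     *)
(* terms of higher degree; every smaller delta still works.                       *)
Lemma dominant_lead (T : finType) (gam : T -> mon V * J) (g : T -> mon V * J -> K) :
  (forall i e, (erk e < erk (gam i))%N -> g i e = 0) ->
  (forall i, exists w C, (forall x, 0 < w x) /\ bounded v (fun e => mwt w e.1) (g i) C) ->
  exists w k, [/\ forall i, 0 < w i, forall j, 0 < k j &
   forall c i, 0 < c <= 1 ->
     bounded v (ewt (fun x => c * w x) k) (fun e => if e == gam i then 0 else g i e)
       (2^-1 * ewt (fun x => c * w x) k (gam i))].
Proof.
move=> glow /choice[W /choice[C gW]].
have vg i e : 0 <= v (g i e) by exact: (abs_ge0 hv).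
have [d0 d00 dW] : exists2 d, 0 < d & forall i x, d <= W i x.
  have [|d d0 dW] := @small_common _ T (fun i d => forall x, d <= W i x).
    by move=> i; apply: pos_lower; case: (gW i).
  by exists d => // i x; apply: dW; rewrite d0 lexx.
have gd i S : uniq S -> \sum_(e <- S) v (g i e) * d0 ^+ edeg e <= C i.
  case: (gW i) => W0 gC uS; apply: le_trans (gC S uS); apply: ler_sum => e _.
  rewrite ler_wpM2l // -mwt_cst; apply: mwt_le => x; by rewrite ltW ?dW.
pose D i := [seq e <- [seq (a, j) | a <- mons V (edeg (gam i)), j <- enum J] |
               (edeg e == edeg (gam i)) && (e != gam i)].
have uD i : uniq (D i).
  by rewrite filter_uniq // allpairs_uniq ?mons_uniq ?enum_uniq // => -[a j] [a' j'].
have memD i e : (e \in D i) = (edeg e == edeg (gam i)) && (e != gam i).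
  rewrite mem_filter andb_idr // => /andP[/eqP ed _].
  by apply/allpairsP; exists e; rewrite -ed mem_enum mem_mons leqnn; case: (e).
have [tau htau] : exists tau, forall i,
   \sum_(e <- D i) v (g i e) * (pval e)%:R^-1 ^+ tau <= 4^-1 * (pval (gam i))%:R^-1 ^+ tau.
  have [|t ht] := @large_common T (fun i tau => \sum_(e <- D i) v (g i e) * (pval e)%:R^-1 ^+ tau
      <= 4^-1 * (pval (gam i))%:R^-1 ^+ tau); last by exists t => i; apply: ht.
  move=> i; have A0 : 0 <= \sum_(e <- D i) v (g i e) by apply: sumr_ge0.
  have [t ht] := ratio_small A0 (pval_gt0 (gam i)); exists t => s /ht; apply: le_trans.
  rewrite mulr_suml big_seq [leRHS]big_seq; apply: ler_sum => e; rewrite memD => /andP[/eqP ed ne].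
  have [->|ge0] := eqVneq (g i e) 0; first by rewrite (abs0 hv) !mul0r.
  rewrite ler_wpM2l // lerXn2r ?nnegrE ?invr_ge0 ?ler0n //.
  rewrite lef_pV2 ?posrE ?ltr0n ?pval_gt0 // ler_nat.
  have : ~~ (erk e < erk (gam i))%N by apply: contra_neqN ge0 => /glow.
  rewrite -leqNgt leq_eqVlt => /orP[/eqP/erk_inj ge|]; first by rewrite ge eqxx in ne.
  by rewrite erk_lt ed ltnn eqxx.
have [d1 d10 hd] : exists2 d, 0 < d & forall x, 0 < x <= d -> forall i S, uniq S ->
    \sum_(e <- S | (edeg (gam i) < edeg e)%N) v (g i e) * x ^+ edeg e <=
      4^-1 * (x ^+ edeg (gam i) * (pval (gam i))%:R^-1 ^+ tau).
  apply: small_common => i; set n := edeg (gam i); set q := _ ^+ tau.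
  have q0 : 0 < q by rewrite exprn_gt0 // invr_gt0 ltr0n pval_gt0.
  have C0 : 0 <= C i by case: (gW i) => _ /bounded_ge0.
  (* For x at most [d0] the terms of degree above [n] gain the factor (x / d0) ^ (n + 1) over their
     bound [C i]. Of this, x ^ n belongs to the weight of the lead, and [x0] makes the remaining x *
     C i / d0 ^ (n + 1) at most a quarter of [q]. *)
  pose x0 := 4^-1 * q * d0 ^+ n.+1 / (C i + 1).
  have x00 : 0 < x0.
    rewrite /x0; apply: divr_gt0; last by apply: ltr_wpDl.
    by apply: mulr_gt0; [apply: mulr_gt0|apply: exprn_gt0].
  exists (Num.min d0 x0); first by rewrite lt_min d00.
  move=> x /andP[xp]; rewrite le_min => /andP[xd xx0] S uS.
  apply: (@le_trans _ _ ((x / d0) ^+ n.+1 * C i)).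
    apply: le_trans (ler_wpM2l _ (gd i S uS)); last by rewrite exprn_ge0 // divr_ge0 // ltW.
    rewrite mulr_sumr [leRHS](bigID (fun e => n < edeg e)%N) /= -[leLHS]addr0 lerD //; last first.
      by apply: sumr_ge0 => e _; rewrite !mulr_ge0 // exprn_ge0 ?divr_ge0 // ltW.
    apply: ler_sum => e ne; rewrite mulrCA ler_wpM2l //.
    rewrite -(subnKC ne) !exprD mulrA -exprMn divfK ?gt_eqF //.
    rewrite ler_wpM2l ?exprn_ge0 ?(ltW xp) // lerXn2r // nnegrE; exact: ltW.
  have D0 : 0 < d0 ^+ n.+1 by rewrite exprn_gt0.
  have key : x * C i / d0 ^+ n.+1 <= 4^-1 * q.
    rewrite ler_pdivrMr //; rewrite /x0 ler_pdivlMr ?ltr_wpDl // in xx0.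
    by apply: le_trans xx0; rewrite ler_wpM2l ?(ltW xp) // lerDl.
  have -> : (x / d0) ^+ n.+1 * C i = x ^+ n * (x * C i / d0 ^+ n.+1).
    by rewrite expr_div_n exprSr; ring.
  by rewrite [leRHS]mulrCA ler_wpM2l // exprn_ge0 // ltW.
exists (fun x => d1 * prime_wt tau x), (prime_kt tau); split.
- by move=> i; rewrite mulr_gt0 // exprn_gt0 // invr_gt0 ltr0n pr_gt0.
- by move=> i; rewrite exprn_gt0 // invr_gt0 ltr0n pr_gt0.
move=> c i /andP[c0 c1] S uS.
have cd : 0 < c * d1 <= d1 by rewrite mulr_gt0 //= ger_pMl.
have {}hd := hd _ cd i S uS.
have cd0 : 0 < c * d1 by case/andP: cd.
have E e : ewt (fun x => c * (d1 * prime_wt tau x)) (prime_kt tau) e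
    = (c * d1) ^+ edeg e * (pval e)%:R^-1 ^+ tau.
  by rewrite -prime_ewt; congr (mwt _ _ * _); apply/funext => x; rewrite mulrA.
rewrite E; under eq_bigr do rewrite E.
set n := edeg (gam i) in hd *.
(* One quarter pays for the other terms in the degree of the lead, one for the higher degrees; there
   are none below. *)
have -> : (2^-1 : R) = 4^-1 + 4^-1 by lra.
rewrite mulrDl.
apply: (@le_trans _ _ (\sum_(e <- S | edeg e == n) v (if e == gam i then 0 else g i e) *
      ((c * d1) ^+ n * (pval e)%:R^-1 ^+ tau) +
      \sum_(e <- S | (n < edeg e)%N) v (g i e) * (c * d1) ^+ edeg e)); last first.
  apply: lerD => //; rewrite mulrCA; apply: le_trans (ler_wpM2l _ (htau i)); last first.
    by rewrite exprn_ge0 // ltW.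
  rewrite mulr_sumr [leLHS](_ : _ = \sum_(e <- [seq e <- S | (edeg e == n) && (e != gam i)])
      (c * d1) ^+ n * (v (g i e) * (pval e)%:R^-1 ^+ tau)); last first.
    rewrite big_filter big_mkcond [RHS]big_mkcond; apply: eq_bigr => e _ /=.
    case: (edeg e == n) => //=; case: (e == gam i); first by rewrite (abs0 hv) mul0r.
    by rewrite mulrCA.
  apply: ler_sum_uniq; rewrite ?uD ?filter_uniq //.
  - by move=> e; rewrite memD mem_filter => /andP[].
  - move=> e; rewrite !mulr_ge0 ?exprn_ge0 ?invr_ge0 //; exact: ltW.
rewrite (bigID (fun e => edeg e == n)) /=; apply: lerD.
  by apply: ler_sum => e /eqP ->.
rewrite (bigID (fun e => n < edeg e)%N) /= [X in _ + X]big1 ?addr0 => [|e /andP[nn]]; last first.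
  rewrite -leqNgt => en; rewrite glow ?if_same ?(abs0 hv) ?mul0r //.
  by rewrite erk_lt ltn_neqAle nn en.
rewrite big_mkcond [leRHS]big_mkcond; apply: ler_sum => e _ /=.
case: (ltnP n (edeg e)) => ne; rewrite ?andbF //.
rewrite gtn_eqF //= ; have -> : (e == gam i) = false.
  by apply: contraTF ne => /eqP ->; rewrite ltnn.
(* Values are at least 1, so in higher degrees their inverse powers are simply dropped. *)
rewrite ler_wpM2l // ler_piMr ?exprn_ge0 ?(ltW cd0) // exprn_ile1 ?invr_ge0 ?ler0n //.
by rewrite invf_le1 ?ltr0n ?pval_gt0 // ler1n pval_gt0.
Qed.

End Weights.

(** * Standard bases *)

Lemma finite_of_size_bound (T : eqType) (A : set T) (p : nat) :
  (forall s, uniq s -> (forall x, x \in s -> A x) -> (size s <= p)%N) ->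
  exists L : seq T, (forall x, x \in L -> A x) /\ (forall x, A x -> x \in L).
Proof.
move=> bd; apply: contrapT => nL.
suff /(_ p.+1)[s [us [sA sz]]] : forall n, exists s : seq T, uniq s /\ (forall x, x \in s -> A x) /\ size s = n.
  by have := bd s us sA; rewrite sz ltnn.
elim=> [|n [s [us [sA <-]]]]; first by exists [::].
have [x [Ax xs]] : exists x, A x /\ x \notin s.
  apply: contrapT => nx; apply: nL; exists s; split=> // x Ax.
  by apply: contrapT => /negP xs; apply: nx; exists x.
exists (x :: s); split; first by rewrite /= xs.
by split=> // y; rewrite inE => /orP[/eqP ->|/sA].
Qed.

Section StandardBasis.
Variables (K : fieldType) (V J : finType).
Implicit Types (e : mon V * J) (f g : mon V * J -> K) (b : mon V).

Definition lead f e := f e <> 0 /\ forall e', (erk e' < erk e)%N -> f e' = 0.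

Definition eshift b f e := if mle b e.1 then f (msub e.1 b, e.2) else 0.

Definition conv (h : mon V -> K) f e := \sum_(b <- below e.1) h b * f (msub e.1 b, e.2).

Lemma eadd_ex (e e' : mon V * J) : mle e'.1 e.1 -> e'.2 = e.2 -> e = eadd (msub e.1 e'.1) e'.
Proof. by case: e e' => a j [a' j'] /= aa ->; rewrite /eadd /= addrC msubK. Qed.

Lemma lead_exists f : (exists e, f e <> 0) -> exists e, lead f e.
Proof.
move=> [e fe]; have /ex_minnP[m] : exists m, `[< exists2 e, f e <> 0 & erk e = m >].
  by exists (erk e); apply/asboolP; exists e.
move=> /asboolP[e0 fe0 <-] min; exists e0; split=> // e' e'e; apply: contrapT => fe'.
have : (erk e0 <= erk e')%N by apply: min; apply/asboolP; exists e'.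
by rewrite leqNgt e'e.
Qed.

(** The component is encoded as an exponent with a single entry 1, so that divisibility of the codes
    forces equal components, and the statement for monomials applies. *)
Lemma dickson_exp (S : set (mon V * J)) : exists L : seq (mon V * J),
  (forall e, e \in L -> S e) /\ (forall e, S e -> exists e' b, e' \in L /\ e = eadd b e').
Proof.
pose enc e : mon (V + J)%type := mjoin e.1 (mdelta e.2).
have [L [LS SL]] := dickson [set enc e | e in S].
have [L' [L'S LE]] : exists L' : seq (mon V * J), (forall e, e \in L' -> S e) /\ L = map enc L'.
  elim: L LS {SL} => [|a L IH] LS; first by exists [::].
  have [L' [L'S LE]] : exists L' : seq (mon V * J), (forall e, e \in L' -> S e) /\ L = map enc L'.
    by apply: IH => x xL; apply: LS; rewrite inE xL orbT.
  have [e Se ea] := LS a (mem_head _ _); exists (e :: L'); split; last by rewrite /= LE ea.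
  by move=> x; rewrite inE => /orP[/eqP ->|/L'S].
exists L'; split=> // e Se; have [a] : exists2 b, b \in L & mle b (enc e) by apply: SL; exists e.
rewrite LE => /mapP[e' e'L ->]; rewrite mle_join !lmonE !rmonE => /andP[le1 le2].
exists e', (msub e.1 e'.1); split=> //; apply: eadd_ex => //.
by move/mleP/(_ e'.2): le2; rewrite !ffunE eqxx; case: eqP.
Qed.

Variable p : nat.
(* P c f reads: f = A c + m, with A a fixed matrix with p columns and m in a module; *)
(* P 0 is the module itself.                                                         *)
Variable P : 'rV[K]_p -> (mon V * J -> K) -> Prop.
Hypothesis P0 : P 0 (fun=> 0).
Hypothesis P_lin : forall c c' f f' k, P c f -> P c' f' -> P (c + k *: c') (fun e => f e + k * f' e).

Let leads0 : set (mon V * J) := [set e | exists2 f, P 0 f & lead f e].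
Let leads : set (mon V * J) := [set e | exists c f, P c f /\ lead f e].

Lemma P_sum (I : Type) (r : seq I) (d : I -> K) (c : I -> 'rV[K]_p) (f : I -> mon V * J -> K) :
  (forall i, P (c i) (f i)) ->
  P (\sum_(i <- r) d i *: c i) (fun e => \sum_(i <- r) d i * f i e).
Proof.
move=> Pf; elim: r => [|i r IH].
  by rewrite big_nil; under eq_fun do rewrite big_nil.
have -> : (fun e => \sum_(j <- i :: r) d j * f j e) = (fun e => \sum_(j <- r) d j * f j e + d i * f i e).
  by apply/funext => e; rewrite big_cons addrC.
by rewrite big_cons addrC; exact: P_lin.
Qed.

Lemma P_scale k c f : P c f -> P (k *: c) (fun e => k * f e).
Proof. by move=> /(P_lin k P0); rewrite add0r; under eq_fun do rewrite add0r. Qed.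

(* More than p elements have a combination in P 0, and distinct leads do not cancel. *)
Lemma new_leads_bound s : uniq s -> (forall e, e \in s -> (leads `\` leads0) e) -> (size s <= p)%N.
Proof.
move=> us sl; rewrite leqNgt; apply/negP => ps.
have /choice[c /choice[f cf]] : forall i : 'I_(size s), exists c f,
    P c f /\ lead f (tnth (in_tuple s) i).
  by move=> i; have [[c [f cf]] _] := sl _ (mem_tnth i (in_tuple s)); exists c, f.
pose M : 'M[K]_(size s, p) := \matrix_i c i.
have : kermx M != 0.
  rewrite -mxrank_eq0 mxrank_ker subn_eq0 -ltnNge; apply: leq_ltn_trans ps; exact: rank_leq_col.
move=> /rowV0Pn[d /sub_kermxP dM /rV0Pn[i1 di1]].
have Pd := P_sum (index_enum 'I_(size s)) (d 0) (fun i => (cf i).1).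
have dc0 : \sum_i d 0 i *: c i = 0.
  transitivity (d *m M); last exact: dM.
  by rewrite mulmx_sum_row; apply: eq_bigr => i _; rewrite rowK.
rewrite dc0 in Pd.
case: (@arg_minnP _ i1 (fun i => d 0 i != 0) (fun i => erk (tnth (in_tuple s) i)) di1) => i0 di0 min.
have [_ []] := sl _ (mem_tnth i0 (in_tuple s)).
exists (fun e => \sum_i d 0 i * f i e); first exact: Pd.
split=> [|e' e'e].
  rewrite (bigD1 i0) //= big1 ?addr0 => [|i ii0].
    by apply/eqP; rewrite mulf_neq0 //; apply/eqP; case: (cf i0) => _ [].
  have [->|di] := eqVneq (d 0 i) 0; first by rewrite mul0r.
  case: (cf i) => _ [_ ->]; rewrite ?mulr0 //.
  rewrite ltn_neqAle min // andbT; apply: contraNneq ii0 => /erk_inj ee; apply/eqP/esym.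
  exact: (tuple_uniqP (in_tuple s) us).
rewrite big1 // => i _; have [->|di] := eqVneq (d 0 i) 0; first by rewrite mul0r.
by case: (cf i) => _ [_ ->]; rewrite ?mulr0 //; apply: leq_trans e'e (min i di).
Qed.

(** [ix e] names the element that reduces the exponent [e]. If [e] is a lead of the module [P 0],
    this is an element of the module, shifted. Any other lead is one of at most p, each with an
    element of its own used with shift [b = 0], since a shifted column need not be in the space. *)
Lemma standard_basis : exists (T : finType) (gam : T -> mon V * J) (c : T -> 'rV[K]_p)
    (g : T -> mon V * J -> K) (ix : mon V * J -> option T),
  [/\ forall i, [/\ P (c i) (g i), g i (gam i) = 1 &
        forall e, (erk e < erk (gam i))%N -> g i e = 0],
      forall e i, ix e = Some i -> exists b, e = eadd b (gam i) /\ (b = 0 \/ c i = 0)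
    & forall e, ix e = None -> forall c f, P c f -> ~ lead f e].
Proof.
have norm c f e : P c f -> lead f e -> exists2 k, P (k *: c) (fun e => k * f e) &
    k * f e = 1 /\ forall e', (erk e' < erk e)%N -> k * f e' = 0.
  move=> Pf [/eqP fe f0]; exists (f e)^-1; first exact: P_scale.
  by rewrite mulVf //; split=> // e' /f0 ->; rewrite mulr0.
have [L0 [L0S SL0]] := dickson_exp leads0.
have [L1 [L1S SL1]] := finite_of_size_bound new_leads_bound.
pose L := L0 ++ L1.
have /choice[c /choice[g cg]] : forall i : seq_sub L, exists c g,
    [/\ P c g, g (ssval i) = 1, forall e, (erk e < erk (ssval i))%N -> g e = 0
      & ssval i \in L0 -> c = 0].
  move=> [e /= eL]; have [eL0|eL0] := boolP (e \in L0).
    have [f Pf le] := L0S e eL0; have [k Pk [k1 k0]] := norm _ _ _ Pf le.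
    by rewrite scaler0 in Pk; exists 0, (fun e => k * f e).
  have [[c [f [Pf le]]] _] : (leads `\` leads0) e.
    by apply: L1S; move: eL; rewrite mem_cat (negbTE eL0).
  have [k Pk [k1 k0]] := norm _ _ _ Pf le.
  by exists (k *: c), (fun e => k * f e).
have /choice[ix ixP] : forall e, exists o : option (seq_sub L),
    if o is Some i then exists b, e = eadd b (ssval i) /\ (b = 0 \/ c i = 0)
    else ~ leads e.
  move=> e; have [le|nle] := pselect (leads e); last by exists None.
  have [l0|nl0] := pselect (leads0 e).
    have [e' [b [e'L eb]]] := SL0 e l0.
    have e'L' : e' \in L by rewrite mem_cat e'L.
    exists (Some (SeqSub e'L')); exists b; split=> //; right.
    by case: (cg (SeqSub e'L')) => _ _ _; apply.
  have eL : e \in L by rewrite mem_cat SL1 ?orbT.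
  by exists (Some (SeqSub eL)); exists 0; rewrite eadd0; split=> //; left.
exists (seq_sub L), (@ssval _ L), c, g, ix; split.
- by move=> i; case: (cg i).
- by move=> e i ie; have := ixP e; rewrite ie.
- by move=> e ie c' f Pf le; have := ixP e; rewrite ie; apply; exists c', f.
Qed.

End StandardBasis.

(** * Division *)

Lemma addIm (V : finType) (a b c : mon V) : b + a = c + a -> b = c.
Proof. by rewrite ![_ + a]addrC; exact: monDI. Qed.

Section Division.
Variables (K : fieldType) (V J T : finType).
Implicit Types (e : mon V * J) (f : mon V * J -> K) (b : mon V).
Variables (gam : T -> mon V * J) (g : T -> mon V * J -> K) (ix : mon V * J -> option T).
Hypothesis g_lead : forall i, g i (gam i) = 1.
Hypothesis g_low : forall i e, (erk e < erk (gam i))%N -> g i e = 0.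
Hypothesis ix_add : forall e i, ix e = Some i -> exists b, e = eadd b (gam i).

(** Row [e] of a unitriangular matrix: the basis element shifted so that its lead is [e], or the
    monomial [e] itself if it is not reducible. Expanding a series in these rows is division: the
    rows of the first kind collect into quotients, those of the second into the remainder. *)
Definition reducer e e' : K :=
  if ix e is Some i then eshift (msub e.1 (gam i).1) (g i) e' else (e' == e)%:R.

Lemma reducerE b i e' : ix (eadd b (gam i)) = Some i ->
  reducer (eadd b (gam i)) e' = eshift b (g i) e'.
Proof. by rewrite /reducer => -> /=; rewrite addrC maddK. Qed.

Lemma eshift_add b f e : eshift b f (eadd b e) = f e.
Proof. by case: e => a j; rewrite /eshift /= mle_addr maddK. Qed.

Lemma reducer_diag e : reducer e e = 1.
Proof.
case ie: (ix e) => [i|]; last by rewrite /reducer ie eqxx.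
by have [b eb] := ix_add ie; move: ie; rewrite eb => /reducerE ->; rewrite eshift_add.
Qed.

Lemma reducer_low e e' : (erk e' < erk e)%N -> reducer e e' = 0.
Proof.
move=> e'e; case ie: (ix e) => [i|]; last first.
  by rewrite /reducer ie; case: eqP e'e => // ->; rewrite ltnn.
have [b eb] := ix_add ie; move: ie e'e; rewrite eb => /reducerE -> {eb}; rewrite /eshift.
case: (boolP (mle b e'.1)) => // be' e'e; apply: g_low.
by rewrite -(erk_add b) /eadd /= msubK //; case: e' e'e {be'}.
Qed.

Definition coefs f := tri (@erk_inj V J) reducer f.

Definition quo (i : T) f b : K :=
  if ix (eadd b (gam i)) == Some i then coefs f (eadd b (gam i)) else 0.

Definition nf f e : K := if ix e is Some _ then 0 else coefs f e.

Lemma division f e : f e = \sum_i conv (quo i f) (g i) e + nf f e.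
Proof.
rewrite {1}(tri_sum (@erk_inj V J) reducer_diag reducer_low f (ltnSn (erk e))) -/(coefs f).
set S := seg _ _.
have uS : uniq S by exact: seg_uniq.
transitivity (\sum_(e' <- S) (\sum_i (if ix e' == Some i then coefs f e' * reducer e' e else 0)
    + (if ix e' is Some _ then 0 else coefs f e' * reducer e' e))).
  apply: eq_bigr => e' _; case ie: (ix e') => [i|] /=.
    rewrite addr0 (bigD1 i) //= eqxx big1 ?addr0 // => k ki.
    by rewrite (inj_eq Some_inj) eq_sym (negbTE ki).
  by rewrite big1 ?add0r.
rewrite big_split exchange_big /=; congr (_ + _).
  apply: eq_bigr => i _; rewrite /conv.
  transitivity (\sum_(e' <- [seq eadd b (gam i) | b <- below e.1])
      (if ix e' == Some i then coefs f e' * reducer e' e else 0)); last first.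
    rewrite big_map big_seq [RHS]big_seq; apply: eq_bigr => b; rewrite mem_below => be.
    rewrite /quo; case: eqP => [ie|_]; last by rewrite mul0r.
    by rewrite reducerE // /eshift be.
  apply: big_uniq_supp => //.
  - by rewrite map_inj_uniq ?below_uniq // => b c [] /addIm.
  - move=> e' _; case: eqP => // ie; have [b eb] := ix_add ie; rewrite eb in ie *.
    move=> nb; rewrite reducerE // /eshift; case: (boolP (mle b e.1)) => be; last by rewrite mulr0.
    by case/negP: nb; apply/mapP; exists b; rewrite // mem_below.
  - move=> e' _; rewrite mem_seg ltnS -ltnNge => ee'; case: eqP => // ie.
    by rewrite reducer_low ?mulr0.
rewrite (bigD1_seq e) //= ?mem_seg // big1 => [|e' ne]; last first.
  by rewrite /reducer; case: (ix e') => //; rewrite eq_sym (negbTE ne) mulr0.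
by rewrite addr0 /nf; case: (ix e) => //; rewrite reducer_diag mulr1.
Qed.

Lemma nf_matrix f e : nf f e =
  \sum_(e' <- seg (@erk_inj V J) (erk e).+1) f e' * nf (fun x => (x == e')%:R) e.
Proof.
rewrite /nf; case: (ix e) => [_|]; first by rewrite big1 // => e' _; rewrite mulr0.
exact: tri_matrix.
Qed.

Lemma nf_lt k f : (forall e, (edeg e < k)%N -> f e = 0) -> forall e, (edeg e < k)%N -> nf f e = 0.
Proof.
move=> f0 e ek; rewrite /nf; case: (ix e) => // ; apply: (@tri_lt _ _ _ _ _ (erk e).+1) => // e' e'e.
by apply: f0; apply: leq_ltn_trans ek; exact: edeg_le.
Qed.

Lemma nf_fixed f : (forall e, ix e <> None -> f e = 0) -> nf f =1 f.
Proof.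
move=> f0 e; rewrite /nf; case ie: (ix e) => [i|]; first by rewrite f0 // ie.
apply: tri_fixed => {e ie} e e' fe e'e; rewrite /reducer.
by case ie: (ix e) => [i|]; [rewrite f0 ?eqxx ?ie // in fe|rewrite (negbTE e'e)].
Qed.

Lemma nf_supp f e : ix e <> None -> nf f e = 0.
Proof. by rewrite /nf; case: (ix e). Qed.

Section Bounds.
Variables (R : realType) (v : K -> R).
Hypothesis hv : real_valued_field v.
Variables (w : V -> R) (k : J -> R).
Hypotheses (w_gt0 : forall i, 0 < w i) (k_gt0 : forall j, 0 < k j).
Hypothesis g_tail : forall i,
  bounded v (ewt w k) (fun e => if e == gam i then 0 else g i e) (2^-1 * ewt w k (gam i)).

Let wt0 e : 0 < ewt w k e. Proof. exact: ewt_gt0. Qed.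
Let wt_ge0 e : 0 <= ewt w k e. Proof. exact: ltW. Qed.

(** A shift multiplies every weight by the same factor [mwt w b], so domination by the lead passes
    from [g i] to its monomial multiples. *)
Lemma reducer_tail e :
  bounded v (ewt w k) (fun e' => if e' == e then 0 else reducer e e') (2^-1 * ewt w k e).
Proof.
case ie: (ix e) => [i|]; last first.
  rewrite /reducer ie; apply: (@bounded_le _ _ _ _ _ _ 0); first by rewrite mulr_ge0.
  move=> S _; rewrite big1 // => e' _; by case: eqP; rewrite (abs0 hv) mul0r.
have [b eb] := ix_add ie; rewrite eb in ie *; rewrite ewt_add mulrCA => S uS.
pose S' := [seq (msub e'.1 b, e'.2) | e' <- S & mle b e'.1].
have uS' : uniq S'.
  rewrite map_inj_in_uniq ?filter_uniq // => -[a j] [a' j'].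
  rewrite !mem_filter /= => /andP[ba _] /andP[ba' _] [aa' ->].
  by rewrite -(msubK ba) aa' msubK.
apply: le_trans (ler_wpM2l (ltW (mwt_gt0 b w_gt0)) (g_tail i uS')).
rewrite /S' big_map big_filter mulr_sumr [leRHS]big_mkcond; apply: ler_sum => -[a j] _ /=.
case: (boolP (mle b a)) => ba; last first.
  by rewrite reducerE // /eshift /= (negbTE ba) if_same (abs0 hv) mul0r.
have -> : ((a, j) == eadd b (gam i)) = ((msub a b, j) == gam i).
  by rewrite -{1}(msubK ba) -[(_, j)]/(eadd b (msub a b, j)) (inj_eq (@eadd_inj _ _ b)).
have -> : ewt w k (a, j) = mwt w b * ewt w k (msub a b, j).
  by rewrite -ewt_add /eadd /= msubK.
by rewrite reducerE // /eshift /= ba mulrCA.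
Qed.

Lemma quo_bound i (S : seq (mon V)) : uniq S -> exists S', uniq S' /\ forall f,
  \sum_(b <- S) v (quo i f b) * mwt w b <=
    2 / ewt w k (gam i) * \sum_(e <- S') v (f e) * ewt w k e.
Proof.
move=> uS.
have [|S' [uS' hS']] := @tri_bound_seq _ _ (@erk_inj V J) _ reducer _ _ hv _ wt_ge0 reducer_tail
  [seq eadd b (gam i) | b <- S].
  by rewrite map_inj_uniq // => b c [] /addIm.
exists S'; split=> // f; rewrite mulrAC ler_pdivlMr //.
apply: le_trans (hS' f); rewrite big_map mulr_suml; apply: ler_sum => b _.
rewrite ewt_add mulrA; apply: ler_wpM2r => //; apply: ler_wpM2r; first exact/ltW/mwt_gt0.
by rewrite /quo; case: eqP; rewrite // (abs0 hv) (abs_ge0 hv).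
Qed.

Lemma nf_bound (S : seq (mon V * J)) : uniq S -> exists S', uniq S' /\ forall f,
  \sum_(e <- S) v (nf f e) * ewt w k e <= 2 * \sum_(e <- S') v (f e) * ewt w k e.
Proof.
move=> uS.
have [S' [uS' hS']] := @tri_bound_seq _ _ (@erk_inj V J) _ reducer _ _ hv _ wt_ge0 reducer_tail S uS.
exists S'; split=> // f; apply: le_trans (hS' f); apply: ler_sum => e _.
by rewrite /nf ler_wpM2r //; case: (ix e); rewrite // (abs0 hv) (abs_ge0 hv).
Qed.

Lemma quo_bounded i f C : bounded v (ewt w k) f C ->
  bounded v (mwt w) (quo i f) (2 / ewt w k (gam i) * C).
Proof.
move=> fC S uS; have [S' [uS' hS']] := quo_bound i uS.
apply: le_trans (hS' f) _; rewrite ler_wpM2l //; first by rewrite divr_ge0.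
exact: fC.
Qed.

Section Membership.
Variable p : nat.
Variable P : 'rV[K]_p -> (mon V * J -> K) -> Prop.
Hypothesis P_lin : forall c c' f f' k, P c f -> P c' f' -> P (c + k *: c') (fun e => f e + k * f' e).
Hypothesis P_conv : forall h f, P 0 f -> convergent v (Powser h) -> P 0 (conv h f).
Variable c : T -> 'rV[K]_p.
Hypothesis Pg : forall i, P (c i) (g i).
Hypothesis ix_const : forall e i, ix e = Some i -> e = gam i \/ c i = 0.
Hypothesis ix_none : forall e, ix e = None -> forall c f, P c f -> ~ lead f e.

(** Elements outside the module are only used unshifted. Their quotients are therefore constants, as
    the increments of y must be. *)
Lemma quo_const i f : c i <> 0 -> forall b, b != 0 -> quo i f b = 0.
Proof.
move=> ci b b0; rewrite /quo; case: eqP => // ie; have [e|//] := ix_const ie.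
case/eqP: b0; move: e; case: (gam i) => a j [] /eqP.
by rewrite -{2}[a]add0r => /eqP /addIm.
Qed.

Lemma conv_const (h : mon V -> K) f : (forall b, b != 0 -> h b = 0) -> conv h f =1 (fun e => h 0 * f e).
Proof.
move=> h0 [a j]; rewrite /conv (bigD1_seq 0) ?below_uniq //=; last first.
  by rewrite mem_below; apply/mleP => i; rewrite mon0E.
rewrite big1 ?addr0 => [|b /h0 ->]; last by rewrite mul0r.
by congr (_ * f (_, _)); apply/ffunP => i; rewrite !ffunE subn0.
Qed.

(** The remainder is [f] minus combinations that stay in the space, so it is in the space too. If it
    were nonzero it would have a lead, at an exponent that no basis element reduces, against the
    choice of [ix]. The bound on [f] serves to make the quotients convergent, as [P_conv]
    demands. *)
Lemma nf_eq0 d f C : P d f -> bounded v (ewt w k) f C -> nf f =1 (fun=> 0).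
Proof.
move=> Pf fC.
have P00 : P 0 (fun=> 0).
  have := P_lin (-1) Pf Pf; rewrite scaleN1r subrr.
  by under eq_fun do rewrite mulN1r subrr.
have Pq i : exists c', P c' (conv (quo i f) (g i)).
  have [ci|ci] := pselect (c i = 0).
    exists 0; apply: P_conv; first by rewrite -ci.
    apply/(convergentP hv); exists w; split=> //; eexists; exact: quo_bounded fC.
  exists (0 + quo i f 0 *: c i).
  rewrite (funext (conv_const _ (quo_const f ci))).
  by have := P_lin (quo i f 0) P00 (Pg i); under eq_fun do rewrite add0r.
have [c' Pc'] : exists c', P c' (fun e => \sum_i conv (quo i f) (g i) e).
  elim: (index_enum T) => [|i s [c' IH]].
    by exists 0; under eq_fun do rewrite big_nil.
  have [c'' Pi] := Pq i; exists (c'' + 1 *: c').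
  by have := P_lin 1 Pi IH; congr P; apply/funext => e; rewrite big_cons mul1r.
have Pnf : P (d + (-1) *: c') (nf f).
  have := P_lin (-1) Pf Pc'; congr P; apply/funext => e.
  by rewrite {1}(division f e) mulN1r addrAC subrr add0r.
move=> e; apply: contrapT => ne.
have [e0 le] : exists e0, lead (nf f) e0 by apply: lead_exists; exists e.
case ie: (ix e0) => [i|]; first by case: le => + _; rewrite nf_supp // ie.
exact: ix_none ie _ _ Pnf le.
Qed.

End Membership.
End Bounds.
End Division.

(** * Substitution *)

Section Substitution.
Variables (K : fieldType) (X T : finType).
Implicit Types (g u : T -> powser X K) (ws : seq T) (b : mon T) (F : powser T K).

(** A monomial as the list of its factors with multiplicity, so that products and their linear parts
    can be treated by induction, one factor at a time. *)
Definition mlist b : seq T := flatten [seq nseq (b t) t | t <- enum T].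

Lemma mlist_prod (A : comPzSemiRingType) (h : T -> A) b : \prod_(t <- mlist b) h t = \prod_t h t ^+ b t.
Proof.
rewrite /mlist big_flatten /= big_map big_enum /=; apply: eq_bigr => t _.
by rewrite big_nseq -Monoid.iteropE.
Qed.

Lemma size_mlist b : size (mlist b) = mdeg b.
Proof.
rewrite size_flatten /shape -map_comp sumnE big_map big_enum /=.
by apply: eq_bigr => t _; rewrite size_nseq.
Qed.

(* The coefficient of u t in the part of the product of the g w + u w, w in ws, *)
(* that is linear in u.                                                       *)
Fixpoint lincoef g ws t : powser X K :=
  if ws is w :: ws' then g w * lincoef g ws' t + (if w == t then \prod_(w <- ws') g w else 0)
  else 0.

(** The predecessor allows for derivatives, in which one factor of the monomial is missing; for the
    same reason [psum] goes up to degree [(mdeg a).+1]. *)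
Definition locfin (Phi : mon T -> powser X K) :=
  forall b, ord_ge (@mdeg X) (mdeg b).-1 (Phi b).

Definition psum (Phi : mon T -> powser X K) : powser X K :=
  Powser (fun a => \sum_(b <- mons T (mdeg a).+1) ps_coef (Phi b) a).

Lemma psumE Phi a m : locfin Phi -> (mdeg a < m)%N ->
  ps_coef (psum Phi) a = \sum_(b <- mons T m) ps_coef (Phi b) a.
Proof.
move=> lf am; apply: big_uniq_supp; rewrite ?mons_uniq // => b; rewrite !mem_mons; first by lia.
by rewrite -ltnNge => _ ab; apply: lf; lia.
Qed.

Lemma psumD Phi Psi : psum (fun b => Phi b + Psi b) = psum Phi + psum Psi.
Proof. by apply/powserP => a; rewrite ps_coefD /= -big_split. Qed.

Lemma psumN Phi : psum (fun b => - Phi b) = - psum Phi.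
Proof. by apply/powserP => a; rewrite ps_coefN /= sumrN. Qed.

Lemma psumB Phi Psi : psum (fun b => Phi b - Psi b) = psum Phi - psum Psi.
Proof. by rewrite psumD psumN. Qed.

Lemma psum_sum (I : Type) (r : seq I) (Phi : I -> mon T -> powser X K) :
  psum (fun b => \sum_(i <- r) Phi i b) = \sum_(i <- r) psum (Phi i).
Proof.
apply/powserP => a; rewrite ps_coef_sum /=.
by under eq_bigr do rewrite ps_coef_sum; rewrite exchange_big.
Qed.

Lemma psum_mulr Phi h : locfin Phi -> psum (fun b => Phi b * h) = psum Phi * h.
Proof.
move=> lf; apply/powserP => a; rewrite ps_coefM_below.
transitivity (\sum_(b <- mons T (mdeg a).+1) \sum_(c <- below a) ps_coef (Phi b) c * ps_coef h (msub a c)).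
  by apply: eq_bigr => b _; rewrite ps_coefM_below.
rewrite exchange_big /=.
apply: eq_big_seq => c /mdeg_below ca; rewrite -mulr_suml; congr (_ * _).
by rewrite -psumE.
Qed.

Lemma ord_psum (D : mon X -> nat) k Phi : (forall b, ord_ge D k (Phi b)) -> ord_ge D k (psum Phi).
Proof. by move=> h a ak; rewrite /= big1 // => b _; exact: h. Qed.

Section Order.
Variable g : T -> powser X K.
Hypothesis g0 : forall t, ord_ge (@mdeg X) 1 (g t).

Lemma ord_prod ws : ord_ge (@mdeg X) (size ws) (\prod_(w <- ws) g w).
Proof.
elim: ws => [|w ws IH]; first exact: ord_ge_zero.
by rewrite big_cons -[size _]/(1 + size ws)%N; apply: ord_geM => //; exact: mdegD.
Qed.

Lemma ord_lincoef ws t : ord_ge (@mdeg X) (size ws).-1 (lincoef g ws t).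
Proof.
elim: ws => [|w ws IH] //=; apply: ord_geD.
  case: ws IH => [|w' ws] IH /=; first exact: ord_ge_zero.
  by rewrite -add1n; apply: ord_geM => //; exact: mdegD.
by case: eqP => // _; exact: ord_prod.
Qed.

Lemma locfin_prod F : locfin (fun b => ps_const X (ps_coef F b) * \prod_(w <- mlist b) g w).
Proof.
move=> b; apply: (ord_ge_mull (@mdegD X)); rewrite -size_mlist.
apply: (@ord_ge_le _ _ _ (size (mlist b))); [exact: leq_pred|exact: ord_prod].
Qed.

Lemma locfin_lin F t : locfin (fun b => ps_const X (ps_coef F b) * lincoef g (mlist b) t).
Proof.
by move=> b; apply: (ord_ge_mull (@mdegD X)); rewrite -size_mlist; exact: ord_lincoef.
Qed.

Lemma substE F : ps_subst F g = psum (fun b => ps_const X (ps_coef F b) * \prod_(w <- mlist b) g w).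
Proof.
apply/powserP => a; rewrite (psumE (locfin_prod F) (ltnSn _)).
rewrite -[LHS]/(\sum_(b \in [set: mon T]) ps_coef F b * ps_coef (\prod_(t : T) g t ^+ b t) a).
under [RHS]eq_bigr do rewrite ps_coef_constM mlist_prod.
rewrite -(fsbig_widen [set` mons T (mdeg a).+1]) // => [|b [_ /=]].
  by rewrite -fsbig_seq ?mons_uniq.
move=> /negP; rewrite mem_mons -ltnNge => ab.
by rewrite -mlist_prod ord_prod ?mulr0 // size_mlist ltnW.
Qed.

End Order.

(** The formal partial derivative of [F] with respect to [t], evaluated at [g]. *)
Definition lin F g t : powser X K := psum (fun b => ps_const X (ps_coef F b) * lincoef g (mlist b) t).

Section Linearize.
Variables (D : mon X -> nat).
Hypothesis DD : forall a a', D (a + a') = (D a + D a')%N.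

Lemma prod_diff_ord g g0 ws : (forall t, ord_ge D 1 (g t - g0 t)) ->
  ord_ge D 1 (\prod_(w <- ws) g w - \prod_(w <- ws) g0 w).
Proof.
move=> gg; elim: ws => [|w ws IH]; first by rewrite !big_nil subrr.
rewrite !big_cons.
set P := \prod_(_ <- _) g _ in IH *; set P' := \prod_(_ <- _) g0 _ in IH *.
have -> : g w * P - g0 w * P' = (g w - g0 w) * P + g0 w * (P - P') by ring.
by apply: ord_geD; [apply: ord_ge_mulr|apply: ord_ge_mull].
Qed.

(** The linear part is taken at [g0], not at [g]. The error of this is a difference of order 1 times
    an increment of order [m], no worse than the terms quadratic in [u], since [m] is positive. *)
Lemma prod_lin_ord g g0 u m ws : (0 < m)%N -> (forall t, ord_ge D 1 (g t - g0 t)) ->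
  (forall t, ord_ge D m (u t)) ->
  ord_ge D m.+1 (\prod_(w <- ws) (g w + u w) - \prod_(w <- ws) g w - \sum_t lincoef g0 ws t * u t).
Proof.
move=> m0 gg um; elim: ws => [|w ws IH].
  by rewrite !big_nil subrr sub0r; under eq_bigr do rewrite mul0r; rewrite sumr_const mul0rn oppr0.
rewrite !big_cons /=; have Pd := prod_diff_ord ws gg.
set P := \prod_(_ <- _) g _ in IH Pd *; set P0 := \prod_(_ <- _) g0 _ in Pd *.
set Pu := \prod_(_ <- _) (g _ + u _) in IH *; set B := \sum_t _ in IH.
have -> : \sum_t (g0 w * lincoef g0 ws t + (if w == t then P0 else 0)) * u t = g0 w * B + P0 * u w.
  under eq_bigr do rewrite mulrDl -mulrA.
  rewrite big_split /= -mulr_sumr; congr (_ + _); rewrite (bigD1 w) //= eqxx big1 ?addr0 // => t tw.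
  by rewrite eq_sym (negbTE tw) mul0r.
have Bm : ord_ge D m B by apply: ord_ge_sum => t _; apply: ord_ge_mull.
have -> : (g w + u w) * Pu - g w * P - (g0 w * B + P0 * u w) =
   (g w + u w) * (Pu - P - B) + (g w - g0 w) * B + u w * (P - P0) + u w * B by ring.
apply: ord_geD; [apply: ord_geD; [apply: ord_geD|]|].
- exact: ord_ge_mull.
- by rewrite -add1n; apply: ord_geM.
- by rewrite -addn1; apply: ord_geM.
- by apply: (@ord_ge_le _ _ _ (m + m)); [lia|apply: ord_geM].
Qed.

Lemma subst_lin_ord F g g0 u m : (0 < m)%N ->
  (forall t, ord_ge (@mdeg X) 1 (g t)) -> (forall t, ord_ge (@mdeg X) 1 (g0 t)) ->
  (forall t, ord_ge (@mdeg X) 1 (u t)) ->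
  (forall t, ord_ge D 1 (g t - g0 t)) -> (forall t, ord_ge D m (u t)) ->
  ord_ge D m.+1 (ps_subst F (fun t => g t + u t) - ps_subst F g - \sum_t lin F g0 t * u t).
Proof.
move=> m0 gm g0m umd gg um.
have gum t : ord_ge (@mdeg X) 1 (g t + u t) by apply: ord_geD.
have L t : lin F g0 t * u t =
    psum (fun b => ps_const X (ps_coef F b) * lincoef g0 (mlist b) t * u t).
  by rewrite psum_mulr //; exact: locfin_lin.
rewrite (eq_bigr _ (fun t _ => L t)).
rewrite !substE // -psumB -psum_sum -psumB; apply: ord_psum => b.
rewrite (eq_bigr _ (fun t _ => esym (mulrA _ _ _))).
by rewrite -mulr_sumr -!mulrBr; apply: ord_ge_mull => //; exact: prod_lin_ord.
Qed.

End Linearize.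

Section Norms.
Variables (R : realType) (v : K -> R).
Hypothesis hv : real_valued_field v.
Variable w : X -> R.
Hypothesis w_ge0 : forall i, 0 <= w i.

Lemma nrm_psum F (Phi : mon T -> powser X K) (wt : mon T -> R) C c : 0 <= c ->
  (forall b, nrm v w (Phi b) (c * wt b)) -> bounded v wt (ps_coef F) C ->
  nrm v w (psum (fun b => ps_const X (ps_coef F b) * Phi b)) (c * C).
Proof.
move=> c0 hP FC S uS.
pose N := (\max_(a <- S) mdeg a).+1.
have W0 a := mwt_ge0 a w_ge0.
apply: (@le_trans _ _ (\sum_(b <- mons T N) \sum_(a <- S) v (ps_coef F b) * (v (ps_coef (Phi b) a) * mwt w a))).
  rewrite exchange_big [leLHS]big_seq [leRHS]big_seq; apply: ler_sum => a aS.
  have aN : (mdeg a < N)%N by rewrite ltnS /N; apply: leq_bigmax_seq.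
  apply: le_trans (ler_wpM2r (W0 a) (abs_sum hv _ _ _)) _; rewrite mulr_suml.
  apply: (@le_trans _ _ (\sum_(b <- mons T (mdeg a).+1) v (ps_coef F b) * (v (ps_coef (Phi b) a) * mwt w a))).
    apply: ler_sum => b _; rewrite mulrA -(absM hv) -ps_coef_constM; exact: lexx.
  apply: ler_sum_uniq; rewrite ?mons_uniq //.
  - by move=> b; rewrite !mem_mons => ba; apply: leq_trans aN.
  - by move=> b; rewrite !mulr_ge0 ?(abs_ge0 hv).
apply: le_trans (ler_wpM2l c0 (FC _ (mons_uniq T N))).
rewrite mulr_sumr; apply: ler_sum => b _; rewrite -mulr_sumr mulrCA.
by rewrite ler_wpM2l ?(abs_ge0 hv) //; exact: hP.
Qed.

Variables (r C : R) (F : powser T K).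
Hypothesis r_gt0 : 0 < r.
Hypothesis FC : bounded v (mwt (fun=> 3 * r)) (ps_coef F) C.

Let r_ge0 : 0 <= r. Proof. exact: ltW. Qed.
Let r3_ge0 : 0 <= 3 * r. Proof. by rewrite mulr_ge0. Qed.

Lemma nrm_subst g : (forall t, ord_ge (@mdeg X) 1 (g t)) ->
  (forall t, nrm v w (g t) (3 * r)) -> nrm v w (ps_subst F g) C.
Proof.
move=> gm gr; rewrite substE // -[C]mul1r; apply: nrm_psum FC => // b.
rewrite mul1r mwt_cst -size_mlist; elim: (mlist b) => [|t ws IH].
  by rewrite big_nil expr0; exact: nrm1.
by rewrite big_cons [size _]/= exprS; apply: nrmM.
Qed.

Lemma nrm_prod_r g ws : (forall t, nrm v w (g t) r) -> nrm v w (\prod_(t <- ws) g t) (r ^+ size ws).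
Proof.
move=> gr; elim: ws => [|t ws IH]; first by rewrite big_nil expr0; exact: nrm1.
by rewrite big_cons [size _]/= exprS; apply: nrmM.
Qed.

(** The linear part of a product has as many terms as factors; the gap between the norm r of the
    arguments and the radius 3 * r for [F] absorbs this number. The factor [r^-1] stands for the
    missing argument. *)
Lemma nrm_lincoef g ws t : (forall t, nrm v w (g t) r) ->
  nrm v w (lincoef g ws t) (r^-1 * (3 * r) ^+ size ws).
Proof.
move=> gr; elim: ws => [|s ws IH].
  by apply: bounded_le (bounded0 hv _) => //; rewrite mulr1 invr_ge0 ltW.
rewrite -[lincoef _ _ _]/(g s * lincoef g ws t + (if s == t then \prod_(i <- ws) g i else 0)).
rewrite [size _]/=.
have rr : r ^+ size ws <= (3 * r) ^+ size ws by apply: lerXn2r; rewrite ?nnegrE // ler_peMl // ler1n.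
apply: (@bounded_le _ _ _ _ _ _ (r * (r^-1 * (3 * r) ^+ size ws) + (3 * r) ^+ size ws)).
  rewrite exprS; have : 0 <= (3 * r) ^+ size ws by exact: exprn_ge0.
  by rewrite mulrA mulfV ?gt_eqF // mul1r mulrA (mulrCA _ 3) mulVf ?gt_eqF //; lra.
apply: nrmD => //; first exact: nrmM.
case: eqP => _; first by apply: bounded_le rr _; exact: nrm_prod_r.
by apply: bounded_le (bounded0 hv _) => //; exact: exprn_ge0.
Qed.

Lemma nrm_lin g t : (forall t, nrm v w (g t) r) -> nrm v w (lin F g t) (r^-1 * C).
Proof.
move=> gr; apply: nrm_psum FC; first by rewrite invr_ge0 ltW.
by move=> b; rewrite mwt_cst -size_mlist; exact: nrm_lincoef.
Qed.

(** One more factor multiplies the bound for the remainder by r * (1 + k) and adds k ^ 2 * r times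
    the power of 3 * r from the linear part. As k is at most 1, this is at most 3 * r in all, the
    reason for bounding [F] at radius 3 * r. The linear part must be bounded in the same
    induction. *)
Lemma nrm_prod_rem g u k ws : 0 <= k <= 1 ->
  (forall t, nrm v w (g t) r) -> (forall t, nrm v w (u t) (k * r)) ->
  nrm v w (\sum_t lincoef g ws t * u t) (k * (3 * r) ^+ size ws) /\
  nrm v w (\prod_(t <- ws) (g t + u t) - \prod_(t <- ws) g t - \sum_t lincoef g ws t * u t)
    (k ^+ 2 * (3 * r) ^+ size ws).
Proof.
move=> /andP[k0 k1] gr uk; elim: ws => [|s ws [IHB IHQ]].
  rewrite !big_nil subrr sub0r; under eq_bigr do rewrite mul0r.
  rewrite sumr_const mul0rn oppr0 /=; split; apply: bounded_le (bounded0 hv _) => //.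
    by rewrite mulr1.
  by rewrite mulr1 exprn_ge0.
set P := \prod_(_ <- _) g _ in IHQ; set B := \sum_t _ in IHB IHQ.
set Pu := \prod_(_ <- _) (g _ + u _) in IHQ.
have PP : nrm v w P (r ^+ size ws) by exact: nrm_prod_r.
have BE : \sum_t lincoef g (s :: ws) t * u t = g s * B + u s * P.
  have LE t : lincoef g (s :: ws) t * u t = g s * (lincoef g ws t * u t) + (if s == t then P else 0) * u t.
    by rewrite mulrA -mulrDl.
  rewrite (eq_bigr _ (fun t _ => LE t)) big_split -mulr_sumr; congr (_ + _).
  rewrite (bigD1 s) //= eqxx big1 ?addr0 => [|t ts]; first by rewrite mulrC.
  by rewrite eq_sym (negbTE ts) mul0r.
rewrite BE !big_cons -/P -/Pu [size _]/= exprS.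
set Y := (3 * r) ^+ size ws in IHB IHQ *.
have Y0 : 0 <= Y by exact: exprn_ge0.
have rY : r ^+ size ws <= Y by apply: lerXn2r; rewrite ?nnegrE // ler_peMl // ler1n.
have rY0 : 0 <= r * Y by rewrite mulr_ge0 // ltW.
have PY : nrm v w P Y by exact: bounded_le rY PP.
split.
  apply: (@bounded_le _ _ _ _ _ _ (r * (k * Y) + (k * r) * Y)).
    have : 0 <= k * (r * Y) by rewrite mulr_ge0.
    lra.
  by apply: nrmD => //; apply: nrmM.
have -> : (g s + u s) * Pu - g s * P - (g s * B + u s * P) =
   g s * (Pu - P - B) + u s * (Pu - P - B) + u s * B by ring.
apply: (@bounded_le _ _ _ _ _ _ (r * (k ^+ 2 * Y) + (k * r) * (k ^+ 2 * Y) + (k * r) * (k * Y))).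
  have : 0 <= (1 - k) * (k ^+ 2 * (r * Y)) by apply: mulr_ge0; [lra|apply: mulr_ge0 => //; exact: exprn_ge0].
  lra.
by apply: nrmD => //; [apply: nrmD => //|]; apply: nrmM.
Qed.

Lemma nrm_subst_rem g u k : 0 <= k <= 1 ->
  (forall t, ord_ge (@mdeg X) 1 (g t)) -> (forall t, ord_ge (@mdeg X) 1 (u t)) ->
  (forall t, nrm v w (g t) r) -> (forall t, nrm v w (u t) (k * r)) ->
  nrm v w (ps_subst F (fun t => g t + u t) - ps_subst F g - \sum_t lin F g t * u t) (k ^+ 2 * C).
Proof.
move=> k01 gm um gr uk.
have gum t : ord_ge (@mdeg X) 1 (g t + u t) by apply: ord_geD.
have L t : lin F g t * u t =
    psum (fun b => ps_const X (ps_coef F b) * lincoef g (mlist b) t * u t).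
  by rewrite psum_mulr //; exact: locfin_lin.
rewrite (eq_bigr _ (fun t _ => L t)).
rewrite !substE // -psumB -psum_sum -psumB.
pose Phi b := \prod_(t <- mlist b) (g t + u t) - \prod_(t <- mlist b) g t
   - \sum_t lincoef g (mlist b) t * u t.
have -> : psum (fun b => ps_const X (ps_coef F b) * \prod_(t <- mlist b) (g t + u t)
    - ps_const X (ps_coef F b) * \prod_(t <- mlist b) g t
    - \sum_t ps_const X (ps_coef F b) * lincoef g (mlist b) t * u t) =
    psum (fun b => ps_const X (ps_coef F b) * Phi b).
  congr psum; apply/funext => b; rewrite (eq_bigr _ (fun t _ => esym (mulrA _ _ _))).
  by rewrite -mulr_sumr -!mulrBr.
apply: nrm_psum FC; first by rewrite exprn_ge0 //; case/andP: k01.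
move=> b; rewrite mwt_cst -size_mlist; exact: (nrm_prod_rem _ k01 gr uk).2.
Qed.

End Norms.
End Substitution.

(** * Slices *)

Section Slices.
Variables (K : fieldType) (V W : finType).
Implicit Types (f g : powser (V + W)%type K) (a : mon V) (b : mon W).

Definition ps_coef_left f a : powser W K := Powser (fun b => ps_coef f (mjoin a b)).

Definition ps_liftl (h : powser V K) : powser (V + W)%type K :=
  Powser (fun c => if rmon c == 0 then ps_coef h (lmon c) else 0).

Lemma msubxx (U : finType) (a : mon U) : msub a a = 0.
Proof. by apply/ffunP => i; rewrite !ffunE subnn. Qed.

Lemma mlexx (U : finType) (a : mon U) : mle a a.
Proof. exact/mleP. Qed.

Lemma msub_eq0 (U : finType) (a c : mon U) : mle c a -> (msub a c == 0) = (c == a).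
Proof.
move=> ca; apply/eqP/eqP => [e|->]; last exact: msubxx.
by rewrite -(msubK ca) e addr0.
Qed.

Lemma coef_right_mull f (h : powser V K) b :
  ps_coef_right (f * ps_liftl h) b = ps_coef_right f b * h.
Proof.
apply/powserP => a; rewrite -[LHS]/(ps_coef (f * ps_liftl h) (mjoin a b)) !ps_coefM_below.
transitivity (\sum_(c <- [seq mjoin a' b | a' <- below a])
    ps_coef f c * ps_coef (ps_liftl h) (msub (mjoin a b) c)).
  apply: big_uniq_supp; first exact: below_uniq.
  - rewrite map_inj_uniq ?below_uniq // => a1 a2 e.
    by rewrite -(lmonE a1 b) e lmonE.
  - move=> c; rewrite mem_below mle_join lmonE rmonE => /andP[lc rc] nc.
    rewrite /= rmon_sub rmonE msub_eq0 //; case: eqP => [rb|]; last by rewrite mulr0.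
    case/negP: nc; apply/mapP; exists (lmon c); first by rewrite mem_below.
    by rewrite -rb mjoinK.
  - move=> c /mapP[a']; rewrite mem_below => aa ->.
    by rewrite mem_below mle_join !lmonE !rmonE aa mlexx.
rewrite big_map; apply: eq_bigr => a' _.
by rewrite /= rmon_sub !rmonE msubxx eqxx lmon_sub !lmonE.
Qed.

Lemma coef_left_mulr f (h : powser W K) a :
  ps_coef_left (f * ps_lift V h) a = ps_coef_left f a * h.
Proof.
apply/powserP => b; rewrite -[LHS]/(ps_coef (f * ps_lift V h) (mjoin a b)) !ps_coefM_below.
transitivity (\sum_(c <- [seq mjoin a b' | b' <- below b])
    ps_coef f c * ps_coef (ps_lift V h) (msub (mjoin a b) c)).
  apply: big_uniq_supp; first exact: below_uniq.
  - rewrite map_inj_uniq ?below_uniq // => b1 b2 e.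
    by rewrite -(rmonE a b1) e rmonE.
  - move=> c; rewrite mem_below mle_join lmonE rmonE => /andP[lc rc] nc.
    rewrite /= lmon_sub lmonE msub_eq0 //; case: eqP => [rb|]; last by rewrite mulr0.
    case/negP: nc; apply/mapP; exists (rmon c); first by rewrite mem_below.
    by rewrite -rb mjoinK.
  - move=> c /mapP[b']; rewrite mem_below => bb ->.
    by rewrite mem_below mle_join !lmonE !rmonE bb mlexx.
rewrite big_map; apply: eq_bigr => b' _.
by rewrite /= lmon_sub !lmonE msubxx eqxx rmon_sub !rmonE.
Qed.

Lemma coef_right_inj f g : (forall b, ps_coef_right f b = ps_coef_right g b) -> f = g.
Proof.
move=> fg; apply/powserP => c; rewrite -(mjoinK c).
by have /powserP/(_ (lmon c)) := fg (rmon c).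
Qed.

Lemma coef_left_inj f g : (forall a, ps_coef_left f a = ps_coef_left g a) -> f = g.
Proof.
move=> fg; apply/powserP => c; rewrite -(mjoinK c).
by have /powserP/(_ (rmon c)) := fg (lmon c).
Qed.

Lemma coef_right_sum (I : Type) (r : seq I) (F : I -> powser (V + W)%type K) b :
  ps_coef_right (\sum_(i <- r) F i) b = \sum_(i <- r) ps_coef_right (F i) b.
Proof. by apply/powserP => a; rewrite ps_coef_sum /= ps_coef_sum. Qed.

Lemma coef_right_liftl h b : ps_coef_right (ps_liftl h) b = if b == 0 then h else 0.
Proof.
by apply/powserP => a /=; rewrite rmonE lmonE; case: eqP.
Qed.

Lemma liftlM (h h' : powser V K) : ps_liftl (h * h') = ps_liftl h * ps_liftl h'.
Proof.
apply: coef_right_inj => b; rewrite coef_right_mull !coef_right_liftl.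
by case: eqP; rewrite ?mul0r.
Qed.

Lemma liftl_coef0 f : (forall c, rmon c != 0 -> ps_coef f c = 0) <->
  f = ps_liftl (ps_coef_right f 0).
Proof.
split=> [f0|->]; last by move=> c /= /negbTE ->.
apply/powserP => c /=; case: eqP => [e|/eqP /f0//]; by rewrite -e mjoinK.
Qed.

Definition rdeg (c : mon (V + W)%type) := mdeg (rmon c).

Lemma rdegD c c' : rdeg (c + c') = (rdeg c + rdeg c')%N.
Proof. by rewrite /rdeg rmonD mdegD. Qed.

Variables (R : realType) (v : K -> R).
Hypothesis hv : real_valued_field v.

Definition swt (wV : V -> R) (wW : W -> R) (x : (V + W)%type) : R :=
  match x with inl i => wV i | inr j => wW j end.

Variables (wV : V -> R) (wW : W -> R).
Hypotheses (wV0 : forall i, 0 < wV i) (wW0 : forall j, 0 < wW j).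

Lemma swt_gt0 x : 0 < swt wV wW x. Proof. by case: x. Qed.

Lemma swt_ge0 x : 0 <= swt wV wW x. Proof. exact/ltW/swt_gt0. Qed.

Lemma mwt_swt c : mwt (swt wV wW) c = mwt wV (lmon c) * mwt wW (rmon c).
Proof.
rewrite /mwt big_sumType /=; congr (_ * _); by apply: eq_bigr => i _; rewrite ffunE.
Qed.

Lemma mwt_join a b : mwt (swt wV wW) (mjoin a b) = mwt wV a * mwt wW b.
Proof. by rewrite mwt_swt lmonE rmonE. Qed.

Lemma nrm_coef_right f C b : nrm v (swt wV wW) f C -> nrm v wV (ps_coef_right f b) (C / mwt wW b).
Proof.
move=> fC S uS; rewrite ler_pdivlMr ?mwt_gt0 // mulr_suml.
have uS' : uniq [seq mjoin a b | a <- S].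
  by rewrite map_inj_uniq // => a1 a2 e; rewrite -(lmonE a1 b) e lmonE.
apply: le_trans (fC _ uS'); rewrite big_map; apply: ler_sum => a _.
by rewrite mwt_join mulrA.
Qed.

Lemma nrm_coef_left f C a : nrm v (swt wV wW) f C -> nrm v wW (ps_coef_left f a) (C / mwt wV a).
Proof.
move=> fC S uS; rewrite ler_pdivlMr ?mwt_gt0 // mulr_suml.
have uS' : uniq [seq mjoin a b | b <- S].
  by rewrite map_inj_uniq // => b1 b2 e; rewrite -(rmonE a b1) e rmonE.
apply: le_trans (fC _ uS'); rewrite big_map; apply: ler_sum => b _.
by rewrite mwt_join mulrAC mulrA.
Qed.

Lemma nrm_liftl h C : nrm v wV h C -> nrm v (swt wV wW) (ps_liftl h) C.
Proof.
move=> hC S uS.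
rewrite (bigID (fun c => rmon c == 0)) /= [X in _ + X]big1 ?addr0 => [|c /negbTE ->]; last first.
  by rewrite (abs0 hv) mul0r.
rewrite -big_filter.
have uS' : uniq [seq lmon c | c <- S & rmon c == 0].
  rewrite map_inj_in_uniq ?filter_uniq // => c d; rewrite !mem_filter => /andP[/eqP c0 _] /andP[/eqP d0 _] e.
  by rewrite -(mjoinK c) -(mjoinK d) e c0 d0.
apply: le_trans (hC _ uS'); rewrite big_map big_seq [leRHS]big_seq; apply: ler_sum => c.
by rewrite mem_filter => /andP[/eqP c0 _]; rewrite mwt_swt c0 eqxx mwt0 mulr1.
Qed.

Lemma nrm_lift h C : nrm v wW h C -> nrm v (swt wV wW) (ps_lift V h) C.
Proof.
move=> hC S uS.
rewrite (bigID (fun c => lmon c == 0)) /= [X in _ + X]big1 ?addr0 => [|c /negbTE ->]; last first.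
  by rewrite (abs0 hv) mul0r.
rewrite -big_filter.
have uS' : uniq [seq rmon c | c <- S & lmon c == 0].
  rewrite map_inj_in_uniq ?filter_uniq // => c d; rewrite !mem_filter => /andP[/eqP c0 _] /andP[/eqP d0 _] e.
  by rewrite -(mjoinK c) -(mjoinK d) e c0 d0.
apply: le_trans (hC _ uS'); rewrite big_map big_seq [leRHS]big_seq; apply: ler_sum => c.
by rewrite mem_filter => /andP[/eqP c0 _]; rewrite mwt_swt c0 eqxx mwt0 mul1r.
Qed.

End Slices.

Section SlicedBound.
Variables (K : fieldType) (R : realType) (v : K -> R).
Hypothesis hv : real_valued_field v.
Variables (E E' B : eqType) (wt : E -> R) (wt' : E' -> R) (wb : B -> R).
Hypotheses (wt'0 : forall e, 0 <= wt' e) (wb0 : forall b, 0 <= wb b).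
Variables (Phi : (E -> K) -> E' -> K) (c : R).
Hypothesis c0 : 0 <= c.
Hypothesis Phi_bound : forall S, uniq S -> exists S', uniq S' /\ forall f,
  \sum_(e <- S) v (Phi f e) * wt' e <= c * \sum_(e <- S') v (f e) * wt e.

Lemma sliced_bound (f : E * B -> K) C : bounded v (fun eb => wt eb.1 * wb eb.2) f C ->
  bounded v (fun eb => wt' eb.1 * wb eb.2) (fun eb => Phi (fun e => f (e, eb.2)) eb.1) (c * C).
Proof.
move=> fC S uS.
pose S1 := undup (map fst S); pose S2 := undup (map snd S).
have [S' [uS' hS']] := Phi_bound (undup_uniq (map fst S)).
have usp (A1 A2 : eqType) (s1 : seq A1) (s2 : seq A2) : uniq s1 -> uniq s2 ->
    uniq [seq (x, y) | y <- s2, x <- s1].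
  by move=> u1 u2; apply: allpairs_uniq => // -[x y] [x' y'] _ _ [-> ->].
apply: (@le_trans _ _ (\sum_(eb <- [seq (e, b) | b <- S2, e <- S1])
   v (Phi (fun e => f (e, eb.2)) eb.1) * (wt' eb.1 * wb eb.2))).
  apply: ler_sum_uniq => //; first by apply: usp; exact: undup_uniq.
    move=> [e b] ebS; apply/allpairsP; exists (b, e); split=> //=; rewrite mem_undup.
      by apply/mapP; exists (e, b).
    by apply/mapP; exists (e, b).
  by move=> eb; rewrite !mulr_ge0 // (abs_ge0 hv).
apply: le_trans (ler_wpM2l c0 (fC _ (usp _ _ _ _ uS' (undup_uniq (map snd S))))).
rewrite !big_allpairs_dep mulr_sumr; apply: ler_sum => b _ /=.
under eq_bigr do rewrite mulrA.
rewrite -mulr_suml; under [in leRHS]eq_bigr do rewrite mulrA.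
by rewrite -mulr_suml mulrA ler_wpM2r.
Qed.

End SlicedBound.

(** * Normal forms modulo an ideal *)

Section NormalForm.
Variables (R : realType) (K : fieldType) (v : K -> R).
Hypothesis hv : real_valued_field v.

Lemma convergent_nrm (V : finType) (w : V -> R) (f : powser V K) C :
  (forall i, 0 < w i) -> nrm v w f C -> convergent v f.
Proof. by move=> w0 fC; apply/(convergentP hv); exists w; split=> //; exists C. Qed.

Lemma convergent_mono (V : finType) b : convergent v (ps_mono K b : powser V K).
Proof. by apply: (@convergent_nrm _ (fun=> 1)) => //; apply: nrm_mono. Qed.

Lemma convergent_const (V : finType) c : convergent v (ps_const V c : powser V K).
Proof. by apply: (@convergent_nrm _ (fun=> 1)) => //; apply: nrm_const. Qed.

(** Leads are only known to dominate along the multiples c * w of one polyradius, so convergence has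
    to be tested along such a ray. *)
Lemma convergent_small (V : finType) (w : V -> R) (f : powser V K) : (forall i, 0 < w i) ->
  convergent v f -> exists C, exists2 d, 0 < d &
    forall x, 0 < x <= d -> nrm v (fun i => x * w i) f C.
Proof.
move=> w0 /(convergentP hv)[w' [w'0 [C fC]]]; exists C.
have [d d0 dP] := @pos_lower _ _ (fun i => w' i / w i) (fun i => divr_gt0 (w'0 i) (w0 i)).
exists d => // x xd; have x0 : 0 < x by case/andP: xd.
apply: nrm_le_wt fC => // i; rewrite mulr_ge0 ?(ltW x0) ?(ltW (w0 i)) //=.
by rewrite -ler_pdivlMr // dP.
Qed.

(* Reduction of the series in V + W modulo an ideal of K{W}, slicewise in V. *)
Record normal_form (V W : finType) (I : set (powser W K)) := NormalForm {
  nfo :> powser (V + W)%type K -> powser (V + W)%type K;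
  nf_std : pred (mon W);
  nf_seg : mon W -> seq (mon W);
  nf_mx : mon W -> mon W -> K;
  nf_T : finType;
  nf_gen : nf_T -> powser W K;
  nf_quo : nf_T -> powser (V + W)%type K -> powser (V + W)%type K;
  nf_wt : W -> R;
  nf_right : forall f b, ps_coef_right (nfo f) b =
    \sum_(b' <- nf_seg b) ps_const V (nf_mx b b') * ps_coef_right f b';
  nf_ord : forall f k, ord_ge (@rdeg V W) k f -> ord_ge (@rdeg V W) k (nfo f);
  nf_id : forall f, (forall b, ~~ nf_std b -> ps_coef_right f b = 0) -> nfo f = f;
  nf_std0 : forall f b, ~~ nf_std b -> ps_coef_right (nfo f) b = 0;
  nf_genI : forall i, I (nf_gen i);
  nf_div : forall f, f = \sum_i nf_quo i f * ps_lift V (nf_gen i) + nfo f;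
  nf_wt_gt0 : forall j, 0 < nf_wt j;
  nf_nrm : forall w c f C, (forall i, 0 < w i) -> 0 < c <= 1 ->
    nrm v (swt w (fun j => c * nf_wt j)) f C ->
    nrm v (swt w (fun j => c * nf_wt j)) (nfo f) (2 * C);
  nf_quo_nrm : forall i w c f C, (forall i, 0 < w i) -> 0 < c <= 1 ->
    nrm v (swt w (fun j => c * nf_wt j)) f C ->
    exists D, nrm v (swt w (fun j => c * nf_wt j)) (nf_quo i f) D;
  nf_ideal : forall c g, convergent v c -> I g -> nfo (c * ps_lift V g) = 0
}.

Lemma convergent_slice (V W : finType) (f : powser (V + W)%type K) a :
  convergent v f -> convergent v (ps_coef_left f a).
Proof.
move=> /(convergentP hv)[w [w0 [C fC]]].
have wE : w = swt (fun i => w (inl i)) (fun j => w (inr j)) by apply/funext => -[].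
rewrite wE in fC.
exact: (convergent_nrm (fun j => w0 (inr j)) (nrm_coef_left (fun i => w0 (inl i)) a fC)).
Qed.

Lemma convergent_slice_right (V W : finType) (f : powser (V + W)%type K) b :
  convergent v f -> convergent v (ps_coef_right f b).
Proof.
move=> /(convergentP hv)[w [w0 [C fC]]].
have wE : w = swt (fun i => w (inl i)) (fun j => w (inr j)) by apply/funext => -[].
rewrite wE in fC.
exact: (convergent_nrm (fun i => w0 (inl i)) (nrm_coef_right (fun j => w0 (inr j)) b fC)).
Qed.

Section IdealDivision.
Variables (V W : finType) (I : set (powser W K)).
Hypothesis hI : is_ideal (convergent v (V := W)) I.

Let vec (h : powser W K) (e : mon W * unit) : K := ps_coef h e.1.

(** An ideal is the case of a single component and no extra columns, hence row vectors of length
    0. *)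
Let P (c : 'rV[K]_0) (f : mon W * unit -> K) := exists2 h, I h & f = vec h.

Let P_zero : P 0 (fun=> 0).
Proof. by exists 0; [case: hI|apply/funext]. Qed.

Let P_lin c c' f f' k : P c f -> P c' f' -> P (c + k *: c') (fun e => f e + k * f' e).
Proof.
case: hI => _ _ ID IM [h hh ->] [h' hh' ->]; exists (h + ps_const W k * h').
  by apply: ID => //; apply: IM => //; exact: convergent_const.
by apply/funext => e; rewrite /vec ps_coefD ps_coef_constM.
Qed.

Let P_conv h f : P 0 f -> convergent v (Powser h) -> P 0 (conv h f).
Proof.
case: hI => _ _ _ IM [h' hh' ->] ch; exists (Powser h * h'); first exact: IM.
by apply/funext => -[a []]; rewrite /vec ps_coefM_below.
Qed.

Theorem normal_form_exists : exists nf : normal_form V I, True.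
Proof.
have [T [gam [c [g [ix [gP ixS ixN]]]]]] := standard_basis P_zero P_lin.
have /choice[h hP] : forall i, exists h, I h /\ g i = vec h.
  by move=> i; have [[h hh gh] _ _] := gP i; exists h.
have g_lead i : g i (gam i) = 1 by case: (gP i).
have g_low i e : (erk e < erk (gam i))%N -> g i e = 0 by case: (gP i) => _ _; exact.
have ix_add e i : ix e = Some i -> exists b, e = eadd b (gam i).
  by move=> /ixS[b [-> _]]; exists b.
have gconv i : exists w C, (forall x, 0 < w x) /\ bounded v (fun e => mwt w e.1) (g i) C.
  have [hh gh] := hP i; have /(convergentP hv)[w [w0 [C hC]]] : convergent v (h i).
    by case: hI => + _ _ _; apply.
  exists w, C; split=> // S uS.
  have uS' : uniq (map fst S) by rewrite map_inj_uniq // => -[a []] [b []] /= ->.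
  by apply: le_trans (hC _ uS'); rewrite big_map gh.
have [w [k [w0 k0 tail]]] := dominant_lead hv g_low gconv.
pose gnf := nf gam g ix.
pose gquo := quo gam g ix.
pose NF (f : powser (V + W)%type K) : powser (V + W)%type K :=
  Powser (fun ab => gnf (fun e => ps_coef f (mjoin (lmon ab) e.1)) (rmon ab, tt)).
pose Q i (f : powser (V + W)%type K) : powser (V + W)%type K :=
  Powser (fun ab => gquo i (fun e => ps_coef f (mjoin (lmon ab) e.1)) (rmon ab)).
pose sg (b : mon W) : seq (mon W) := map fst (seg (@erk_inj W unit) (erk (b, tt)).+1).
pose mx (b b' : mon W) := gnf (fun e => (e == (b', tt))%:R) (b, tt).
have cw0 x : 0 < x <= 1 -> forall j, 0 < x * w j.
  by move=> /andP[x0 _] j; rewrite mulr_gt0.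
pose cw x j := x * w j.
pose wE x e := ewt (cw x) k e.
have kE e : k e.2 = k tt by case: e.2.
(* The slices of f, with the weight k tt absorbed in the bound. *)
have slice_in x eps f C : (forall i, 0 < eps i) -> 0 < x <= 1 ->
    nrm v (swt eps (cw x)) f C ->
    bounded v (fun eb : (mon W * unit) * mon V => wE x eb.1 * mwt eps eb.2)
      (fun eb => ps_coef f (mjoin eb.2 eb.1.1)) (C * k tt).
  move=> eps0 x01 fC.
  have ji : injective (fun eb : (mon W * unit) * mon V => mjoin eb.2 eb.1.1).
    move=> [[b []] a] [[b' []] a'] /= e; have := congr1 (@lmon V W) e; have := congr1 (@rmon V W) e.
    by rewrite !lmonE !rmonE => -> ->.
  move=> S uS; have := bounded_reindex ji fC uS; rewrite -(ler_pM2r (k0 tt)).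
  apply: le_trans; rewrite mulr_suml; apply: ler_sum => -[[b []] a] _ /=.
  rewrite mwt_join /wE /ewt /= le_eqVlt; apply/orP; left; apply/eqP; ring.
have ixc e i : ix e = Some i -> e = gam i \/ c i = 0.
  by move=> _; right; exact: thinmx0.
have gnf_bd x : 0 < x <= 1 -> forall S, uniq S -> exists S', uniq S' /\ forall f,
  \sum_(e <- S) v (gnf f e) * wE x e <= 2 * \sum_(e <- S') v (f e) * wE x e.
  move=> x01; apply: (nf_bound ix_add hv (cw0 _ x01) k0) => i; exact: tail.
have quo_bd x i : 0 < x <= 1 -> forall S, uniq S -> exists S', uniq S' /\ forall f,
  \sum_(b <- S) v (gquo i f b) * mwt (cw x) b <=
    2 / wE x (gam i) * \sum_(e <- S') v (f e) * wE x e.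
  move=> x01; apply: (quo_bound ix_add hv (cw0 _ x01) k0) => j; exact: tail.
have nf_ideal (d : powser (V + W)%type K) (u : powser W K) : convergent v d -> I u -> NF (d * ps_lift V u) = 0.
  move=> dc Iu; apply/powserP => ab; rewrite [LHS]/=.
  have -> : (fun e : mon W * unit => ps_coef (d * ps_lift V u) (mjoin (lmon ab) e.1)) =
      vec (ps_coef_left d (lmon ab) * u).
    by apply/funext => e; rewrite /vec -coef_left_mulr.
  have Iu' : I (ps_coef_left d (lmon ab) * u).
    by case: hI => _ _ _; apply => //; exact: convergent_slice.
  (* The reduction itself does not refer to a radius, so each slice may be treated at a small radius
     of its own. *)
  have [C [y y0 yC]] := convergent_small w0 (let: And4 IC _ _ _ := hI in IC _ Iu').
  pose x := Num.min y 1.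
  have x01 : 0 < x <= 1 by rewrite /x lt_min y0 ltr01 ge_min lexx orbT.
  have uC : bounded v (wE x) (vec (ps_coef_left d (lmon ab) * u)) (C * k tt).
    move=> S uS.
    have uS' : uniq (map fst S) by rewrite map_inj_uniq // => -[a []] [b []] /= ->.
    have xy : 0 < x <= y by case/andP: x01 => -> _; rewrite /x ge_min lexx.
    have := yC x xy _ uS'; rewrite -(ler_pM2r (k0 tt)); apply: le_trans.
    rewrite big_map mulr_suml; apply: ler_sum => -[b []] _ /=.
    by rewrite /vec /wE /ewt /= mulrA.
  by apply: (nf_eq0 g_lead g_low ix_add hv (cw0 _ x01) k0 _ P_lin P_conv _ ixc ixN (d := 0) _ uC) => [i|i|];
    [exact: tail|case: (gP i)|exists (ps_coef_left d (lmon ab) * u)].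
unshelve refine (ex_intro _ (@NormalForm V W I NF (fun b => ix (b, tt) == None) sg mx T h Q w
  _ _ _ _ _ _ _ _ _ _) Logic.I).
- move=> f b; apply/powserP => a; rewrite ps_coef_sum [LHS]/= lmonE rmonE.
  rewrite /gnf nf_matrix /sg big_map; apply: eq_bigr => -[b' []] _.
  by rewrite ps_coef_constM mulrC.
- move=> f n fn ab abn /=.
  apply: (@nf_lt _ _ _ _ gam g ix n) => // -[b []] bn /=.
  by apply: fn; rewrite /rdeg rmonE.
- move=> f f0; apply/powserP => ab /=.
  rewrite /gnf (@nf_fixed _ _ _ _ gam g ix) /= ?mjoinK // => -[b []] /eqP bn /=.
  by have /powserP/(_ (lmon ab)) := f0 b bn.
- by move=> f b /eqP bn; apply/powserP => a /=; apply: nf_supp; rewrite rmonE.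
- by move=> i; case: (hP i).
- move=> f; apply: coef_left_inj => a; apply/powserP => b.
  rewrite -[RHS]/(ps_coef (\sum_i Q i f * ps_lift V (h i)) (mjoin a b) + ps_coef (NF f) (mjoin a b)).
  rewrite [X in _ + X]/= lmonE rmonE; set fa := fun e : mon W * unit => ps_coef f (mjoin a e.1).
  transitivity (\sum_i conv (gquo i fa) (g i) (b, tt) + gnf fa (b, tt)).
    exact: (division g_lead g_low ix_add fa (b, tt)).
  congr (_ + _); rewrite ps_coef_sum; apply: eq_bigr => i _.
  rewrite -[RHS]/(ps_coef (ps_coef_left (Q i f * ps_lift V (h i)) a) b) coef_left_mulr ps_coefM_below.
  by apply: eq_bigr => b' _; case: (hP i) => _ -> /=; rewrite lmonE rmonE.
- exact: w0.
- move=> eps x f C eps0 x01 fC.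
  have B := sliced_bound hv (fun e => ltW (ewt_gt0 e (cw0 x x01) k0)) (fun b => ltW (mwt_gt0 b eps0))
    (ler0n R 2) (gnf_bd x x01) (slice_in x eps f C eps0 x01 fC).
  have ji : injective (fun ab : mon (V + W)%type => ((rmon ab, tt), lmon ab)).
    by move=> ab ab' [r l]; rewrite -(mjoinK ab) r l mjoinK.
  move=> S uS; rewrite -(ler_pM2r (k0 tt)) -[leRHS]mulrA.
  apply: le_trans (bounded_reindex ji B uS); rewrite mulr_suml; apply: ler_sum => ab _ /=.
  rewrite mwt_swt /wE /ewt /= le_eqVlt; apply/orP; left; apply/eqP; ring.
- move=> i eps x f C eps0 x01 fC.
  have c0 : 0 <= 2 / wE x (gam i) by rewrite divr_ge0 // ltW // ewt_gt0 //; exact: cw0.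
  have B := sliced_bound hv (fun b => ltW (mwt_gt0 b (cw0 x x01))) (fun a => ltW (mwt_gt0 a eps0))
    c0 (quo_bd x i x01) (slice_in x eps f C eps0 x01 fC).
  have ji : injective (fun ab : mon (V + W)%type => (rmon ab, lmon ab)).
    by move=> ab ab' [r l]; rewrite -(mjoinK ab) r l mjoinK.
  exists (2 / wE x (gam i) * (C * k tt)) => S uS.
  apply: le_trans (bounded_reindex ji B uS); apply: ler_sum => ab _ /=.
  by rewrite mwt_swt mulrC [leRHS]mulrC [mwt eps _ * _]mulrC.
- exact: nf_ideal.
Qed.
End IdealDivision.
End NormalForm.

(** * Bounded sections of linear maps *)

Section ConvergentRing.
Variables (R : realType) (K : fieldType) (v : K -> R).
Hypothesis hv : real_valued_field v.

Lemma convergentD (U : finType) (f g : powser U K) :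
  convergent v f -> convergent v g -> convergent v (f + g).
Proof.
move=> /(convergent_small hv (fun=> ltr01))[C [d d0 fC]] /(convergent_small hv (fun=> ltr01))[D [d' d'0 gD]].
pose x := Num.min d d'; have x0 : 0 < x by rewrite /x lt_min d0.
have x1 (i : U) : 0 < x * 1 by rewrite mulr1.
apply: (convergent_nrm hv x1 (nrmD hv (fun i => ltW (x1 i)) (fC x _) (gD x _))).
  by rewrite x0 /x ge_min lexx.
by rewrite x0 /x ge_min lexx orbT.
Qed.

Lemma convergentM (U : finType) (f g : powser U K) :
  convergent v f -> convergent v g -> convergent v (f * g).
Proof.
move=> /(convergent_small hv (fun=> ltr01))[C [d d0 fC]] /(convergent_small hv (fun=> ltr01))[D [d' d'0 gD]].
pose x := Num.min d d'; have x0 : 0 < x by rewrite /x lt_min d0.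
have x1 (i : U) : 0 < x * 1 by rewrite mulr1.
apply: (convergent_nrm hv x1 (nrmM hv (fun i => ltW (x1 i)) (fC x _) (gD x _))).
  by rewrite x0 /x ge_min lexx.
by rewrite x0 /x ge_min lexx orbT.
Qed.

Lemma convergent0 (U : finType) : convergent v (0 : powser U K).
Proof.
have -> : (0 : powser U K) = ps_const U 0 by apply/powserP => a /=; case: eqP.
exact: (convergent_const hv).
Qed.

Lemma convergent_sum (U : finType) (I : Type) (r : seq I) (f : I -> powser U K) :
  (forall i, convergent v (f i)) -> convergent v (\sum_(i <- r) f i).
Proof.
by move=> fc; elim/big_rec: _ => [|i x _]; [exact: convergent0|exact: convergentD].
Qed.

Lemma convergentN (U : finType) (f : powser U K) : convergent v f -> convergent v (- f).
Proof.
by move=> /(convergentP hv)[w [w0 [C fC]]]; apply: (convergent_nrm hv w0 (nrmN hv (fun i => ltW (w0 i)) fC)).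
Qed.

Lemma convergent_small_family (T U : finType) (w : U -> R) (f : T -> powser U K) :
  (forall i, 0 < w i) -> (forall t, convergent v (f t)) ->
  exists C, exists2 d, 0 < d & forall x, 0 < x <= d -> forall t, nrm v (fun i => x * w i) (f t) C.
Proof.
move=> w0 fc.
have /choice[C Cp] : forall t, exists C, exists2 d, 0 < d &
    forall x, 0 < x <= d -> nrm v (fun i => x * w i) (f t) C.
  by move=> t; exact: (convergent_small hv).
have [d d0 dP] := small_common Cp; exists (\sum_t C t), d => // x xd t.
apply: bounded_le (dP x xd t); rewrite (bigD1 t) //= lerDl; apply: sumr_ge0 => i _.
exact: bounded_ge0 (dP x xd i).
Qed.

Lemma bounded_family (E : eqType) (J : finType) (wt : E -> R) (k : J -> R) (f : J -> E -> K) C :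
  (forall j, 0 <= k j) -> (forall j, bounded v wt (f j) C) ->
  bounded v (fun e : E * J => wt e.1 * k e.2) (fun e => f e.2 e.1) ((\sum_j k j) * C).
Proof.
move=> k0 fC S uS.
rewrite (partition_big (fun e => e.2) xpredT) //= mulr_suml; apply: ler_sum => j _.
have uS' : uniq [seq e.1 | e <- S & e.2 == j].
  rewrite map_inj_in_uniq ?filter_uniq // => -[e j1] [e' j2].
  by rewrite !mem_filter /= => /andP[/eqP -> _] /andP[/eqP -> _] ->.
apply: le_trans (ler_wpM2l (k0 j) (fC j _ uS')).
rewrite big_map big_filter mulr_sumr; apply: ler_sum => -[e j'] /eqP /= ->.
by rewrite le_eqVlt; apply/orP; left; apply/eqP; ring.
Qed.

End ConvergentRing.

Section LinearSection.
Variables (R : realType) (K : fieldType) (v : K -> R).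
Hypothesis hv : real_valued_field v.
Variables (V W J B : finType) (p : nat).
Variables (LA : J -> 'I_p -> powser V K) (LB : J -> B -> powser V K).
Hypothesis LA_conv : forall j i, convergent v (LA j i).
Hypothesis LB_conv : forall j k, convergent v (LB j k).

(** The constants [c] stand for the increments of y at one monomial in s, the series [h] in x for
    those of z. *)
Definition lin_value (c : 'I_p -> K) (h : B -> powser V K) (j : J) : powser V K :=
  \sum_i ps_const V (c i) * LA j i + \sum_k LB j k * h k.

Definition lin_image (r : J -> powser V K) : Prop :=
  exists c h, (forall k, convergent v (h k)) /\ forall j, r j = lin_value c h j.

Definition slices (f : J -> powser (V + W)%type K) b j : powser V K := ps_coef_right (f j) b.

Definition slicewise_const (su : (J -> powser V K) -> K) f : powser W K :=
  Powser (fun b => su (slices f b)).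

Definition slicewise (sz : (J -> powser V K) -> powser V K) f : powser (V + W)%type K :=
  Powser (fun c => ps_coef (sz (slices f (rmon c))) (lmon c)).

(* A right inverse of (c, h) |-> lin_value c h, bounded for all small polyradii in V. *)
Record linear_section := LinearSection {
  ls_u : 'I_p -> (J -> powser V K) -> K;
  ls_z : B -> (J -> powser V K) -> powser V K;
  ls_wt : V -> R;
  ls_wt_gt0 : forall i, 0 < ls_wt i;
  ls_value : forall r, lin_image r ->
    forall j, r j = lin_value (ls_u^~ r) (ls_z^~ r) j;
  ls_u0 : forall i, ls_u i (fun=> 0) = 0;
  ls_z0 : forall k, ls_z k (fun=> 0) = 0;
  ls_nrm : exists2 x0, 0 < x0 & forall x, 0 < x <= x0 -> exists2 D, 0 <= D &
    forall w f C, 0 <= C -> (forall j, 0 < w j) ->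
      (forall j, nrm v (swt (fun i => x * ls_wt i) w) (f j) C) ->
      (forall i, nrm v w (slicewise_const (ls_u i) f) (D * C)) /\
      (forall k, nrm v (swt (fun i => x * ls_wt i) w) (slicewise (ls_z k) f) (D * C))
}.

Let vec (r : J -> powser V K) (e : mon V * J) : K := ps_coef (r e.2) e.1.

Let P (c : 'rV[K]_p) (f : mon V * J -> K) :=
  exists2 h, (forall k, convergent v (h k)) & f = vec (lin_value (c 0) h).

Lemma lin_value_conv c h j : (forall k, convergent v (h k)) -> convergent v (lin_value c h j).
Proof.
move=> hc; apply: (convergentD hv); apply: (convergent_sum hv) => i; apply: (convergentM hv) => //.
exact: (convergent_const hv).
Qed.

Let P_zero : P 0 (fun=> 0).
Proof.
exists (fun=> 0); first by move=> k; exact: (convergent0 hv).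
apply/funext => e; rewrite /vec /lin_value [X in _ + X]big1 ?addr0 => [|k _]; last by rewrite mulr0.
by rewrite ps_coef_sum big1 // => i _; rewrite ps_coef_constM mxE mul0r.
Qed.

Let P_lin c c' f f' k : P c f -> P c' f' -> P (c + k *: c') (fun e => f e + k * f' e).
Proof.
move=> [h hc ->] [h' hc' ->]; exists (fun i => h i + ps_const V k * h' i).
  by move=> i; apply: (convergentD hv) => //; apply: (convergentM hv) => //; exact: (convergent_const hv).
apply/funext => e; rewrite /vec -ps_coef_constM -ps_coefD; congr (ps_coef _ _).
rewrite /lin_value mulrDr addrACA; congr (_ + _); rewrite mulr_sumr -big_split; apply: eq_bigr => i _ /=.
  rewrite !mxE mulrA -ps_constM -mulrDl; congr (_ * _).
  by apply/powserP => a /=; case: eqP; rewrite ?addr0.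
by rewrite mulrDr mulrCA.
Qed.

Let P_conv h f : P 0 f -> convergent v (Powser h) -> P 0 (conv h f).
Proof.
move=> [g gc ->] hc; exists (fun k => Powser h * g k).
  by move=> k; exact: (convergentM hv).
apply/funext => -[a j].
rewrite -[LHS]/(\sum_(b <- below a) ps_coef (Powser h) b * ps_coef (lin_value ((0 : 'rV_p) 0) g j) (msub a b)).
rewrite -ps_coefM_below; congr (ps_coef _ _); rewrite /lin_value mulrDr !mulr_sumr; congr (_ + _).
  apply: eq_bigr => i _; rewrite mxE.
  have -> : ps_const V (0 : K) = 0 by apply/powserP => a' /=; case: eqP.
  by rewrite !mul0r mulr0.
by apply: eq_bigr => k _; rewrite mulrCA.
Qed.

(** Every basis element comes with a preimage [(c t, h t)]. The section divides by the basis, with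
    remainder 0 on the image, and combines these preimages with the quotients as coefficients;
    boundedness is that of the quotients. *)
Theorem linear_section_exists : exists ls : linear_section, True.
Proof.
have [T [gam [c [g [ix [gP ixS ixN]]]]]] := standard_basis P_zero P_lin.
have /choice[h hP] : forall t, exists h, (forall k, convergent v (h k)) /\ g t = vec (lin_value (c t 0) h).
  by move=> t; have [[h hc gh] _ _] := gP t; exists h.
have g_lead t : g t (gam t) = 1 by case: (gP t).
have g_low t e : (erk e < erk (gam t))%N -> g t e = 0 by case: (gP t) => _ _; exact.
have ix_add e t : ix e = Some t -> exists b, e = eadd b (gam t).
  by move=> /ixS[b [-> _]]; exists b.
have ixc e t : ix e = Some t -> e = gam t \/ c t = 0.
  by move=> /ixS[b [-> [->|]]]; [left; rewrite eadd0|right].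
have gconv t : exists w C, (forall x, 0 < w x) /\ bounded v (fun e => mwt w e.1) (g t) C.
  have [hc gt] := hP t.
  have [C [d d0 dC]] := convergent_small_family hv (fun=> ltr01)
    (fun j => lin_value_conv (c t 0) j hc).
  have dd : 0 < d <= d by rewrite d0 lexx.
  exists (fun=> d * 1), ((\sum_(j : J) 1) * C); split; first by rewrite mulr1.
  have := bounded_family (fun=> ler01) (dC d dd); rewrite gt.
  by apply: (bounded_le_wt hv) => e; rewrite [leRHS]mulr1.
have [w [k [w0 k0 tail]]] := dominant_lead hv g_low gconv.
have [h_bd [y y0 hy]] := convergent_small_family hv w0 (fun tk : T * B => (hP tk.1).1 tk.2).
pose gquo := quo gam g ix.
pose su i (r : J -> powser V K) := \sum_t gquo t (vec r) 0 * c t 0 i.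
pose sz m (r : J -> powser V K) := \sum_t Powser (gquo t (vec r)) * h t m.
have cw0 x : 0 < x -> forall i, 0 < x * w i by move=> x0 i; rewrite mulr_gt0.
have quo0 t r : (forall j, r j = 0) -> forall b, gquo t (vec r) b = 0.
  move=> r0 b; rewrite /gquo /quo; case: eqP => // _; rewrite /coefs.
  have -> : vec r = fun=> 0 by apply/funext => e; rewrite /vec r0.
  exact: tri0.
unshelve refine (ex_intro _ (@LinearSection su sz w w0 _ _ _ _) Logic.I).
- move=> r [c0 [h0 [h0c r0]]] j.
  have rc j' : convergent v (r j') by rewrite r0; exact: lin_value_conv.
  have [C [d d0 dC]] := convergent_small_family hv w0 rc.
  pose x := Num.min d 1.
  have x01 : 0 < x <= 1 by rewrite /x lt_min d0 ltr01 ge_min lexx orbT.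
  have x0 : 0 < x by case/andP: x01.
  have xd : 0 < x <= d by rewrite x0 /x ge_min lexx.
  have rb := bounded_family (fun j => ltW (k0 j)) (dC x xd).
  have Pr : P (\row_i c0 i) (vec r).
    exists h0 => //; apply/funext => e; rewrite /vec r0; congr (ps_coef _ _); rewrite /lin_value; congr (_ + _).
    by apply: eq_bigr => i _; rewrite mxE.
  have nf0 := nf_eq0 g_lead g_low ix_add hv (cw0 _ x0) k0 (fun t => tail x t x01) P_lin P_conv
    (fun t => let: And3 Pg _ _ := gP t in Pg) ixc ixN Pr rb.
  have rE : r j = \sum_t Powser (gquo t (vec r)) * lin_value (c t 0) (h t) j.
    apply/powserP => a; rewrite -[LHS]/(vec r (a, j)).
    rewrite (division g_lead g_low ix_add (vec r) (a, j)) nf0 addr0 ps_coef_sum.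
    apply: eq_bigr => t _; rewrite ps_coefM_below; have [_ ->] := hP t.
    by apply: eq_bigr.
  (* If [c t] is nonzero, the quotient is constant and nothing is lost by keeping its coefficient at
     0; otherwise both sides vanish. *)
  have qc t i : Powser (gquo t (vec r)) * ps_const V (c t 0 i) = ps_const V (gquo t (vec r) 0 * c t 0 i).
    apply/powserP => a; rewrite mulrC ps_coef_constM /=.
    have [ct|ct] := pselect (c t = 0); first by rewrite ct mxE mul0r mulr0; case: eqP.
    case: eqP => [->|/eqP a0]; first by rewrite mulrC.
    by rewrite /gquo (quo_const g ixc _ ct a0) mulr0.
  rewrite {1}rE /lin_value; under eq_bigr do rewrite mulrDr.
  rewrite big_split /=; congr (_ + _).
    under eq_bigr do rewrite mulr_sumr.
    rewrite exchange_big /=; apply: eq_bigr => i _.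
    have -> : ps_const V (su i r) = \sum_t ps_const V (gquo t (vec r) 0 * c t 0 i).
      apply/powserP => a; rewrite ps_coef_sum /=; case: eqP => // _; by rewrite big1.
    by rewrite mulr_suml; apply: eq_bigr => t _; rewrite mulrA qc.
  under eq_bigr do rewrite mulr_sumr.
  rewrite exchange_big /=; apply: eq_bigr => m _; rewrite /sz mulr_sumr; apply: eq_bigr => t _.
  by rewrite mulrCA.
- by move=> i; rewrite /su big1 // => t _; rewrite quo0 ?mul0r.
- move=> m; rewrite /sz big1 // => t _.
  have -> : Powser (gquo t (vec (fun=> 0))) = 0 by apply/powserP => b /=; rewrite quo0.
  by rewrite mul0r.
pose x0 := Num.min y 1.
exists x0; first by rewrite lt_min y0 ltr01.
move=> x /andP[xp xx0].
have x01 : 0 < x <= 1 by rewrite xp (le_trans xx0) // ge_min lexx orbT.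
have xy : 0 < x <= y by rewrite xp (le_trans xx0) // ge_min lexx.
pose cw i := x * w i.
pose wE := ewt cw k.
have wE0 e : 0 < wE e by apply: ewt_gt0 => //; exact: cw0.
pose kap := \sum_j k j.
have kap0 : 0 <= kap by apply: sumr_ge0 => j _; exact: ltW.
pose D t := 2 / wE (gam t) * kap.
have D0 t : 0 <= D t by rewrite mulr_ge0 // divr_ge0 // ltW.
pose D1 := \sum_t D t * \sum_i v (c t 0 i).
pose D2 := \sum_t D t * h_bd.
have hb0 (tm : T * B) : 0 <= h_bd by exact: bounded_ge0 (hy x xy tm).
have D10 : 0 <= D1.
  by apply: sumr_ge0 => t _; apply: mulr_ge0 => //; apply: sumr_ge0 => i _; exact: (abs_ge0 hv).
(* If [T * B] is empty, nothing gives the sign of [h_bd]; the maximum keeps the constant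
   nonnegative. *)
exists (D1 + Num.max 0 D2); first by rewrite addr_ge0 // le_max lexx.
move=> ws f C C0 ws0 fC.
pose A t : powser (V + W)%type K := Powser (fun ab => gquo t (vec (slices f (rmon ab))) (lmon ab)).
have At t : nrm v (swt cw ws) (A t) (D t * C).
  have jj : injective (fun eb : (mon V * J) * mon W => (mjoin eb.1.1 eb.2, eb.1.2)).
    move=> [[a j] b] [[a' j'] b'] /= [e ->]; have := congr1 (@lmon V W) e; have := congr1 (@rmon V W) e.
    by rewrite !lmonE !rmonE => -> ->.
  have := bounded_reindex jj (bounded_family (fun j => ltW (k0 j)) fC).
  have -> : (fun e : mon (V + W)%type * J => mwt (swt (fun i => x * w i) ws) e.1 * k e.2) \o
      (fun eb : (mon V * J) * mon W => (mjoin eb.1.1 eb.2, eb.1.2)) =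
      (fun eb : (mon V * J) * mon W => wE eb.1 * mwt ws eb.2).
    by apply/funext => -[[a j] b] /=; rewrite mwt_join /wE /ewt /=; ring.
  have qb : forall S, uniq S -> exists S', uniq S' /\ forall f,
      \sum_(b <- S) v (gquo t f b) * mwt cw b <= 2 / wE (gam t) * \sum_(e <- S') v (f e) * wE e.
    by move=> S uS; apply: (quo_bound ix_add hv (cw0 _ xp) k0) => // t'; exact: tail.
  have c2 : 0 <= 2 / wE (gam t) by rewrite divr_ge0 // ltW.
  move=> /(sliced_bound hv (fun a => ltW (mwt_gt0 a (cw0 x xp))) (fun b => ltW (mwt_gt0 b ws0)) c2 qb) Bd.
  have ji : injective (fun ab : mon (V + W)%type => (lmon ab, rmon ab)).
    by move=> ab ab' [l r]; rewrite -(mjoinK ab) l r mjoinK.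
  move=> S uS; have := bounded_reindex ji Bd uS; rewrite -/kap [X in _ <= X -> _]mulrA.
  by apply: le_trans; apply: ler_sum => ab _ /=; rewrite mwt_swt.
split=> i.
  have -> : slicewise_const (su i) f = \sum_t ps_const W (c t 0 i) * ps_coef_left (A t) 0.
    apply/powserP => b; rewrite ps_coef_sum; apply: eq_bigr => t _.
    by rewrite ps_coef_constM mulrC /= rmonE lmonE.
  apply: (@bounded_le _ _ _ _ _ _ (\sum_t v (c t 0 i) * (D t * C / mwt cw 0))).
    rewrite mulrDl -[leLHS]addr0 lerD // ?mulr_ge0 ?le_max ?lexx // mulr_suml; apply: ler_sum => t _.
    rewrite mwt0 divr1 mulrA [v _ * _]mulrC ler_wpM2r // ler_wpM2l // (bigD1 i) //= lerDl.
    by apply: sumr_ge0 => i' _; exact: (abs_ge0 hv).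
  apply: (nrm_sum hv) => [j|t _]; first exact: ltW.
  by apply: (nrm_constM hv); apply: nrm_coef_left (At t); exact: cw0.
have -> : slicewise (sz i) f = \sum_t A t * ps_liftl W (h t i).
  apply: coef_right_inj => b; rewrite coef_right_sum.
  have -> : ps_coef_right (slicewise (sz i) f) b = sz i (slices f b).
    apply/powserP => a.
    by rewrite -[LHS]/(ps_coef (sz i (slices f (rmon (mjoin a b)))) (lmon (mjoin a b))) lmonE rmonE.
  rewrite /sz; apply: eq_bigr => t _; rewrite coef_right_mull.
  suff -> : ps_coef_right (A t) b = Powser (gquo t (vec (slices f b))) by [].
  apply/powserP => a.
  by rewrite -[LHS]/(gquo t (vec (slices f (rmon (mjoin a b)))) (lmon (mjoin a b))) lmonE rmonE.
apply: (@bounded_le _ _ _ _ _ _ (\sum_t (D t * C) * h_bd)).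
  rewrite mulrDl -[leLHS]add0r lerD ?mulr_ge0 //.
  apply: (@le_trans _ _ (D2 * C)); last by rewrite ler_wpM2r // le_max lexx orbT.
  by rewrite mulr_suml; apply: ler_sum => t _; rewrite mulrAC.
have sw0 u : 0 <= swt cw ws u by apply: swt_ge0 => // u'; exact: cw0.
apply: (nrm_sum hv) => [//|t _]; apply: (nrmM hv) => //.
apply: (nrm_liftl hv); exact: (hy x xy (t, i)).
Qed.

End LinearSection.

(** * Membership in the extended ideals *)

Section GeneratedIdeals.
Variables (A : comNzRingType) (C S : set A).

Lemma gen_ideal_sum (T : finType) (c g : T -> A) : (forall t, C (c t)) -> (forall t, S (g t)) ->
  gen_ideal C S (\sum_t c t * g t).
Proof.
move=> Cc Sg; exists #|T|, (c \o enum_val), (g \o enum_val); split=> [i|i|]; [exact: Cc|exact: Sg|].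
rewrite (reindex (fun i : 'I_#|T| => enum_val i)) //=.
by exists enum_rank => t _; [exact: enum_valK|exact: enum_rankK].
Qed.

Lemma gen_ideal_seq (T : eqType) (r : seq T) (c g : T -> A) :
  (forall t, t \in r -> C (c t)) -> (forall t, t \in r -> S (g t)) ->
  gen_ideal C S (\sum_(t <- r) c t * g t).
Proof.
move=> Cc Sg; rewrite big_tnth; apply: gen_ideal_sum => i; [apply: Cc|apply: Sg]; exact: mem_tnth.
Qed.

Lemma gen_idealD f g : gen_ideal C S f -> gen_ideal C S g -> gen_ideal C S (f + g).
Proof.
move=> [k [c [u [Cc Su ->]]]] [k' [c' [u' [Cc' Su' ->]]]].
pose cc x := match x with inl i => c i | inr j => c' j end.
pose uu x := match x with inl i => u i | inr j => u' j end.
have := @gen_ideal_sum ('I_k + 'I_k')%type cc uu; rewrite big_sumType /=.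
by apply=> -[].
Qed.

End GeneratedIdeals.

Lemma gen_idealS (A : comNzRingType) (C S S' : set A) f : S `<=` S' -> gen_ideal C S f -> gen_ideal C S' f.
Proof. by move=> SS [k [c [u [Cc Su ->]]]]; exists k, c, u; split=> // i; exact/SS/Su. Qed.

Section Membership.
Variables (R : realType) (K : fieldType) (v : K -> R).
Hypothesis hv : real_valued_field v.

(** Each exponent in the support is assigned, by [beta], to one of its divisors in [S]. The pieces
    have disjoint supports and coefficients taken from [f], so they converge where [f] does. *)
Lemma monomial_split (X : finType) (S : seq (mon X)) (f : powser X K) : uniq S ->
  (forall c, ps_coef f c <> 0 -> exists2 b, b \in S & mle b c) -> convergent v f ->
  exists h : mon X -> powser X K, (forall b, convergent v (h b)) /\ f = \sum_(b <- S) h b * ps_mono K b.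
Proof.
move=> uS fS /(convergentP hv)[w [w0 [C fC]]].
have /choice[beta betaP] : forall c, exists b, ps_coef f c <> 0 -> b \in S /\ mle b c.
  move=> c; have [/fS[b bS bc]|fc] := pselect (ps_coef f c <> 0); first by exists b.
  by exists c => /fc.
exists (fun b => Powser (fun c => if beta (b + c) == b then ps_coef f (b + c) else 0)); split=> [b|].
  apply: (convergent_nrm hv w0 (C := C / mwt w b)) => s us; rewrite ler_pdivlMr ?mwt_gt0 //.
  have us' : uniq [seq b + c | c <- s] by rewrite map_inj_uniq //; exact: monDI.
  apply: le_trans (fC _ us'); rewrite big_map mulr_suml; apply: ler_sum => c _ /=.
  rewrite mwtD -mulrA [mwt w b * _]mulrC; apply: ler_wpM2r.
    by rewrite mulr_ge0 // ltW // mwt_gt0.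
  by case: eqP; rewrite // (abs0 hv) (abs_ge0 hv).
apply/powserP => c; rewrite ps_coef_sum.
transitivity (\sum_(b <- S) if (b == beta c) && mle b c then ps_coef f c else 0); last first.
  apply: eq_bigr => b _; rewrite mulrC ps_coef_monoM /= andbC; case: (boolP (mle b c)) => //= bc.
  by rewrite msubK // eq_sym.
have [f0|fc] := eqVneq (ps_coef f c) 0.
  by rewrite big1 // => b _; rewrite f0 if_same.
have [bS bc] := betaP c (elimN eqP fc).
rewrite (bigD1_seq (beta c)) //= eqxx bc big1 ?addr0 // => b nb.
by rewrite (negbTE nb).
Qed.

Lemma mono_prod_vars (W : finType) (b : mon W) :
  exists ts : seq W, size ts = mdeg b /\ ps_mono K b = \prod_(t <- ts) ps_var K t.
Proof.
elim: {b}(mdeg b) {-2}b (erefl (mdeg b)) => [|k IH] b bk.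
  by exists [::]; split=> //; rewrite big_nil (mdeg_eq0 bk).
have [i bi] : exists i, (0 < b i)%N.
  apply: contrapT => nb; suff b0 : mdeg b = 0%N by rewrite b0 in bk.
  by rewrite /mdeg big1 // => i _; apply/eqP; rewrite -leqn0 leqNgt; apply/negP => bi; apply: nb; exists i.
have ib : mle (mdelta i) b.
  by apply/mleP => j; rewrite ffunE; case: eqP => // ->.
have bE := msubK ib.
have [|ts [sz tE]] := IH (msub b (mdelta i)).
  by move: bk; rewrite -{1}bE mdegD mdeg_delta => -[].
exists (i :: ts); split; first by rewrite /= sz -[in RHS]bE mdegD mdeg_delta.
by rewrite big_cons -tE -{1}bE ps_monoD.
Qed.

Section MaxIdeal.
Variables n l : nat.
Notation xs := ('I_n + 'I_l)%type.

Lemma max_pow_mono k (b : mon 'I_l) : mdeg b = k -> max_pow v k (ps_mono K b).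
Proof.
have [ts [sz tE]] := mono_prod_vars b; rewrite -sz => <-.
have one : convergent v (1 : powser 'I_l K) by exact: (convergent_const hv).
have := @gen_ideal_sum _ (convergent v (V := 'I_l)) [set f | exists g : 'I_(size ts) -> powser 'I_l K,
   (forall i, max_ideal v (g i)) /\ f = \prod_(i < size ts) g i] unit (fun=> 1) (fun=> ps_mono K b).
rewrite (big_pred1 tt) ?mul1r; last by case.
apply => // _; exists (fun i => ps_var K (tnth (in_tuple ts) i)); split; last by rewrite tE big_tnth.
move=> i; have := @gen_ideal_sum _ (convergent v (V := 'I_l)) [set f | exists j, f = ps_var K j]
   unit (fun=> 1) (fun=> ps_var K (tnth (in_tuple ts) i)).
rewrite (big_pred1 tt) ?mul1r; last by case.
by apply => // _; eexists.
Qed.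

Lemma max_pow_ord k (f : powser 'I_l K) : max_pow v k f -> ord_ge (@mdeg 'I_l) k f.
Proof.
have DD := @mdegD 'I_l.
have mi g : max_ideal v g -> ord_ge (@mdeg 'I_l) 1 g.
  move=> [m [c [u [_ uv ->]]]]; apply: ord_ge_sum => i _; apply: (ord_ge_mull DD).
  have [j ->] := uv i; move=> a; rewrite ltnS leqn0 => /eqP /mdeg_eq0 -> /=.
  by case: eqP => // /ffunP /(_ j); rewrite !ffunE eqxx.
move=> [m [c [u [_ uv ->]]]]; apply: ord_ge_sum => i _; apply: (ord_ge_mull DD).
have [g [gm ->]] := uv i; elim: k g gm {uv} => [|k IH] g gm; first exact: ord_ge_zero.
rewrite big_ord_recl.
apply: (@ord_geM _ _ _ DD 1 k); first exact/mi/gm.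
by apply: IH => j; exact: gm.
Qed.

Lemma ord_max_pow k (f : powser 'I_l K) : convergent v f -> ord_ge (@mdeg 'I_l) k f -> max_pow v k f.
Proof.
move=> fc fk; pose S := [seq b <- mons 'I_l k | mdeg b == k].
have [||h [hc ->]] := @monomial_split _ S f _ _ fc; first by rewrite filter_uniq // mons_uniq.
  move=> c fc0; have [|b bc bk] := @mons_split _ k c.
    by rewrite leqNgt; apply/negP => ck; apply: fc0; exact: fk.
  by exists b => //; rewrite mem_filter bk eqxx mem_mons bk leqnn.
pose J := [set f : powser 'I_l K | exists g : 'I_k -> powser 'I_l K,
   (forall i, max_ideal v (g i)) /\ f = \prod_(i < k) g i].
have JD := @gen_idealD _ (convergent v (V := 'I_l)) J.
have JM c g : convergent v c -> gen_ideal (convergent v (V := 'I_l)) J g -> gen_ideal (convergent v (V := 'I_l)) J (c * g).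
  move=> cc [m [d [u [dc uJ ->]]]]; rewrite mulr_sumr; under eq_bigr do rewrite mulrA.
  by apply: gen_ideal_sum => // t; apply: (convergentM hv).
rewrite big_seq; apply: (big_ind (max_pow v k)) => [||b].
- by have := @gen_ideal_seq _ (convergent v (V := 'I_l)) J unit [::] (fun=> 0) (fun=> 0); rewrite big_nil; apply.
- exact: JD.
rewrite mem_filter => /andP[/eqP bk _]; apply: JM => //; exact: max_pow_mono.
Qed.

Lemma lift_mono (b : mon 'I_l) : ps_lift 'I_n (ps_mono K b) = ps_mono K (mjoin 0 b).
Proof.
apply/powserP => c /=; have -> : (c == mjoin 0 b) = (lmon c == 0) && (rmon c == b).
  apply/eqP/andP => [->|[/eqP lc /eqP rc]]; first by rewrite lmonE rmonE !eqxx.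
  by rewrite -(mjoinK c) lc rc.
by case: (lmon c == 0).
Qed.

Lemma ord_extended k (f : powser xs K) : convergent v f -> ord_ge (@rdeg 'I_n 'I_l) k f ->
  Defs.extended v (max_pow v (l := l) k) f.
Proof.
move=> fc fk; pose S := [seq mjoin (0 : mon 'I_n) b | b <- [seq b <- mons 'I_l k | mdeg b == k]].
have [||h [hc ->]] := @monomial_split _ S f _ _ fc.
- rewrite map_inj_uniq; first exact/filter_uniq/mons_uniq.
  by move=> b b' e; rewrite -(rmonE (0 : mon 'I_n) b) e rmonE.
- move=> c fc0; have [|b bc bk] := @mons_split _ k (rmon c).
    by rewrite leqNgt; apply/negP => ck; apply: fc0; exact: fk.
  exists (mjoin 0 b); first by apply: map_f; rewrite mem_filter bk eqxx mem_mons bk leqnn.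
  by rewrite mle_join lmonE rmonE bc andbT; apply/mleP => i; rewrite mon0E.
apply: gen_ideal_seq => // c /mapP[b]; rewrite mem_filter => /andP[/eqP bk _] ->.
by exists (ps_mono K b); [exact: max_pow_mono|exact: lift_mono].
Qed.

Section Reduction.
Variable I : set (powser 'I_l K).
Hypothesis hI : is_ideal (convergent v (V := 'I_l)) I.
Variable NF : normal_form v 'I_n I.

Lemma nfoD f g : NF (f + g) = NF f + NF g.
Proof.
apply: coef_right_inj => b.
have aD (f' g' : powser xs K) : ps_coef_right (f' + g') b = ps_coef_right f' b + ps_coef_right g' b.
  exact/powserP.
rewrite aD !nf_right -big_split; apply: eq_bigr => b' _ /=.
have -> : ps_coef_right (f + g) b' = ps_coef_right f b' + ps_coef_right g b' by exact/powserP.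
by rewrite mulrDr.
Qed.

Lemma nfo0 : NF 0 = 0.
Proof. by have := nfoD 0 0; rewrite addr0 => /eqP; rewrite -subr_eq subrr => /eqP. Qed.

Lemma nfoN f : NF (- f) = - NF f.
Proof. by apply/eqP; rewrite -addr_eq0 -nfoD addNr nfo0. Qed.

Lemma nfoB f g : NF (f - g) = NF f - NF g.
Proof. by rewrite nfoD nfoN. Qed.

Lemma nfo_sum (T : Type) (r : seq T) (f : T -> powser xs K) :
  NF (\sum_(t <- r) f t) = \sum_(t <- r) NF (f t).
Proof. by elim/big_rec2: _ => [|t x y _ <-]; [exact: nfo0|exact: nfoD]. Qed.

Lemma nfo_mull (h : powser 'I_n K) f : NF (f * ps_liftl 'I_l h) = NF f * ps_liftl 'I_l h.
Proof.
apply: coef_right_inj => b; rewrite coef_right_mull !nf_right mulr_suml.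
by apply: eq_bigr => b' _; rewrite coef_right_mull mulrA.
Qed.

(** The normal form kills I and does not lower the order in s. Together with the converse
    [nfo_ord_extended], this turns congruences modulo I + m ^ k into order conditions on normal
    forms, the form in which solutions are handled below. *)
Lemma nfo_extended k f : Defs.extended v (ideal_add I (max_pow v k)) f -> ord_ge (@rdeg 'I_n 'I_l) k (NF f).
Proof.
move=> [m [c [g [cc gS ->]]]]; rewrite nfo_sum; apply: ord_ge_sum => i _.
have [_ [u [h [Iu mh ->]]] <-] := gS i.
have -> : ps_lift 'I_n (u + h) = ps_lift 'I_n u + ps_lift 'I_n h.
  by apply/powserP => a /=; case: eqP; rewrite ?addr0.
rewrite mulrDr nfoD nf_ideal // add0r; apply: nf_ord; apply: (ord_ge_mull (@rdegD _ _)).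
by move=> a ak /=; case: eqP => // _; exact: (max_pow_ord mh).
Qed.

Lemma nfo_small (f : powser xs K) : convergent v f -> exists w x C, [/\ forall i, 0 < w i, 0 < x <= 1 &
  nrm v (swt w (fun j => x * nf_wt NF j)) f C].
Proof.
move=> fc.
have w0 (t : xs) : 0 < swt (fun=> 1 : R) (nf_wt NF) t by case: t => //= j; exact: nf_wt_gt0.
have [C [d d0 dC]] := convergent_small hv w0 fc.
pose x := Num.min d 1.
have x01 : 0 < x <= 1 by rewrite /x lt_min d0 ltr01 ge_min lexx orbT.
have x0 : 0 < x by case/andP: x01.
have xd : 0 < x <= d by rewrite x0 /x ge_min lexx.
exists (fun=> x * 1), x, C; split=> //; first by move=> i; rewrite mulr1.
have := dC x xd; suff -> : (fun i : xs => x * swt (fun=> 1) (nf_wt NF) i) =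
  swt (fun=> x * 1) (fun j => x * nf_wt NF j) by [].
by apply/funext => -[].
Qed.

Lemma nfo_conv (f : powser xs K) : convergent v f -> convergent v (NF f).
Proof.
move=> /nfo_small[w [x [C [w0 x01 fC]]]].
apply: (convergent_nrm hv _ (nf_nrm w0 x01 fC)) => -[i|j] //=.
by rewrite mulr_gt0 ?nf_wt_gt0 //; case/andP: x01.
Qed.

Lemma nfo_quo_conv (i : nf_T NF) (f : powser xs K) : convergent v f -> convergent v (nf_quo i f).
Proof.
move=> /nfo_small[w [x [C [w0 x01 fC]]]]; have [D fD] := nf_quo_nrm i w0 x01 fC.
apply: (convergent_nrm hv _ fD) => -[i'|j] //=.
by rewrite mulr_gt0 ?nf_wt_gt0 //; case/andP: x01.
Qed.

Lemma extended_quo (f : powser xs K) (J : set (powser 'I_l K)) : convergent v f -> I `<=` J ->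
  Defs.extended v J (\sum_(i : nf_T NF) nf_quo i f * ps_lift 'I_n (nf_gen i)).
Proof.
move=> fc IJ; apply: gen_ideal_sum => t; first exact: nfo_quo_conv.
by exists (nf_gen t) => //; apply: IJ; exact: nf_genI.
Qed.

Lemma nfo_eq0_extended (f : powser xs K) : convergent v f -> NF f = 0 -> Defs.extended v I f.
Proof. by move=> fc f0; rewrite (nf_div NF f) f0 addr0; exact: extended_quo. Qed.

Lemma nfo_ord_extended k (f : powser xs K) : convergent v f -> ord_ge (@rdeg 'I_n 'I_l) k (NF f) ->
  Defs.extended v (ideal_add I (max_pow v k)) f.
Proof.
case: hI => IC I0 ID IM fc fk; rewrite (nf_div NF f); apply: gen_idealD.
  apply: extended_quo => // g Ig; exists g, 0; rewrite addr0; split=> //.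
  apply: ord_max_pow; [exact: (convergent0 hv)|by []].
apply: gen_idealS (ord_extended (nfo_conv fc) fk) => _ [g mg <-].
by exists g => //; exists 0, g; rewrite add0r.
Qed.

End Reduction.
End MaxIdeal.
End Membership.

(** * Convergence of the initial data, and bounds that improve as radii shrink *)

Section Preliminaries.
Variables (R : realType) (K : fieldType) (v : K -> R).
Hypothesis hv : real_valued_field v.

Lemma polynomial_convergent (U : finType) (f : powser U K) : polynomial_series f -> convergent v f.
Proof.
move=> /finite_seqP[s sE]; have w0 (i : U) : 0 < (1 : R) by [].
apply: (convergent_nrm hv w0 (C := \sum_(a <- undup s) v (ps_coef f a) * mwt (fun=> 1) a)) => S uS.
have t0 a : 0 <= v (ps_coef f a) * mwt (fun=> 1) a.
  by rewrite mulr_ge0 ?(abs_ge0 hv) // ltW // mwt_gt0.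
rewrite (bigID (fun a => ps_coef f a != 0)) /= [X in _ + X]big1 ?addr0 => [|a]; last first.
  by rewrite negbK => /eqP ->; rewrite (abs0 hv) mul0r.
rewrite -big_filter; apply: ler_sum_uniq; rewrite ?filter_uniq ?undup_uniq //.
move=> a; rewrite mem_filter mem_undup => /andP[fa _].
by have : [set` s] a by rewrite -sE.
Qed.

Lemma convergent_liftl (V W : finType) (f : powser V K) : convergent v f -> convergent v (ps_liftl W f).
Proof.
move=> /(convergentP hv)[w [w0 [C fC]]].
have s0 : forall t : (V + W)%type, 0 < swt w (fun=> 1) t by case.
exact: (convergent_nrm hv s0 (nrm_liftl hv _ fC)).
Qed.

Lemma convergent_lift (V W : finType) (f : powser W K) : convergent v f -> convergent v (ps_lift V f).
Proof.
move=> /(convergentP hv)[w [w0 [C fC]]].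
have s0 : forall t : (V + W)%type, 0 < swt (fun=> 1) w t by case.
exact: (convergent_nrm hv s0 (nrm_lift hv _ fC)).
Qed.

Lemma conv_polynomial_convergent (V W : finType) (f : powser (V + W)%type K) :
  conv_polynomial_series v f -> convergent v f.
Proof.
move=> [/finite_seqP[s sE] fc].
have -> : f = \sum_(b <- undup s) ps_mono K (mjoin 0 b) * ps_liftl W (ps_coef_right f b).
  apply: coef_right_inj => b; rewrite coef_right_sum.
  have mE b' : ps_coef_right (ps_mono K (mjoin (0 : mon V) b')) b = if b == b' then 1 else 0.
    apply/powserP => a /=; case: (eqVneq b b') => [->|bb] /=.
      congr (if _ then _ else _); apply/eqP/eqP => [e|->//].
      by rewrite -(lmonE a b') e lmonE.
    case: eqP => // e; case/eqP: bb; by rewrite -(rmonE a b) e rmonE.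
  under eq_bigr do rewrite coef_right_mull mE.
  have [bs|bs] := boolP (b \in s).
    rewrite (bigD1_seq b) ?undup_uniq ?mem_undup //= eqxx mul1r big1 ?addr0 // => b' b'b.
    by rewrite eq_sym (negbTE b'b) mul0r.
  rewrite big_seq big1 => [|b']; last first.
    by rewrite mem_undup => b's; case: eqP => [bb|_]; [rewrite bb b's in bs|rewrite mul0r].
  have : ~ [set` s] b by apply/negP.
  by rewrite -sE /= => /negP; rewrite negbK => /eqP.
apply: (convergent_sum hv) => b; apply: (convergentM hv); first exact: (convergent_mono hv).
exact: convergent_liftl.
Qed.

(** Without terms of degree 0, shrinking the radii shrinks the norm by a factor instead of merely
    keeping it bounded. Every small bound on the data comes from this. *)
Lemma nrm_ord_scale (X : finType) (D : mon X -> nat) (w w' : X -> R) kap (f : powser X K) C :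
  ord_ge D 1 f -> 0 <= kap -> (forall a, (0 < D a)%N -> mwt w' a <= kap * mwt w a) ->
  nrm v w f C -> nrm v w' f (kap * C).
Proof.
move=> f1 k0 ww fC S uS; apply: le_trans (ler_wpM2l k0 (fC S uS)).
rewrite mulr_sumr; apply: ler_sum => a _; rewrite mulrCA.
have [a0|a0] := posnP (D a); first by rewrite f1 ?a0 // (abs0 hv) !mul0r.
by rewrite ler_wpM2l ?(abs_ge0 hv) // ww.
Qed.

Lemma exp_scale_le (x d : R) m : 0 < x <= d -> (0 < m)%N -> x ^+ m <= x / d * d ^+ m.
Proof.
move=> /andP[x0 xd]; have d0 := lt_le_trans x0 xd; case: m => // m _.
rewrite !exprS mulrA divfK ?gt_eqF // ler_wpM2l ?(ltW x0) //.
by apply: lerXn2r => //; rewrite nnegrE ltW.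
Qed.

Lemma small_ord (T U : finType) (w : U -> R) (f : T -> powser U K) r :
  (forall i, 0 < w i) -> (forall t, convergent v (f t)) -> (forall t, ord_ge (@mdeg U) 1 (f t)) ->
  0 < r -> exists2 d, 0 < d & forall x, 0 < x <= d -> forall t, nrm v (fun i => x * w i) (f t) r.
Proof.
move=> w0 fc f1 r0; have [C [d d0 dC]] := convergent_small_family hv w0 fc.
have C1 : 0 < Num.max C 1 by rewrite lt_max ltr01 orbT.
exists (Num.min d (r * d / Num.max C 1)); first by rewrite lt_min d0 divr_gt0 // mulr_gt0.
move=> x /andP[x0]; rewrite le_min => /andP[xd xr] t.
have dd : 0 < d <= d by rewrite d0 lexx.
apply: (@bounded_le _ _ _ _ _ _ (x / d * Num.max C 1)).
  by rewrite mulrAC ler_pdivrMr // -ler_pdivlMr.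
apply: (nrm_ord_scale (f1 t) (w := fun i => d * w i)).
- by rewrite divr_ge0 // ltW.
- move=> a a0; rewrite !mwt_scale mulrA; apply: ler_wpM2r; first exact/ltW/mwt_gt0.
  by apply: exp_scale_le => //; rewrite x0.
- by apply: bounded_le (dC d dd t); rewrite le_max lexx.
Qed.

Lemma polynomial_seriesD (U : finType) (f g : powser U K) :
  polynomial_series f -> polynomial_series g -> polynomial_series (f + g).
Proof.
move=> ff fg; apply: (@sub_finite_set _ _ ([set a | ps_coef f a != 0] `|` [set a | ps_coef g a != 0])).
  move=> a /= fga; have [fa|fa] := eqVneq (ps_coef f a) 0; last by left.
  by right; apply: contraNneq fga => ga; rewrite /= fa ga addr0.
by rewrite finite_setU.
Qed.

Lemma conv_polynomial_seriesD (V W : finType) (f g : powser (V + W)%type K) :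
  conv_polynomial_series v f -> conv_polynomial_series v g -> conv_polynomial_series v (f + g).
Proof.
have aD b : ps_coef_right (f + g) b = ps_coef_right f b + ps_coef_right g b by exact/powserP.
move=> [ff fc] [fg gc]; split=> [|b]; last by rewrite aD; exact: (convergentD hv).
apply: (@sub_finite_set _ _ ([set b | ps_coef_right f b != 0] `|` [set b | ps_coef_right g b != 0])).
  move=> b /= fgb; have [fb|fb] := eqVneq (ps_coef_right f b) 0; last by left.
  by right; apply: contraNneq fgb => gb; rewrite aD fb gb addr0.
by rewrite finite_setU.
Qed.

End Preliminaries.

(** * The iteration *)

Lemma dependent_choice (S : Type) (P : nat -> S -> Prop) (Q : nat -> S -> S -> Prop) (s0 : S) :
  P 0%N s0 -> (forall k s, P k s -> exists s', P k.+1 s' /\ Q k s s') ->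
  exists f : nat -> S, forall k, P k (f k) /\ Q k (f k) (f k.+1).
Proof.
move=> P0 PS.
have /choice[next nextP] : forall ks : nat * S, exists s', P ks.1 ks.2 -> P ks.1.+1 s' /\ Q ks.1 ks.2 s'.
  move=> [k s]; have [/PS[s' s'P]|nP] := pselect (P k s); first by exists s'.
  by exists s => /nP.
pose f := fix f k := if k is k'.+1 then next (k', f k') else s0.
have Pf k : P k (f k) by elim: k => //= k IH; case: (nextP (k, f k) IH).
by exists f => k; split=> //; case: (nextP (k, f k) (Pf k)).
Qed.

Section Iteration.
Variables (R : realType) (K : fieldType) (v : K -> R).
Hypothesis hv : real_valued_field v.
Variables n l p q N : nat.
Notation xs := ('I_n + 'I_l)%type.
Notation args := (xs + ('I_p + 'I_q))%type.
Variable I : set (powser 'I_l K).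
Hypothesis hI : is_ideal (convergent v (V := 'I_l)) I.
Variable F : 'I_N -> powser args K.
Variables (y0 : 'I_p -> powser 'I_l K) (z0 : 'I_q -> powser xs K) (e0 : nat).
Implicit Types (u : 'I_p -> powser 'I_l K) (w : 'I_q -> powser xs K).

Local Notation arg0 := (nested_args y0 z0).
Local Notation rord := (ord_ge (@rdeg 'I_n 'I_l)).
Local Notation mord := (ord_ge (@mdeg xs)).

Definition incr u w (t : args) : powser xs K :=
  match t with
  | inl _ => 0
  | inr (inl i) => ps_lift 'I_n (u i)
  | inr (inr k) => w k
  end.

Lemma ps_liftD (f g : powser 'I_l K) : ps_lift 'I_n (f + g) = ps_lift 'I_n f + ps_lift 'I_n g.
Proof. by apply/powserP => a /=; case: eqP; rewrite ?addr0. Qed.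

Lemma nested_argsD (y : 'I_p -> powser 'I_l K) (z : 'I_q -> powser xs K) u w t :
  nested_args (fun j => y j + u j) (fun k => z k + w k) t = nested_args y z t + incr u w t.
Proof. by case: t => [t|[i|k]] /=; rewrite ?addr0 // ps_liftD. Qed.

Lemma incrD u u' w w' t :
  incr (fun i => u i + u' i) (fun k => w k + w' k) t = incr u w t + incr u' w' t.
Proof. by case: t => [t|[i|k]] /=; rewrite ?addr0 // ps_liftD. Qed.

Lemma coef_right_lift (f : powser 'I_l K) b : ps_coef_right (ps_lift 'I_n f) b = ps_const 'I_n (ps_coef f b).
Proof. by apply/powserP => a /=; rewrite lmonE rmonE. Qed.

Lemma coef_rightD (f g : powser xs K) b :
  ps_coef_right (f + g) b = ps_coef_right f b + ps_coef_right g b.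
Proof. exact/powserP. Qed.

Lemma coef_rightN (f : powser xs K) b : ps_coef_right (- f) b = - ps_coef_right f b.
Proof. exact/powserP. Qed.

Lemma coef_right_ord (f : powser xs K) m b : rord m f -> (mdeg b < m)%N -> ps_coef_right f b = 0.
Proof. by move=> fm bm; apply/powserP => a /=; apply: fm; rewrite /rdeg rmonE. Qed.

Lemma ord_coef_right (f : powser xs K) m : (forall b, (mdeg b < m)%N -> ps_coef_right f b = 0) -> rord m f.
Proof. by move=> f0 c cm; rewrite -(mjoinK c); have /powserP/(_ (lmon c)) := f0 _ cm. Qed.

Lemma incr_rord u w m : (forall i, ord_ge (@mdeg 'I_l) m (u i)) -> (forall k, rord m (w k)) ->
  forall t, rord m (incr u w t).
Proof.
move=> um wm [t|[i|k]] //=.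
by move=> c cm /=; case: eqP => // _; exact: um.
Qed.

Lemma rord_mord (f : powser xs K) : rord 1 f -> mord 1 f.
Proof. by move=> f1 c; rewrite mdeg_join ltnS leqn0 addn_eq0 => /andP[_ /eqP c0]; apply: f1; rewrite /rdeg c0. Qed.

(* The unknowns at s = 0, and the derivatives of F there. *)
Definition base (t : args) : powser xs K := ps_liftl 'I_l (ps_coef_right (arg0 t) 0).

Definition jac j t := lin (F j) base t.
Definition jac0 j t : powser 'I_n K := ps_coef_right (jac j t) 0.

Hypothesis arg0_ord : forall t, mord 1 (arg0 t).

Lemma base_ord t : mord 1 (base t).
Proof.
move=> c; rewrite ltnS leqn0 => /eqP /mdeg_eq0 ->.
have := arg0_ord t (a := 0); rewrite mdeg0 => /(_ isT) h; rewrite /= .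
case: eqP => // _; rewrite -h; congr (ps_coef (arg0 t) _).
by apply/ffunP => -[i|i]; rewrite !ffunE.
Qed.

Lemma arg0_base t : rord 1 (arg0 t - base t).
Proof.
apply: ord_coef_right => b; rewrite ltnS leqn0 => /eqP /mdeg_eq0 ->.
by rewrite coef_rightD coef_rightN coef_right_liftl eqxx subrr.
Qed.

(** Series free of s are closed under products, and the derivative is built from the values at s =
    0. Being free of s, it acts on each coefficient of a monomial in s separately. *)
Lemma jac_liftl j t : jac j t = ps_liftl 'I_l (jac0 j t).
Proof.
apply/liftl_coef0 => c c0.
have sfM (f g : powser xs K) : (forall c, rmon c != 0 -> ps_coef f c = 0) ->
    (forall c, rmon c != 0 -> ps_coef g c = 0) -> forall c, rmon c != 0 -> ps_coef (f * g) c = 0.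
  move=> /liftl_coef0 -> /liftl_coef0 ->; rewrite -liftlM => d /negbTE d0.
  by rewrite -[LHS]/(if rmon d == 0 then _ else _) d0.
have sfb t' d : rmon d != 0 -> ps_coef (base t') d = 0 by move=> /negbTE /= ->.
have sf1 d : rmon d != 0 -> ps_coef (1 : powser xs K) d = 0.
  by move=> d0; rewrite ps_coef1 mjoin_eq0 (negbTE d0) andbF.
have sfprod ts d : rmon d != 0 -> ps_coef (\prod_(t' <- ts) base t') d = 0.
  elim: ts d => [|t' ts IH] d; first by rewrite big_nil; exact: sf1.
  by rewrite big_cons; apply: sfM => // d'; exact: sfb.
have sflin ts d : rmon d != 0 -> ps_coef (lincoef base ts t) d = 0.
  elim: ts d => [|t' ts IH] d d0 //.
  rewrite -[lincoef _ _ _]/(base t' * lincoef base ts t + (if t' == t then \prod_(i <- ts) base i else 0)).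
  rewrite ps_coefD sfM ?add0r //; last by move=> d'; exact: sfb.
  by case: eqP => // _; exact: sfprod.
rewrite /jac /lin /psum [LHS]big1 // => b _.
by rewrite ps_coef_constM sflin // mulr0.
Qed.

Definition jacA j i := jac0 j (inr (inl i)).
Definition jacB j k := jac0 j (inr (inr k)).

Definition jac_app u w j := \sum_t jac j t * incr u w t.

Lemma jac_appE u w j : jac_app u w j =
  \sum_i ps_lift 'I_n (u i) * ps_liftl 'I_l (jacA j i) + \sum_k w k * ps_liftl 'I_l (jacB j k).
Proof.
rewrite /jac_app big_sumType /= big1 ?add0r => [|t _]; last by rewrite mulr0.
rewrite big_sumType; congr (_ + _); apply: eq_bigr => i _; by rewrite jac_liftl mulrC.
Qed.

Lemma coef_right_jac_app u w j b : ps_coef_right (jac_app u w j) b =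
  lin_value jacA jacB (fun i => ps_coef (u i) b) (fun k => ps_coef_right (w k) b) j.
Proof.
rewrite jac_appE coef_rightD !coef_right_sum; congr (_ + _); apply: eq_bigr => i _.
  by rewrite coef_right_mull coef_right_lift.
by rewrite coef_right_mull mulrC.
Qed.

Lemma lin_value0 j : lin_value jacA jacB (fun=> 0) (fun=> 0) j = 0.
Proof.
rewrite /lin_value !big1 ?addr0 // => i _; first by rewrite mulr0.
by apply/powserP => a; rewrite ps_coef_constM mul0r.
Qed.

Definition evalF u w j := ps_subst (F j) (fun t => arg0 t + incr u w t).

Lemma evalFE u w : eval_system F (fun j => y0 j + u j) (fun k => z0 k + w k) = evalF u w.
Proof. by apply/funext => j; congr ps_subst; apply/funext => t; exact: nested_argsD. Qed.

Lemma evalF_lin u w u' w' m j : (0 < m)%N -> (forall t, rord 1 (incr u w t)) ->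
  (forall i, ord_ge (@mdeg 'I_l) m (u' i)) -> (forall k, rord m (w' k)) ->
  rord m.+1 (evalF (fun i => u i + u' i) (fun k => w k + w' k) j - evalF u w j - jac_app u' w' j).
Proof.
move=> m0 uw u'm w'm.
have -> : evalF (fun i => u i + u' i) (fun k => w k + w' k) j =
    ps_subst (F j) (fun t => (arg0 t + incr u w t) + incr u' w' t).
  by congr ps_subst; apply/funext => t; rewrite incrD addrA.
have du := incr_rord u'm w'm.
apply: (subst_lin_ord (@rdegD _ _)) => // [t|t|t|t].
- by apply: ord_geD; [exact: arg0_ord|exact/rord_mord/uw].
- exact: base_ord.
- by apply: rord_mord; apply: ord_ge_le (du t).
- by rewrite addrAC; apply: ord_geD; [exact: arg0_base|exact: uw].
Qed.

Variable NF : normal_form v 'I_n I.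
Variable ls : linear_section v 'I_l jacA jacB.

(* The increments u, w only involve standard monomials, so NF fixes jac_app u w: the *)
(* residue is NF of base_value + remainder, and the remainder is quadratic.          *)
Definition resid u w j := NF (evalF u w j) - jac_app u w j.

Definition in_range k b := [&& (e0 < mdeg b)%N, (mdeg b <= e0 + k)%N & nf_std NF b].

Definition supported k u w :=
  (forall i b, ~~ in_range k b -> ps_coef (u i) b = 0) /\
  (forall m b, ~~ in_range k b -> ps_coef_right (w m) b = 0).

Definition solves k u w :=
  (forall i b, (e0 < mdeg b <= e0 + k)%N -> ps_coef (u i) b = - ls_u ls i (slices (resid u w) b)) /\
  (forall m b, (e0 < mdeg b <= e0 + k)%N -> ps_coef_right (w m) b = - ls_z ls m (slices (resid u w) b)).

Lemma supported_ord k u w : supported k u w ->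
  (forall i, ord_ge (@mdeg 'I_l) e0.+1 (u i)) /\ (forall m, rord e0.+1 (w m)).
Proof.
move=> [us ws]; split=> [i b be|m].
  by apply: us; rewrite /in_range ltnNge -ltnS be.
by apply: ord_coef_right => b be; apply: ws; rewrite /in_range ltnNge -ltnS be.
Qed.

Lemma supported_incr k u w : supported k u w -> forall t, rord 1 (incr u w t).
Proof.
move=> /supported_ord[ue we] t; apply: incr_rord => [i|m]; [apply: ord_ge_le (ue i)|apply: ord_ge_le (we m)]; lia.
Qed.

Lemma nfo_jac_app_id u w j : (forall i b, ~~ nf_std NF b -> ps_coef (u i) b = 0) ->
  (forall m b, ~~ nf_std NF b -> ps_coef_right (w m) b = 0) -> NF (jac_app u w j) = jac_app u w j.
Proof.
move=> us ws; apply: nf_id => b nb; rewrite coef_right_jac_app -(lin_value0 j).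
congr (lin_value _ _ _ _ j); apply/funext => i; [exact: us|exact: ws].
Qed.

Lemma supported_std k u w : supported k u w ->
  (forall i b, ~~ nf_std NF b -> ps_coef (u i) b = 0) /\
  (forall m b, ~~ nf_std NF b -> ps_coef_right (w m) b = 0).
Proof.
by move=> [us ws]; split=> i b nb; [apply: us|apply: ws]; rewrite /in_range (negbTE nb) !andbF.
Qed.

(** The normal form combines slices with coefficients in K, so constants remain constants and the
    result is again a value of the linear map. This is needed because the increments granted by the
    extension hypothesis may involve monomials that are not standard. *)
Lemma nfo_jac_app_image u w b : (forall k, convergent v (w k)) ->
  lin_image v jacA jacB (fun j => ps_coef_right (NF (jac_app u w j)) b).
Proof.
move=> wc.
exists (fun i => \sum_(b' <- nf_seg NF b) nf_mx NF b b' * ps_coef (u i) b').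
exists (fun k => ps_coef_right (NF (w k)) b); split.
  by move=> k; apply: (convergent_slice_right hv); exact: (nfo_conv hv).
move=> j; rewrite jac_appE nfoD coef_rightD !nfo_sum !coef_right_sum; congr (_ + _); apply: eq_bigr => i _.
  rewrite nfo_mull coef_right_mull; congr (_ * _); rewrite nf_right.
  under eq_bigr do rewrite coef_right_lift -ps_constM.
  apply/powserP => a; rewrite ps_coef_sum /=.
  by case: eqP => // _; rewrite big1.
by rewrite nfo_mull coef_right_mull mulrC.
Qed.

Lemma lin_imageN r : lin_image v jacA jacB r -> lin_image v jacA jacB (fun j => - r j).
Proof.
move=> [c [h [hc rE]]]; exists (fun i => - c i), (fun k => - h k); split.
  by move=> k; exact: (convergentN hv).
move=> j; rewrite rE /lin_value opprD -!sumrN; congr (_ + _); apply: eq_bigr => i _.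
  by rewrite -mulNr; congr (_ * _); apply/powserP => a /=; case: eqP; rewrite ?oppr0.
by rewrite mulrN.
Qed.

(** The increments only see the residue in positive degrees in s. Without its part free of s, the
    constant part of the equation becomes small as the radii in s shrink. *)
Definition trunc (f : powser xs K) : powser xs K :=
  Powser (fun c => if rdeg c == 0%N then 0 else ps_coef f c).

(** The Taylor expansion is made around the values at s = 0 and not around the given solution, so
    that its linear part is the fixed map [jac]. The known difference [arg0 t - base t] then
    contributes to the constant part, and to the remainder through [shift]. *)
Definition base_value j := ps_subst (F j) base + \sum_t jac j t * (arg0 t - base t).

Definition shift u w t := (arg0 t - base t) + incr u w t.

Definition remainder u w j :=
  ps_subst (F j) (fun t => base t + shift u w t) - ps_subst (F j) base
    - \sum_t jac j t * shift u w t.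

Lemma evalF_shift u w j : evalF u w j = ps_subst (F j) (fun t => base t + shift u w t).
Proof. by congr ps_subst; apply/funext => t; rewrite /shift addrA [base t + _]addrC subrK. Qed.

Lemma residE k u w j : supported k u w -> resid u w j = NF (base_value j + remainder u w j).
Proof.
move=> /supported_std[us ws]; rewrite /resid -(nfo_jac_app_id j us ws) -nfoB; congr (nfo NF _).
rewrite evalF_shift /base_value /remainder /jac_app.
have -> : \sum_t jac j t * shift u w t =
    \sum_t jac j t * (arg0 t - base t) + \sum_t jac j t * incr u w t.
  by rewrite -big_split; apply: eq_bigr => t _; exact: mulrDr.
by ring.
Qed.

(** * A priori bounds at fixed radii *)

Section Estimates.
Variables (r CF kap D eta : R) (wx : 'I_n -> R) (ws : 'I_l -> R).
Hypotheses (r_gt0 : 0 < r) (kap_gt0 : 0 < kap) (kap_le : 2 * kap <= 1) (D_ge0 : 0 <= D).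
Hypotheses (wx_gt0 : forall i, 0 < wx i) (ws_gt0 : forall j, 0 < ws j).
Local Notation wt := (swt wx ws).
Hypothesis F_bound : forall j, bounded v (mwt (fun=> 3 * r)) (ps_coef (F j)) CF.
Hypothesis NF_bound : forall f C, nrm v wt f C -> nrm v wt (NF f) (2 * C).
Hypothesis ls_bound : forall (f : 'I_N -> powser xs K) C, 0 <= C -> (forall j, nrm v wt (f j) C) ->
  (forall i, nrm v ws (slicewise_const (ls_u ls i) f) (D * C)) /\
  (forall m, nrm v wt (slicewise (ls_z ls m) f) (D * C)).
Hypothesis base_bound : forall t, nrm v wt (base t) r.
Hypothesis arg0_bound : forall t, nrm v wt (arg0 t - base t) (kap * r).
Hypothesis value_bound : forall j, nrm v wt (trunc (NF (base_value j))) eta.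
Hypothesis eta_ge0 : 0 <= eta.
(* The section (norm D) applied to the constant part eta and to the quadratic remainder *)
(* of increments in the ball of radius kap * r stays in that ball.                       *)
Hypothesis budget : D * (eta + 2 * ((2 * kap) ^+ 2 * Num.max CF 0)) <= kap * r.

Let wt_gt0 t : 0 < wt t. Proof. exact: swt_gt0. Qed.
Let wt_ge0 t : 0 <= wt t. Proof. exact: ltW. Qed.

Let CF' := Num.max CF 0.
Let CF'_ge0 : 0 <= CF'. Proof. by rewrite le_max lexx orbT. Qed.
Let F_bound' j : bounded v (mwt (fun=> 3 * r)) (ps_coef (F j)) CF'.
Proof. by apply: bounded_le (F_bound j); rewrite le_max lexx. Qed.

Definition small u w := (forall i, nrm v ws (u i) (kap * r)) /\ (forall m, nrm v wt (w m) (kap * r)).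

(** One [kap * r] comes from [arg0 t - base t], the other from the increments; hence the [2 * kap]
    in the budget. *)
Lemma shift_bound u w : small u w -> forall t, nrm v wt (shift u w t) (2 * kap * r).
Proof.
move=> [ub wb] t; rewrite -mulrA mulr_natl mulr2n; apply: (nrmD hv) => //.
case: t => [t|[i|m]]; last exact: wb.
  by apply: bounded_le (bounded0 hv _); rewrite mulr_ge0 // ltW.
by apply: (nrm_lift hv); exact: ub.
Qed.

Lemma shift_ord u w : (forall t, rord 1 (incr u w t)) -> forall t, mord 1 (shift u w t).
Proof.
by move=> uw t; apply: ord_geD; apply: rord_mord; [exact: arg0_base|exact: uw].
Qed.

Lemma evalF_bound u w j : (forall t, rord 1 (incr u w t)) -> small u w -> nrm v wt (evalF u w j) CF'.
Proof.
move=> uw sm; rewrite evalF_shift.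
apply: (nrm_subst hv wt_ge0 (F_bound' j)) => t.
  by apply: ord_geD; [exact: base_ord|exact: shift_ord uw _].
apply: (@bounded_le _ _ _ _ _ _ (r + 2 * kap * r)).
  have : 2 * kap * r <= 1 * r by rewrite ler_wpM2r // ltW.
  by have := r_gt0; lra.
by apply: (nrmD hv) => //; exact: shift_bound.
Qed.

Lemma evalF_conv u w j : (forall t, rord 1 (incr u w t)) -> small u w -> convergent v (evalF u w j).
Proof. by move=> uw sm; exact: (convergent_nrm hv wt_gt0 (evalF_bound j uw sm)). Qed.

Lemma truncD f g : trunc (f + g) = trunc f + trunc g.
Proof. by apply/powserP => c /=; case: eqP; rewrite ?addr0. Qed.

Lemma trunc_bound f C : nrm v wt f C -> nrm v wt (trunc f) C.
Proof.
apply: bounded_dom => [c|c]; first exact: mwt_ge0.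
by rewrite /=; case: eqP; rewrite // (abs0 hv) (abs_ge0 hv).
Qed.

Lemma coef_right_trunc f b : (0 < mdeg b)%N -> ps_coef_right (trunc f) b = ps_coef_right f b.
Proof.
by move=> b0; apply/powserP => a /=; rewrite /rdeg rmonE; case: eqP b0 => // ->.
Qed.

Lemma resid_bound k u w j : supported k u w -> small u w ->
  nrm v wt (trunc (resid u w j)) (eta + 2 * ((2 * kap) ^+ 2 * CF')).
Proof.
move=> uw sm; rewrite (residE j uw) nfoD truncD; apply: (nrmD hv) => //.
apply/trunc_bound/NF_bound.
have k01 : 0 <= 2 * kap <= 1 by rewrite kap_le andbT mulr_ge0 // ltW.
apply: (nrm_subst_rem hv wt_ge0 r_gt0 (F_bound' j) k01) => t.
- exact: base_ord.
- exact: shift_ord (supported_incr uw) _.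
- exact: base_bound.
- exact: shift_bound.
Qed.

Definition approx k u w := [/\ solution_of_order v F I (e0 + k) (fun i => y0 i + u i) (fun m => z0 m + w m),
  supported k u w, solves k u w & small u w].

Hypothesis hext : forall e : nat, (e0 <= e)%N ->
  forall (y : 'I_p -> powser 'I_l K) (z : 'I_q -> powser xs K),
    solution_of_order v F I e y z -> congruent v e0.+1 y y0 z z0 ->
    exists (u : 'I_p -> powser 'I_l K) (w : 'I_q -> powser xs K),
      [/\ forall j, polynomial_series (u j) /\ homogeneous e.+1 (u j),
          forall k, conv_polynomial_series v (w k) /\ homogeneous_right e.+1 (w k)
        & solution_of_order v F I e.+1 (fun j => y j + u j) (fun k => z k + w k)].

Lemma small_convergent u w : small u w -> (forall i, convergent v (u i)) /\ (forall m, convergent v (w m)).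
Proof.
move=> [ub wb]; split=> i; first exact: (convergent_nrm hv ws_gt0 (ub i)).
exact: (convergent_nrm hv wt_gt0 (wb i)).
Qed.

Lemma increment_congruent u w : small u w ->
  (forall i, ord_ge (@mdeg 'I_l) e0.+1 (u i)) -> (forall m, rord e0.+1 (w m)) ->
  congruent v e0.+1 (fun i => y0 i + u i) y0 (fun m => z0 m + w m) z0.
Proof.
move=> /small_convergent[uc wc] ue we; split=> i; rewrite addrC addKr.
  exact: (ord_max_pow hv).
exact: (ord_extended hv).
Qed.

(** * From order e0 + k to order e0 + k + 1 *)

Section Step.
Variables (k : nat) (u : 'I_p -> powser 'I_l K) (w : 'I_q -> powser xs K).
Hypothesis uw : approx k u w.

Let sol : solution_of_order v F I (e0 + k) (fun i => y0 i + u i) (fun m => z0 m + w m).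
Proof. by case: uw. Qed.
Let sup : supported k u w. Proof. by case: uw. Qed.
Let slv : solves k u w. Proof. by case: uw. Qed.
Let sml : small u w. Proof. by case: uw. Qed.

Let Rf j := NF (evalF u w j).
Let d := (e0 + k).+1.

Let Rf_ord j : rord d (Rf j).
Proof.
case: sol => _ _ _ /(_ j); rewrite evalFE; exact: nfo_extended.
Qed.

(** Modulo order [d.+1], passing to an extension changes the normal form of the system by that of
    the derivative at the increment, and must cancel the part of degree [d]. The increments granted
    by the hypothesis are used only for this solvability; the ones actually added come from the
    section, which controls their size. *)
Lemma obstruction_image b : mdeg b = d -> lin_image v jacA jacB (slices Rf b).
Proof.
move=> bd.
have [ue we] := supported_ord sup.
have [|u1 [w1 [u1h w1h [_ _ _ sol1]]]] := hext _ sol (increment_congruent sml ue we).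
  exact: leq_addr.
have u1d i : ord_ge (@mdeg 'I_l) d (u1 i).
  move=> a ad; have [_ hom] := u1h i; apply: contrapT => /eqP /hom ae; by rewrite ae ltnn in ad.
have w1d m : rord d (w1 m).
  have [_ hom] := w1h m; apply: ord_coef_right => a ad; apply: contrapT => /eqP /hom ae.
  by rewrite ae ltnn in ad.
have w1c m : convergent v (w1 m) by have [/(conv_polynomial_convergent hv)] := w1h m.
have im := lin_imageN (nfo_jac_app_image u1 b w1c).
suff -> : slices Rf b = (fun j => - ps_coef_right (NF (jac_app u1 w1 j)) b) by [].
apply/funext => j.
have E1 : rord d.+1 (NF (eval_system F (fun j => y0 j + u j + u1 j) (fun k => z0 k + w k + w1 k) j)).
  exact: nfo_extended (sol1 j).
have E2 := evalF_lin (m := d) j isT (supported_incr sup) u1d w1d.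
have {}E2 := nf_ord NF E2.
have Y : (fun j => y0 j + u j + u1 j) = (fun j => y0 j + (u j + u1 j)).
  by apply/funext => i; rewrite addrA.
have Z : (fun k => z0 k + w k + w1 k) = (fun k => z0 k + (w k + w1 k)).
  by apply/funext => i; rewrite addrA.
rewrite Y Z evalFE in E1.
have bd' : (mdeg b < d.+1)%N by rewrite bd.
have := coef_right_ord E2 bd'; rewrite !nfoB !coef_rightD !coef_rightN.
rewrite (coef_right_ord E1 bd') add0r -opprD => /eqP; rewrite oppr_eq0 addr_eq0 => /eqP <-.
by [].
Qed.

Let u' (i : 'I_p) : powser 'I_l K :=
  Powser (fun b => if mdeg b == d then - ls_u ls i (slices Rf b) else 0).
Let w' (m : 'I_q) : powser xs K :=
  Powser (fun c => if rdeg c == d then - ps_coef (ls_z ls m (slices Rf (rmon c))) (lmon c) else 0).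

Let w'E m b : ps_coef_right (w' m) b = if mdeg b == d then - ls_z ls m (slices Rf b) else 0.
Proof.
apply/powserP => a; rewrite -[LHS]/(if rdeg (mjoin a b) == d then
  - ps_coef (ls_z ls m (slices Rf (rmon (mjoin a b)))) (lmon (mjoin a b)) else 0).
by rewrite /rdeg rmonE lmonE; case: eqP.
Qed.

Let u'd i : ord_ge (@mdeg 'I_l) d (u' i).
Proof. by move=> b bd /=; case: eqP => // be; rewrite be ltnn in bd. Qed.

Let w'd m : rord d (w' m).
Proof. by apply: ord_coef_right => b bd; rewrite w'E; case: eqP => // be; rewrite be ltnn in bd. Qed.

Let Rf_std b : ~~ nf_std NF b -> slices Rf b = fun=> 0.
Proof. by move=> nb; apply/funext => j; rewrite /slices nf_std0. Qed.

Let u'_std i b : ~~ nf_std NF b -> ps_coef (u' i) b = 0.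
Proof. by move=> nb /=; case: eqP => // _; rewrite Rf_std // ls_u0 oppr0. Qed.

Let w'_std m b : ~~ nf_std NF b -> ps_coef_right (w' m) b = 0.
Proof. by move=> nb; rewrite w'E; case: eqP => // _; rewrite Rf_std // ls_z0 oppr0. Qed.

Let jac_app' j b : mdeg b = d -> ps_coef_right (jac_app u' w' j) b = - ps_coef_right (Rf j) b.
Proof.
move=> bd; rewrite coef_right_jac_app -[ps_coef_right (Rf j) b]/(slices Rf b j).
rewrite (ls_value ls (obstruction_image bd)) /lin_value opprD -!sumrN; congr (_ + _); apply: eq_bigr => i _.
  rewrite -mulNr; congr (_ * _); apply/powserP => a /=; rewrite bd eqxx.
  by case: eqP; rewrite ?oppr0.
by rewrite w'E bd eqxx mulrN.
Qed.

Let un i := u i + u' i.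
Let wn m := w m + w' m.

(** In degree [d] the old increments vanish, so the residue there is [Rf]; in lower degrees this is
    [solves]. The new increments are thus, up to sign, the section applied to a single series, and
    get bounded as a whole instead of degree by degree. *)
Let un_coef i b : ps_coef (un i) b =
  if (e0 < mdeg b <= e0 + k.+1)%N then - ls_u ls i (slices (resid u w) b) else 0.
Proof.
have [us _] := sup; have [sl _] := slv.
rewrite /un ps_coefD [ps_coef (u' i) b]/=; case: (eqVneq (mdeg b) d) => [bd|bd].
  rewrite us ?add0r; last by rewrite /in_range bd /d ltnn andbF.
  have -> : (e0 < mdeg b <= e0 + k.+1)%N by rewrite bd /d addnS leqnn ltnS leq_addr.
  congr (- ls_u ls i _); apply/funext => j; rewrite /slices /resid coef_rightD coef_rightN.
  rewrite coef_right_jac_app; have [us' ws'] := sup.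
  have -> : (fun i0 => ps_coef (u i0) b) = fun=> 0.
    by apply/funext => i0; rewrite us' // /in_range bd /d ltnn andbF.
  have -> : (fun k0 => ps_coef_right (w k0) b) = fun=> 0.
    by apply/funext => i0; rewrite ws' // /in_range bd /d ltnn andbF.
  by rewrite lin_value0 subr0.
rewrite addr0; case: (boolP (e0 < mdeg b <= e0 + k)%N) => [br|nbr].
  rewrite sl //; have -> // : (e0 < mdeg b <= e0 + k.+1)%N.
  by case/andP: br => -> /=; rewrite addnS; exact: leqW.
rewrite us; last by rewrite /in_range andbA (negbTE nbr).
case: ifP => //; rewrite addnS => /andP[b1 b2]; case/negP: nbr; rewrite b1 /=.
by move: b2; rewrite leq_eqVlt (negbTE bd).
Qed.

Let wn_coef m b : ps_coef_right (wn m) b =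
  if (e0 < mdeg b <= e0 + k.+1)%N then - ls_z ls m (slices (resid u w) b) else 0.
Proof.
have [us ws'] := sup; have [_ sl] := slv.
rewrite /wn coef_rightD w'E; case: (eqVneq (mdeg b) d) => [bd|bd].
  rewrite ws' ?add0r; last by rewrite /in_range bd /d ltnn andbF.
  have -> : (e0 < mdeg b <= e0 + k.+1)%N by rewrite bd /d addnS leqnn ltnS leq_addr.
  congr (- ls_z ls m _); apply/funext => j; rewrite /slices /resid coef_rightD coef_rightN.
  rewrite coef_right_jac_app.
  have -> : (fun i0 => ps_coef (u i0) b) = fun=> 0.
    by apply/funext => i0; rewrite us // /in_range bd /d ltnn andbF.
  have -> : (fun k0 => ps_coef_right (w k0) b) = fun=> 0.
    by apply/funext => i0; rewrite ws' // /in_range bd /d ltnn andbF.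
  by rewrite lin_value0 subr0.
rewrite addr0; case: (boolP (e0 < mdeg b <= e0 + k)%N) => [br|nbr].
  rewrite sl //; have -> // : (e0 < mdeg b <= e0 + k.+1)%N.
  by case/andP: br => -> /=; rewrite addnS; exact: leqW.
rewrite ws'; last by rewrite /in_range andbA (negbTE nbr).
case: ifP => //; rewrite addnS => /andP[b1 b2]; case/negP: nbr; rewrite b1 /=.
by move: b2; rewrite leq_eqVlt (negbTE bd).
Qed.

Let supn : supported k.+1 un wn.
Proof.
have [us ws'] := supported_std sup.
split=> [i|m] b; rewrite /in_range andbA negb_and => /orP[nb|nb].
- by rewrite un_coef (negbTE nb).
- by rewrite ps_coefD us // u'_std // addr0.
- by rewrite wn_coef (negbTE nb).
- by rewrite coef_rightD ws' // w'_std // addr0.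
Qed.

Let evalF_diff j : rord d.+1 (evalF un wn j - evalF u w j - jac_app u' w' j).
Proof. exact: (evalF_lin (m := d) j isT (supported_incr sup) u'd w'd). Qed.

(* The old residue agrees with the new one in all the degrees that are solved, *)
(* hence bounds the new increments without circularity.                        *)
Let smln : small un wn.
Proof.
have [lu lz] := ls_bound (addr_ge0 eta_ge0 (mulr_ge0 (ler0n R 2) (mulr_ge0 (exprn_ge0 2 (mulr_ge0 (ler0n R 2) (ltW kap_gt0))) CF'_ge0)))
  (fun j => resid_bound j sup sml).
have sE b : (0 < mdeg b)%N -> slices (fun j => trunc (resid u w j)) b = slices (resid u w) b.
  by move=> b0; apply/funext => j; rewrite /slices coef_right_trunc.
split=> i; apply: bounded_le budget _.
  apply: bounded_dom (lu i) => [b|b]; first by apply: mwt_ge0 => j; exact: ltW.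
  rewrite un_coef; case: ifP => [/andP[b0 _]|_]; last by rewrite (abs0 hv) (abs_ge0 hv).
  by rewrite (absN hv) /= sE // (leq_ltn_trans _ b0).
apply: bounded_dom (lz i) => [c|c]; first exact: mwt_ge0.
have -> : ps_coef (wn i) c = ps_coef (ps_coef_right (wn i) (rmon c)) (lmon c) by rewrite -{1}(mjoinK c).
rewrite wn_coef; case: ifP => [/andP[b0 _]|_]; last by rewrite (abs0 hv) (abs_ge0 hv).
by rewrite ps_coefN (absN hv) -[ps_coef (slicewise _ _) c]/(ps_coef (ls_z ls i (slices _ (rmon c))) (lmon c)) sE // (leq_ltn_trans _ b0).
Qed.

Lemma approx_step : exists u2 w2, [/\ approx k.+1 (fun i => u i + u2 i) (fun m => w m + w2 m),
  forall i, ord_ge (@mdeg 'I_l) d (u2 i) & forall m, rord d (w2 m)].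
Proof.
exists u', w'; split=> //.
have Rn_ord j : rord d.+1 (NF (evalF un wn j)).
  apply: ord_coef_right => b bd.
  have := coef_right_ord (nf_ord NF (evalF_diff j)) bd.
  rewrite !nfoB !coef_rightD !coef_rightN nfo_jac_app_id //.
  move: bd; rewrite ltnS leq_eqVlt => /orP[/eqP bd|bd].
    by rewrite (jac_app' j bd) opprK subrK.
  rewrite (coef_right_ord (Rf_ord j) bd) subr0 coef_right_jac_app.
  have -> : (fun i0 => ps_coef (u' i0) b) = fun=> 0 by apply/funext => i; exact: u'd.
  have -> : (fun k0 => ps_coef_right (w' k0) b) = fun=> 0 by apply/funext => i; exact: (coef_right_ord (w'd i)).
  by rewrite lin_value0 subr0.
(* The two residues differ by the normal form of the Taylor error, of order [d.+1], so equations
   solved with the old residue hold with the new one. *)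
have slices_new b : (mdeg b < d.+1)%N -> slices (resid un wn) b = slices (resid u w) b.
  move=> bd; apply/funext => j; apply/eqP; rewrite -subr_eq0; apply/eqP.
  rewrite -[LHS]/(ps_coef_right (resid un wn j - resid u w j) b).
  have -> : resid un wn j - resid u w j = NF (evalF un wn j - evalF u w j - jac_app u' w' j).
    rewrite !nfoB nfo_jac_app_id // /resid.
    have -> : jac_app un wn j = jac_app u w j + jac_app u' w' j.
      by rewrite /jac_app -big_split; apply: eq_bigr => t _; rewrite incrD mulrDr.
    ring.
  exact: coef_right_ord (nf_ord NF (evalF_diff j)) bd.
have fin_d : finite_set [set b : mon 'I_l | mdeg b = d].
  apply: (@sub_finite_set _ _ [set` mons 'I_l d]); last exact: finite_seq.
  by move=> b /= bd; rewrite mem_mons bd.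
split; [|exact: supn| |exact: smln].
- have [yp zp [ys zs] _] := sol.
  have assoc_y : (fun i => y0 i + un i) = (fun i => y0 i + u i + u' i).
    by apply/funext => i; exact: addrA.
  have assoc_z : (fun m => z0 m + wn m) = (fun m => z0 m + w m + w' m).
    by apply/funext => i; exact: addrA.
  split=> [i|m||j].
  + rewrite -[X in polynomial_series X]/((fun i => y0 i + un i) i) assoc_y.
    apply: polynomial_seriesD => //; apply: sub_finite_set fin_d => b /=.
    by case: (mdeg b =P d) => // _; rewrite eqxx.
  + rewrite -[X in conv_polynomial_series v X]/((fun i => z0 i + wn i) m) assoc_z.
    apply: (conv_polynomial_seriesD hv) => //; split.
      apply: sub_finite_set fin_d => b /=; rewrite w'E.
      by case: (mdeg b =P d) => // _; rewrite eqxx.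
    move=> b; rewrite w'E; case: eqP => _; last exact: (convergent0 hv).
    apply: (convergentN hv).
    (* The coefficients of the new increment are convergent in x because the section of [Rf], like
       [Rf], is bounded at the given radii. *)
    have Rf_bd j := NF_bound (evalF_bound j (supported_incr sup) sml).
    have [_ /(_ m) lz] := ls_bound (mulr_ge0 (ler0n R 2) CF'_ge0) Rf_bd.
    have := convergent_slice_right hv b (convergent_nrm hv wt_gt0 lz).
    suff -> : ps_coef_right (slicewise (ls_z ls m) (fun j => NF (evalF u w j))) b = ls_z ls m (slices Rf b) by [].
    apply/powserP => a.
    by rewrite -[LHS]/(ps_coef (ls_z ls m (slices Rf (rmon (mjoin a b)))) (lmon (mjoin a b))) lmonE rmonE.
  + split=> [i|m].
      rewrite -[X in ps_const_coef X]/((fun i => y0 i + un i) i) assoc_y.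
      by rewrite /ps_const_coef ps_coefD [X in X + _]ys add0r; apply: u'd; rewrite mdeg0.
    rewrite -[X in ps_const_coef X]/((fun i => z0 i + wn i) m) assoc_z.
    rewrite /ps_const_coef ps_coefD [X in X + _]zs add0r; apply: w'd.
    have -> : (0 : mon xs) = mjoin 0 0 by apply/ffunP => -[i|i]; rewrite !ffunE.
    by rewrite /rdeg rmonE mdeg0.
  + rewrite evalFE addnS; apply: (nfo_ord_extended hv hI) (Rn_ord j).
    exact: evalF_conv (supported_incr supn) smln.
- split=> [i|m] b br; have bd : (mdeg b < d.+1)%N by case/andP: br => _; rewrite addnS.
    by rewrite un_coef br slices_new.
  by rewrite wn_coef br slices_new.
Qed.

End Step.
Lemma approx0 : solution_of_order v F I e0 y0 z0 -> approx 0 (fun=> 0) (fun=> 0).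
Proof.
move=> sol; have kr0 : 0 <= kap * r by rewrite mulr_ge0 // ltW.
split=> //.
- rewrite addn0; have -> : (fun i => y0 i + 0) = y0 by apply/funext => i; rewrite addr0.
  by have -> : (fun m => z0 m + 0) = z0 by apply/funext => i; rewrite addr0.
- by split=> i b br; exfalso; move: br; rewrite addn0; lia.
- by split=> i; apply: bounded_le (bounded0 hv _).
Qed.

Lemma approx_limit : solution_of_order v F I e0 y0 z0 -> exists y z,
  analytic_solution v F I y z /\ congruent v e0.+1 y y0 z z0.
Proof.
move=> sol.
pose Q k (s s' : ('I_p -> powser 'I_l K) * ('I_q -> powser xs K)) :=
  (forall i, ord_ge (@mdeg 'I_l) (e0 + k).+1 (s'.1 i - s.1 i)) /\
  (forall m, rord (e0 + k).+1 (s'.2 m - s.2 m)).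
have [|f fP] := @dependent_choice _ (fun k s => approx k s.1 s.2) Q (fun=> 0, fun=> 0) (approx0 sol).
  move=> k [u w] /= /approx_step[u2 [w2 [uw2 u2d w2d]]].
  exists (fun i => u i + u2 i, fun m => w m + w2 m); split=> //.
  by split=> i /=; rewrite addrC addKr; [exact: u2d|exact: w2d].
have stab k k' : (k <= k')%N -> Q k (f k) (f k').
  elim: k' => [|k' IH]; first by rewrite leqn0 => /eqP ->; split=> i; rewrite subrr.
  rewrite leq_eqVlt => /orP[/eqP ->|kk']; first by split=> i; rewrite subrr.
  have [[f1 f2] [_ [g1 g2]]] := (IH kk', fP k').
  have ek : ((e0 + k).+1 <= (e0 + k').+1)%N by rewrite ltnS leq_add2l.
  split=> i.
    by rewrite -[X in X - _](subrK ((f k').1 i)) -addrA; apply: ord_geD => //; exact: ord_ge_le (g1 i).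
  by rewrite -[X in X - _](subrK ((f k').2 i)) -addrA; apply: ord_geD => //; exact: ord_ge_le (g2 i).
(* Step [k] changes only degrees above e0 + k, so a coefficient of degree [b] no longer changes from
   index [b] on. *)
pose ul i : powser 'I_l K := Powser (fun b => ps_coef ((f (mdeg b)).1 i) b).
pose wl m : powser xs K := Powser (fun c => ps_coef ((f (rdeg c)).2 m) c).
have ulE k i b : (mdeg b <= e0 + k)%N -> ps_coef (ul i) b = ps_coef ((f k).1 i) b.
  move=> bk /=; have [bk'|bk'] := leqP (mdeg b) k.
    have [/(_ i b) + _] := stab _ _ bk'; rewrite ltnS leq_addl => /(_ isT) /eqP.
    by rewrite ps_coefB subr_eq0 => /eqP.
  have [/(_ i b) + _] := stab _ _ (ltnW bk'); rewrite ltnS bk => /(_ isT) /eqP.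
  by rewrite ps_coefB subr_eq0 => /eqP.
have wlE k m c : (rdeg c <= e0 + k)%N -> ps_coef (wl m) c = ps_coef ((f k).2 m) c.
  move=> ck /=; have [ck'|ck'] := leqP (rdeg c) k.
    have [_ /(_ m c)] := stab _ _ ck'; rewrite ltnS leq_addl => /(_ isT) /eqP.
    by rewrite ps_coefB subr_eq0 => /eqP.
  have [_ /(_ m c)] := stab _ _ (ltnW ck'); rewrite ltnS ck => /(_ isT) /eqP.
  by rewrite ps_coefB subr_eq0 => /eqP.
have ul_ord k i : ord_ge (@mdeg 'I_l) (e0 + k).+1 (ul i - (f k).1 i).
  by move=> b; rewrite ltnS => bk; rewrite ps_coefB (ulE k) ?subrr.
have wl_ord k m : rord (e0 + k).+1 (wl m - (f k).2 m).
  by move=> b; rewrite ltnS => bk; rewrite ps_coefB (wlE k) ?subrr.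
(* A finite sum involves finitely many degrees and is therefore the sum for a single approximant:
   the uniform bound passes to the formal limit with no completeness of K. *)
have sml : small ul wl.
  split=> i S uS.
    pose M := (\max_(a <- S) mdeg a)%N; have [[_ _ _ [/(_ i S uS) + _]] _] := fP M.
    apply: le_trans; rewrite big_seq [leRHS]big_seq; apply: ler_sum => b bS; rewrite (ulE M) //.
    by rewrite (leq_trans _ (leq_addl _ _)) //; apply: leq_bigmax_seq.
  pose M := (\max_(a <- S) rdeg a)%N; have [[_ _ _ [_ /(_ i S uS) +]] _] := fP M.
  apply: le_trans; rewrite big_seq [leRHS]big_seq; apply: ler_sum => b bS; rewrite (wlE M) //.
  by rewrite (leq_trans _ (leq_addl _ _)) //; apply: leq_bigmax_seq.
have [ule wle] : (forall i, ord_ge (@mdeg 'I_l) e0.+1 (ul i)) /\ (forall m, rord e0.+1 (wl m)).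
  have [[_ /supported_ord[ue we] _ _] _] := fP 0%N.
  split=> i.
    rewrite -[ul i](subrK ((f 0%N).1 i)); apply: ord_geD; last exact: ue.
    by have := ul_ord 0%N i; rewrite addn0.
  rewrite -[wl i](subrK ((f 0%N).2 i)); apply: ord_geD; last exact: we.
  by have := wl_ord 0%N i; rewrite addn0.
have incr1 t : rord 1 (incr ul wl t).
  by apply: incr_rord => [i|m]; [apply: ord_ge_le (ule i)|apply: ord_ge_le (wle m)].
(* For the coefficient at [c], the approximant of index [rdeg c] suffices: the limit differs from it
   by order e0 + rdeg c + 1, hence so do the values of the system. *)
have NF0 j : NF (evalF ul wl j) = 0.
  apply/powserP => c; set k := rdeg c.
  suff o : rord (e0 + k).+1 (NF (evalF ul wl j)) by apply: o; rewrite ltnS leq_addl.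
  have [[[_ _ _ /(_ j) sk] sup _ _] _] := fP k.
  have {}sk : rord (e0 + k).+1 (NF (evalF (f k).1 (f k).2 j)) by rewrite evalFE in sk; exact: nfo_extended.
  have := evalF_lin j (ltn0Sn (e0 + k)) (supported_incr sup) (ul_ord k) (wl_ord k).
  have -> : (fun i => (f k).1 i + (ul i - (f k).1 i)) = ul by apply/funext => i; rewrite addrC subrK.
  have -> : (fun i => (f k).2 i + (wl i - (f k).2 i)) = wl by apply/funext => i; rewrite addrC subrK.
  set Z := jac_app _ _ j => o1.
  have oZ : rord (e0 + k).+1 Z.
    apply: ord_ge_sum => t _; apply: (ord_ge_mull (@rdegD _ _)).
    exact: incr_rord (ul_ord k) (wl_ord k) t.
  set X := _ - _ - Z in o1.
  have -> : evalF ul wl j = X + evalF (f k).1 (f k).2 j + Z by rewrite /X; ring.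
  rewrite nfoD (nfoD _ X); apply: ord_geD; last exact: nf_ord.
  by apply: ord_geD => //; apply: nf_ord; exact: ord_ge_le o1.
have [ulc wlc] := small_convergent sml.
exists (fun i => y0 i + ul i), (fun m => z0 m + wl m); split; last exact: increment_congruent.
have [yp zp [ys zs] _] := sol.
split=> [i|m||j].
- by apply: (convergentD hv) => //; exact: (polynomial_convergent hv).
- by apply: (convergentD hv) => //; exact: (conv_polynomial_convergent hv).
- split=> [i|m]; rewrite /ps_const_coef ps_coefD.
    by rewrite [X in X + _]ys add0r; apply: ule; rewrite mdeg0.
  rewrite [X in X + _]zs add0r; apply: wle.
  have -> : (0 : mon xs) = mjoin 0 0 by apply/ffunP => -[i|i]; rewrite !ffunE.
  by rewrite /rdeg rmonE mdeg0.
- rewrite evalFE; apply: (nfo_eq0_extended hv) (NF0 j); exact: evalF_conv.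
Qed.

End Estimates.
End Iteration.

(** * Choice of the radii and conclusion *)

Lemma nrm_rdeg_scale (R : realType) (K : fieldType) (v : K -> R) (hv : real_valued_field v)
    (V W : finType) (wx : V -> R) (ws : W -> R) (x s : R) (f : powser (V + W)%type K) C :
  (forall i, 0 < wx i) -> (forall j, 0 < ws j) -> 0 < x -> 0 < s <= 1 -> ord_ge (@rdeg V W) 1 f ->
  nrm v (swt wx (fun j => x * ws j)) f C -> nrm v (swt wx (fun j => s * x * ws j)) f (s * C).
Proof.
move=> wx0 ws0 x0 /andP[s0 s1] f1; apply: (nrm_ord_scale hv f1 (ltW s0)) => c c0.
rewrite !mwt_swt !mwt_scale [leRHS]mulrCA; apply: ler_wpM2l; first exact/ltW/mwt_gt0.
rewrite [leRHS]mulrA; apply: ler_wpM2r; first exact/ltW/mwt_gt0.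
have := @exp_scale_le R (s * x) x (mdeg (rmon c)); rewrite mulfK ?gt_eqF //; apply=> //.
by rewrite mulr_gt0 //= ger_pMl.
Qed.

Theorem theorem3p4 (R : realType) (K : fieldType) (v : K -> R)
  (hv : real_valued_field v) (n l p q N : nat)
  (I : set (powser 'I_l K)) (hI : is_ideal (convergent v (V := 'I_l)) I)
  (F : 'I_N -> powser (('I_n + 'I_l) + ('I_p + 'I_q))%type K)
  (hF : forall i, convergent v (F i))
  (e0 : nat)
  (y0 : 'I_p -> powser 'I_l K) (z0 : 'I_q -> powser ('I_n + 'I_l)%type K)
  (h0 : solution_of_order v F I e0 y0 z0)
  (hext : forall e : nat, (e0 <= e)%N ->
     forall (y : 'I_p -> powser 'I_l K)
            (z : 'I_q -> powser ('I_n + 'I_l)%type K),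
       solution_of_order v F I e y z ->
       congruent v e0.+1 y y0 z z0 ->
       exists (u : 'I_p -> powser 'I_l K)
              (w : 'I_q -> powser ('I_n + 'I_l)%type K),
         [/\ forall j, polynomial_series (u j) /\ homogeneous e.+1 (u j),
             forall k, conv_polynomial_series v (w k) /\ homogeneous_right e.+1 (w k)
           & solution_of_order v F I e.+1
               (fun j => y j + u j) (fun k => z k + w k)]) :
  exists (y : 'I_p -> powser 'I_l K)
         (z : 'I_q -> powser ('I_n + 'I_l)%type K),
    analytic_solution v F I y z /\ congruent v e0.+1 y y0 z z0.
Proof.
have [y0p z0p [y00 z00] _] := h0.
have [CF0 [d [d0 dF]]] : exists C d, 0 < d /\ forall j, bounded v (mwt (fun=> d)) (ps_coef (F j)) C.
  have [C [d d0 dC]] := convergent_small_family hv (fun=> ltr01) hF.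
  exists C, (d * 1); rewrite mulr1; split=> // j.
  have dd : 0 < d <= d by rewrite d0 lexx.
  by apply: (bounded_le_wt hv) (dC d dd j) => a; rewrite !mwt_cst mulr1.
pose r := d / 3; pose CF := Num.max CF0 0.
have r0 : 0 < r by rewrite divr_gt0.
have r3 : 3 * r = d by rewrite /r mulrC divfK.
have CF_ge0 : 0 <= CF by rewrite le_max lexx orbT.
have FC j : bounded v (mwt (fun=> 3 * r)) (ps_coef (F j)) CF.
  by rewrite r3; apply: bounded_le (dF j); rewrite le_max lexx.
pose arg0 := nested_args y0 z0.
have arg0c t : convergent v (arg0 t).
  case: t => [t|[i|m]]; first exact: (convergent_mono hv (mdelta t)).
    exact: (convergent_lift hv _ (polynomial_convergent hv (y0p i))).
  exact: (conv_polynomial_convergent hv (z0p m)).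
have arg0_ord t : ord_ge (@mdeg _) 1 (arg0 t).
  move=> c; rewrite ltnS leqn0 => /eqP /mdeg_eq0 ->; case: t => [t|[i|m]]; last exact: z00.
    by rewrite /=; case: eqP => // /ffunP /(_ t); rewrite !ffunE eqxx.
  rewrite /=; case: eqP => // _; rewrite -[RHS](y00 i); congr (ps_coef (y0 i) _).
  by apply/ffunP => j; rewrite !ffunE.
pose b0 t : powser 'I_n K := ps_coef_right (arg0 t) 0.
have b0c t : convergent v (b0 t) by exact: (convergent_slice_right hv).
have b0_ord t : ord_ge (@mdeg _) 1 (b0 t).
  move=> c; rewrite ltnS leqn0 => /eqP /mdeg_eq0 ->; rewrite -(arg0_ord t 0) ?mdeg0 //.
  by congr (ps_coef (arg0 t) _); apply/ffunP => -[i|i]; rewrite !ffunE.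
have jac_c j t : convergent v (jac0 F y0 z0 j t).
  apply: (convergent_slice_right hv).
  have [d' d'0 d'b] := small_ord hv (fun=> ltr01) b0c b0_ord r0.
  have dd' : 0 < d' <= d' by rewrite d'0 lexx.
  have w0 (x : 'I_n + 'I_l) : 0 < swt (fun=> d' * 1) (fun=> 1 : R) x by case: x => // i /=; rewrite mulr1.
  apply: (convergent_nrm hv w0 (C := r^-1 * CF)).
  apply: (nrm_lin hv (fun x => ltW (w0 x)) r0 (FC j)) => t'.
  exact: (nrm_liftl hv _ (d'b d' dd' t')).
have [NF _] := normal_form_exists hv 'I_n hI.
have [ls _] := linear_section_exists hv 'I_l (LA := jacA F y0 z0) (LB := jacB F y0 z0)
  (fun j i => jac_c j _) (fun j k => jac_c j _).
have [x0 x00 lsb] := ls_nrm ls.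
have lw0 := ls_wt_gt0 ls; have nw0 := nf_wt_gt0 NF.
have sw0 (t : 'I_n + 'I_l) : 0 < swt (ls_wt ls) (nf_wt NF) t by case: t.
have [d1 d10 d1b] := small_ord hv lw0 b0c b0_ord r0.
have [C1 [d2 d20 d2b]] := convergent_small_family hv sw0 arg0c.
(* The four constraints are for the section, for [base] to have norm at most [r], for the arguments
   to be bounded, and for the normal form. The radii in x are final after this; those in s will be
   shrunk once more, by [s]. *)
pose x := Num.min (Num.min x0 d1) (Num.min d2 1).
have xp : 0 < x by rewrite /x !lt_min x00 d10 d20 ltr01.
have xx0 : 0 < x <= x0 by rewrite xp /x !ge_min lexx.
have xd1 : 0 < x <= d1 by rewrite xp /x !ge_min lexx orbT.
have xd2 : 0 < x <= d2 by rewrite xp /x !ge_min lexx !orbT.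
have x1 : x <= 1 by rewrite /x !ge_min lexx !orbT.
have [D D0 {}lsb] := lsb x xx0.
pose wx i := x * ls_wt ls i.
have wx0 i : 0 < wx i by rewrite mulr_gt0.
pose wt1 := swt wx (fun j => x * nf_wt NF j).
have wt1_ge0 t : 0 <= wt1 t by apply: swt_ge0 => // j; rewrite mulr_gt0.
(* [base] is free of s, so its bound holds whatever the radii in s are. *)
have baseb (ws : 'I_l -> R) t : nrm v (swt wx ws) (base y0 z0 t) r.
  exact: (nrm_liftl hv _ (d1b x xd1 t)).
have arg0b t : nrm v wt1 (arg0 t) C1.
  have := d2b x xd2 t; suff -> : (fun i => x * swt (ls_wt ls) (nf_wt NF) i) = wt1 by [].
  by apply/funext => -[].
pose C2 := C1 + r.
have difb t : nrm v wt1 (arg0 t - base y0 z0 t) C2.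
  by apply: (nrmB hv) => //; exact: baseb.
pose CH := CF + \sum_(t : ('I_n + 'I_l) + ('I_p + 'I_q)) (r^-1 * CF) * C2.
have valb j : nrm v wt1 (base_value F y0 z0 j) CH.
  apply: (nrmD hv) => //.
    apply: (nrm_subst hv wt1_ge0 (FC j)) => t; first exact: base_ord.
    by apply: bounded_le (baseb _ t); lra.
  apply: (nrm_sum hv) => // t _; apply: (nrmM hv) => //.
  by apply: (nrm_lin hv wt1_ge0 r0 (FC j)) => t'; exact: baseb.
pose CH' := Num.max CH 0; have CH'0 : 0 <= CH' by rewrite le_max lexx orbT.
pose C2' := Num.max C2 0; have C2'0 : 0 <= C2' by rewrite le_max lexx orbT.
have DC0 : 0 <= D * CF by rewrite mulr_ge0.
have DH0 : 0 <= D * CH' by rewrite mulr_ge0.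
(* The remainder costs 8 * D * CF * kap ^ 2, which is at most half of the budget kap * r if 16 * D *
   CF * kap is at most r. *)
pose kap := Num.min 2^-1 (r / (16 * (D * CF) + 1)).
have kap0 : 0 < kap by rewrite lt_min invr_gt0 ltr0n divr_gt0 // ltr_wpDl // mulr_ge0.
have kap1 : 2 * kap <= 1.
  have : kap <= 2^-1 by rewrite ge_min lexx.
  lra.
have kr0 : 0 < kap * r by rewrite mulr_gt0.
have kap2 : kap * (16 * (D * CF) + 1) <= r.
  by rewrite -ler_pdivlMr ?ltr_wpDl ?mulr_ge0 // ge_min lexx orbT.
(* The first quotient brings [arg0 t - base t] below kap * r. The second is for the constant part:
   truncation gains the factor [s] and the normal form costs a factor 2, so eta is s * (2 * CH'),
   and D * eta is at most the other half of kap * r. *)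
pose s := Num.min 1 (Num.min (kap * r / (C2' + 1)) (kap * r / (4 * (D * CH') + 1))).
have s0 : 0 < s by rewrite !lt_min ltr01 !divr_gt0 // ltr_wpDl // mulr_ge0.
have s1 : s <= 1 by rewrite ge_min lexx.
have s2 : s * (C2' + 1) <= kap * r.
  by rewrite -ler_pdivlMr ?ltr_wpDl // /s !ge_min lexx !orbT.
have s3 : s * (4 * (D * CH') + 1) <= kap * r.
  by rewrite -ler_pdivlMr ?ltr_wpDl ?mulr_ge0 // /s !ge_min lexx !orbT.
have s01 : 0 < s <= 1 by rewrite s0.
pose ws j := s * x * nf_wt NF j.
have ws0 j : 0 < ws j by rewrite !mulr_gt0.
have sx01 : 0 < s * x <= 1 by rewrite mulr_gt0 //= mulr_ile1 // ltW.
apply: (@approx_limit _ _ _ hv _ _ _ _ _ _ hI F y0 z0 e0 arg0_ord NF ls r CF kap D (s * (2 * CH')) wx ws) => //.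
- by move=> f C fC; exact: nf_nrm.
- by move=> f C C0 fC; exact: lsb.
- move=> t; apply: bounded_le (nrm_rdeg_scale hv wx0 nw0 xp s01 (arg0_base y0 z0 t) (difb t)).
  apply: (@le_trans _ _ (s * (C2' + 1))) => //; rewrite ler_wpM2l ?(ltW s0) //.
  have : C2 <= C2' by rewrite le_max lexx.
  lra.
- move=> j; apply: (nrm_rdeg_scale hv wx0 nw0 xp s01).
    by move=> c; rewrite ltnS leqn0 /= => /eqP ->.
  apply: (trunc_bound hv) => //.
    by move=> i; rewrite mulr_gt0.
  apply: nf_nrm => //; first by rewrite xp.
  by apply: bounded_le (valb j); rewrite le_max lexx.
- by rewrite !mulr_ge0 // ltW.
have -> : Num.max CF 0 = CF by apply/max_idPl.
have : D * (s * (2 * CH')) * 2 <= kap * r by lra.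
have : kap * (kap * (16 * (D * CF) + 1)) <= kap * r by rewrite ler_wpM2l // ltW.
have : 0 <= kap * kap by rewrite mulr_ge0 // ltW.
rewrite expr2; lra.
Qed.
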